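(* Let $V=M_{|a,b|}$ and $W=M_{|c,d|}$ be indecomposables in $\mathrm{rep}_k(A_{\mathbb R})$ such that $\mathrm{Hom}(V,W)\cong k$ and let $f:V\to W$ be a nonzero morphism. Then $\Gamma W$, $\Gamma\operatorname{coker}f$, $\Gamma[1]\ker f$, $\Gamma[1]V$, and possibly a point on one of the lines $y=\pm\frac\pi2$, are the corners of a rectangle in $\mathbb R^2$ whose sides have slope $\pm1$. (Here $\Gamma\operatorname{coker} f$ and $\Gamma[1]\ker f$ stand for the images of all indecomposable summands of $\operatorname{coker}f$ and $\ker f$.) Moreover, the slopes of the line segments that exist in the AR-space (those joining $W$ to an indecomposable summand of $\operatorname{coker}f$, or an indecomposable summand of $\ker f$ to $V$) are $\pm(1,1)$.
   Context: QUIVER. Fix a field $k$. A quiver of continuous type $A$ is a triple $A_{\mathbb R}=(\mathbb R,S,\preceq)$: $S\subset\mathbb R$ is a discrete (possibly empty) subset without accumulation points; $\bar S=S\cup\{\pm\infty\}$ with $-\infty<s<+\infty$ for $s\in S$; the elements of $\bar S$ are indexed in increasing order by a convex subset of $\mathbb Z\cup\{\pm\infty\}$ containing $0$, $s_n$ being the element of index $n$; $\preceq$ is the partial order on $\mathbb R$ for which two points are comparable only if they lie in a common closed interval between consecutive elements of $\bar S$, on each such interval $\preceq$ is $\le$ or its reverse, the direction reverses at each element of $S$, and $s_n$ is a sink ($\preceq$-minimal) if $n$ is even and a source ($\preceq$-maximal) if $n$ is odd. (An infinite $s_n$ with $n\in\mathbb Z$ is also called a sink or source according to the parity of $n$.)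 REPRESENTATIONS. A representation $V$ assigns a $k$-vector space $V(x)$ to each $x\in\mathbb R$ and a linear map $V(x,y):V(x)\to V(y)$ to each $y\preceq x$, with $V(x,z)=V(y,z)\circ V(x,y)$ for $z\preceq y\preceq x$. For an interval $I$, $M_I$ is the representation with $M_I(x)=k$ for $x\in I$ and $0$ otherwise, and identity maps between comparable points of $I$. $|a,b|$ denotes an interval with endpoints $a,b$ (possibly infinite) with unspecified inclusion of endpoints; a bracket at an infinite endpoint is read as open. The indecomposable projectives at $a$ are $P_a,P_{a)},P_{(a}$, the interval representations with supports $\{x\preceq a\}$, $\{x\preceq a,\ x<a\}$, $\{x\preceq a,\ x>a\}$ (when nonempty; also $P_{\pm\infty}$ when $\pm\infty$ is a source with finite index, with support the interval between $\pm\infty$ and the adjacent sink, sink included if finite); the indecomposable injectives $I_a,I_{a)},I_{(a}$ are dual, with $a\preceq x$ in place of $x\preceq a$. $\mathrm{rep}_k(A_{\mathbb R})$ is the category of pointwise finite-dimensional representations that are quotients of finite direct sums of indecomposable projectives. It is abelian and Krull-Schmidt, and its indecomposables are, up to isomorphism, representations $M_I$. THE MAP $\Gamma$. Put $\arctan(\pm\infty)=\pm\frac\pi2$. For $n\in\mathbb Z$ with $s_n\in\bar S$ put $y_n=\arctan s_n$, $x_0=0$, $x_n=\sum_{j=1}^n(-1)^{j+1}(\arctan s_j-\arctan s_{j-1})$ for $n>0$, $x_n=\sum_{j=1}^{-n}(-1)^j(\arctan s_{-j}-\arctan s_{-j+1})$ for $n<0$, and $(x_a,y_a)=(x_n,y_n)$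 if $a=s_n$. For $s_n<a<s_{n+1}$ let $t\in(0,1)$ with $\arctan a=(1-t)\arctan s_n+t\arctan s_{n+1}$ and $(x_a,y_a)=(1-t)(x_n,y_n)+t(x_{n+1},y_{n+1})$. Put $\kappa_a^-=x_a+y_a+\frac\pi2$, $\kappa_a^+=x_a-y_a-\frac\pi2$. Let $\lambda:\mathbb R\to\mathbb R$ be $2\pi$-periodic with $\lambda(w)=w-\frac\pi2$ on $[0,\pi]$ and $\lambda(w)=-w+\frac{3\pi}2$ on $[\pi,2\pi]$. The map $\Gamma$ from isomorphism classes of indecomposables of $\mathrm{rep}_k(A_{\mathbb R})$ to $\mathbb R\times[-\frac\pi2,\frac\pi2]$ is defined by: (G1) any projective indecomposable at $a$ goes to $(x_a,y_a)$; (G2) a simple injective $M_{\{s_n\}}$ ($s_n$ a source) goes to $(x_n+\pi,-y_n)$; (G3) a simple $M_{\{a\}}$, neither projective nor injective, with $s_n<a<s_{n+1}$, goes to $(x_a-y_a+\frac\pi2,\frac\pi2)$ if $s_n$ is a source and to $(x_a+y_a+\frac\pi2,-\frac\pi2)$ if $s_n$ is a sink; (G4) a nonprojective $M_{[s_n,s_{n+1}]}$ goes to $(x_{n+1}+y_{n+1}+\frac\pi2,-\frac\pi2)$ if $s_n$ is a source and to $(x_{n+1}-y_{n+1}+\frac\pi2,\frac\pi2)$ if $s_n$ is a sink; (G5) for any other $M_{|a,b|}$: if $a\in\mathbb R\setminus S$ with $s_n<a<s_{n+1}$, let $\kappa_a^*=\kappa_a^-$ if $s_n$ is a sink and $\kappa_a^*=\kappa_a^+$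 if $s_n$ is a source, and likewise for $b$; if $a\in S$, let $\kappa_a^*=\kappa_a^-$ if $a\in|a,b|$ and $\kappa_a^+$ otherwise; if $b\in S$, let $\kappa_b^*=\kappa_b^+$ if $b\in|a,b|$ and $\kappa_b^-$ otherwise; for infinite endpoints either choice of sign gives the same result. Then $\Gamma M_{|a,b|}=(x,y)$ with $x=\frac12(\kappa_a^*+\kappa_b^* )+n\pi$, $n=0$ if $\kappa_b^*=\kappa_b^-$, $n=1$ if $\kappa_b^*=\kappa_b^+$, and $y=\lambda(x-\kappa_a^* )=\lambda(x-\kappa_b^* )$. For an indecomposable $U$ with $\Gamma U=(x,y)$, $\Gamma[n]U=(x+n\pi,(-1)^ny)$. POSITIONS. A short exact sequence $0\to N\xrightarrow{f}E\xrightarrow{g}M\to0$ is an Auslander-Reiten sequence if $f$ is not a section, $g$ is not a retraction, $N,M$ are indecomposable, and every nontrivial morphism $N\to X$ (resp. $X\to M$) with $X$ indecomposable, $X\not\cong N$ (resp. $X\not\cong M$), factors through $f$ (resp. $g$). Each indecomposable $V$ has a position in $\{1,2,3,4\}$: (i) if the second coordinate of $\Gamma V$ is $\frac\pi2$ the position is 3, if it is $-\frac\pi2$ the position is 2; (ii) otherwise, $P_a$ has position 4, $P_{(a}$ position 2, $P_{a)}$ position 3, $I_a$ position 1, $I_{(a}$ position 3, $I_{a)}$ position 2; (iii) otherwise $V$ belongs to a unique Auslander-Reiten sequence $V_1\hookrightarrow V_2\oplus V_3\twoheadrightarrow V_4$ with all $V_i$ indecomposable, labelled so that the supports of $V_2$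 and $V_1$ have the same lower bound (including openness) and those of $V_3$ and $V_1$ the same upper bound (including openness); the position of $V\cong V_i$ is $i$. Positions are viewed as the corners $c_1=(0,0)$, $c_2=(1,1)$, $c_3=(1,-1)$, $c_4=(2,0)$ of a diamond with edges $12,13,24,34$. EXTRA GENERALIZED METRIC. $\mathbb R\oplus\mathbb Z$ is ordered lexicographically. $d(V,W)\in\mathbb R\oplus\mathbb Z$ has $\mathbb R$-coordinate the Euclidean distance of $\Gamma V,\Gamma W$. If $\Gamma V=\Gamma W$, its $\mathbb Z$-coordinate is the number (0, 1 or 2) of edges of the diamond between the positions. If $\Gamma V\ne\Gamma W$, let $r\in\mathbb R\cup\{\infty\}$ be the slope of the segment between them and name them so that $\Gamma V$ is to the left of $\Gamma W$ if $|r|\le1$ and below $\Gamma W$ if $|r|>1$; if $p,q$ are the positions of $V,W$, the $\mathbb Z$-coordinate is: for $|r|<1$, $f(q)-f(p)$ with $f(1)=0,f(2)=f(3)=1,f(4)=2$; for $|r|>1$, $g(q)-g(p)$ with $g(1)=g(4)=0,g(2)=1,g(3)=-1$; for $r=1$, the $(p,q)$ entry of $\begin{pmatrix}0&1&1&2\\-1&0&0&1\\0&1&0&1\\-1&0&-1&0\end{pmatrix}$; for $r=-1$, the $(p,q)$ entry of $\begin{pmatrix}0&1&1&2\\0&0&1&1\\-1&0&0&1\\-1&-1&0&0\end{pmatrix}$. The AR-space is the set of isomorphism classes of indecomposables with positions, $d$, and the topology whose open sets are $\Gamma^{-1}(U)$, $U\subset\mathbb R^2$ open. LINE SEGMENTS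 AND SLOPES. A line segment with endpoints $U,W$ is a set $l$ of indecomposables containing $U,W$ such that (1) $d(U,V)+d(V,W)=d(U,W)$ for all $V\in l$; (2) for $V_1,V_2,V_3\in l$, if $d(V_1,V_2)<d(V_1,V_3)$ and $d(V_2,V_3)<d(V_1,V_3)$ then $d(V_1,V_2)+d(V_2,V_3)=d(V_1,V_3)$; (3) $l$ is maximal with respect to (2). It is degenerate if $d(U,W)=(0,0)$. The slope of a nondegenerate $l$ is a pair $(r_1,r_2)$. If $\Gamma U\neq\Gamma W$, $r_1$ is the slope of the segment from $\Gamma U$ to $\Gamma W$; naming the endpoints so that $\Gamma U$ is left of $\Gamma W$ if $|r_1|\le1$ and below it if $|r_1|>1$, with positions $p,q$, $r_2$ is the slope of the line from $c_p$ to $c_q+o$, where $o=(2,0),(1,1),(1,-1),(0,2)$ for $|r_1|<1$, $r_1=1$, $r_1=-1$, $|r_1|>1$ respectively (if $c_p=c_q+o$, then $r_2=r_1$ when $r_1=\pm1$, $r_2=0$ when $|r_1|<1$, $r_2=\infty$ when $|r_1|>1$). If $\Gamma U=\Gamma W$, $r_2$ is the slope of the line through $c_p,c_q$ and $r_1=r_2$. $\pm(1,1)$ means $(1,1)$ or $(-1,-1)$.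
   Formalization: In (G5), at endpoints in S that are sinks, the two signs of κ* are exchanged, since the printed rule makes the claim false there; if f is an isomorphism, a point on each of the lines y=±π/2 is allowed; rectangles may have sides of length 0. *)

(* Defs.v *)
From Stdlib Require List.
From HB Require Import structures.
From mathcomp Require Import all_boot all_order all_algebra.
From mathcomp Require Import all_classical all_reals all_analysis.

Set Implicit Arguments.
Unset Strict Implicit.
Unset Printing Implicit Defensive.

Import Order.TTheory GRing.Theory Num.Theory.
Import numFieldNormedType.Exports.

Local Open Scope classical_set_scope.
Local Open Scope ring_scope.

(* [qidx] is the part in [int] of the convex index set of S u {-oo, +oo}.
   By convexity +oo has the index +oo exactly when [qidx] is unbounded above
   (then [qs] takes only values < +oo on [qidx]), and similarly for -oo; this
   is what [quiver_pinf] and [quiver_ninf] say. The value [qs n] is irrelevant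
   when [n] is not in [qidx]. *)
Record quiver (R : realType) := Quiver {
  qS : set R;
  qidx : set int;
  qs : int -> \bar R;
  quiver_discrete : limit_point qS = set0;
  quiver_idx0 : qidx 0;
  quiver_convex : forall m n p : int,
    qidx m -> qidx p -> m <= n <= p -> qidx n;
  quiver_incr : forall m n : int,
    qidx m -> qidx n -> m < n -> (qs m < qs n)%E;
  quiver_val : forall n : int, qidx n ->
    [\/ qs n = -oo%E, qs n = +oo%E | exists2 x, qS x & qs n = x%:E];
  quiver_onto : forall x : R, qS x -> exists2 n, qidx n & qs n = x%:E;
  quiver_pinf : (exists2 n, qidx n & qs n = +oo%E) \/
                (forall n, qidx n -> qidx (n + 1));
  quiver_ninf : (exists2 n, qidx n & qs n = -oo%E) \/
                (forall n, qidx n -> qidx (n - 1)) }.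

Definition odd_idx (n : int) : bool := odd `|n|%N.

Section Quiver.
Context {R : realType} (A : quiver R).

Definition is_sink (n : int) : Prop := qidx A n /\ ~~ odd_idx n.
Definition is_source (n : int) : Prop := qidx A n /\ odd_idx n.

Definition segment (n : int) : Prop := qidx A n /\ qidx A (n + 1).

Definition in_segment (n : int) (x : R) : Prop :=
  (qs A n <= x%:E <= qs A (n + 1))%E.

(* [qle y x] means that y is below x in the partial order of the quiver: it is
   the usual order on a segment [s_n, s_(n+1)] starting at a sink (n even) and
   the reverse order on one starting at a source. *)
Definition qle (y x : R) : Prop :=
  exists n : int, [/\ segment n, in_segment n y, in_segment n x &
                      if odd_idx n then x <= y else y <= x].

Lemma odd_idxS n : odd_idx (n + 1) = ~~ odd_idx n.
Proof.
rewrite /odd_idx; case: n => [n|n].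
- by rewrite addrC -intS !absz_nat.
- rewrite NegzE -[in LHS]addn1 PoszD opprD addrNK !abszN !absz_nat /=.
  by rewrite negbK.
Qed.

Lemma qs_le m n : qidx A m -> qidx A n -> m <= n -> (qs A m <= qs A n)%E.
Proof.
move=> Dm Dn; rewrite le_eqVlt => /predU1P[->//|lt_mn].
by apply/ltW/quiver_incr.
Qed.

Lemma qle_between z y x : qle z y -> qle y x ->
  (z <= y <= x) \/ (x <= y <= z).
Proof.
move=> [n [[Dn Dn1] /andP[nz zn] /andP[ny yn] zy]].
move=> [m [[Dm Dm1] /andP[my ym] /andP[mx xm] yx]].
have [lt_nm|lt_mn|eq_nm] := ltgtP n m; last first.
- by subst m; case: (odd_idx n) zy yx => zy yx; [right|left]; apply/andP.
- have le1 : m + 1 <= n by rewrite lezD1.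
  have le2 := qs_le Dm1 Dn le1.
  have e1 : qs A n = y%:E.
    by apply/eqP; rewrite eq_le ny (le_trans ym le2).
  have eq_mn : m + 1 = n.
    move: le1; rewrite le_eqVlt => /predU1P[//|lt1].
    have := quiver_incr Dm1 Dn lt1; rewrite e1 => lt2.
    by move: ym; rewrite leNgt lt2.
  move: nz; rewrite e1 lee_fin => le_yz.
  move: xm; rewrite eq_mn e1 lee_fin => le_xy.
  by right; apply/andP.
- have le1 : n + 1 <= m by rewrite lezD1.
  have le2 := qs_le Dn1 Dm le1.
  have e1 : qs A m = y%:E.
    by apply/eqP; rewrite eq_le my (le_trans yn le2).
  have eq_nm : n + 1 = m.
    move: le1; rewrite le_eqVlt => /predU1P[//|lt1].
    have := quiver_incr Dn1 Dm lt1; rewrite e1 => lt2.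
    by move: yn; rewrite leNgt lt2.
  move: mx; rewrite e1 lee_fin => le_yx.
  move: zn; rewrite eq_nm e1 lee_fin => le_zy.
  by left; apply/andP.
Qed.

End Quiver.

Section Representations.
Context {R : realType} (k : fieldType) (A : quiver R).

(* [rmap x y] is the map V(x,y), meaningful only for y below x. The identity
   axiom holds automatically for quotients of sums of interval representations. *)
Record rep := Rep {
  robj :> R -> vectType k;
  rmap : forall x y : R, 'Hom(robj x, robj y);
  rmap_id : forall x, rmap x x = \1%VF;
  rmap_comp : forall x y z, qle A z y -> qle A y x ->
    rmap x z = (rmap y z \o rmap x y)%VF }.

Record rhom (V W : rep) := RHom {
  rhom_fun :> forall x : R, 'Hom(V x, W x);
  rhom_nat : forall x y, qle A y x ->
    (rhom_fun y \o rmap V x y)%VF = (rmap W x y \o rhom_fun x)%VF }.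

Definition rhom_nonzero V W (f : rhom V W) : Prop := exists x, f x <> 0.

Definition is_section V W (f : rhom V W) : Prop :=
  exists r : rhom W V, forall x, (r x \o f x)%VF = \1%VF.

Definition is_retraction V W (f : rhom V W) : Prop :=
  exists r : rhom W V, forall x, (f x \o r x)%VF = \1%VF.

Definition is_iso V W (f : rhom V W) : Prop :=
  exists r : rhom W V, forall x,
    (r x \o f x)%VF = \1%VF /\ (f x \o r x)%VF = \1%VF.

Definition isomorphic V W : Prop := exists f : rhom V W, is_iso f.

Definition hom_iso_k V W : Prop :=
  exists e : k -> rhom V W,
    (forall a b c x, e (a * b + c) x = a *: e b x + e c x) /\
    (forall f : rhom V W, exists! c, forall x, e c x = f x).

Definition is_ker V W (f : rhom V W) (K : rep) (i : rhom K V) : Prop :=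
  forall x, lker (i x) = 0%VS /\ limg (i x) = lker (f x).

Definition is_coker V W (f : rhom V W) (Q : rep) (g : rhom W Q) : Prop :=
  forall x, lker (g x) = limg (f x) /\ limg (g x) = fullv.

Definition short_exact N E M (f : rhom N E) (g : rhom E M) : Prop :=
  forall x, [/\ lker (f x) = 0%VS, lker (g x) = limg (f x)
              & limg (g x) = fullv].

Section DirectSum.
Variables V W : rep.

Definition dsum_map x y (u : V x * W x) : V y * W y :=
  (rmap V x y u.1, rmap W x y u.2).

Lemma dsum_map_linear x y : linear (@dsum_map x y).
Proof. by move=> a u v; rewrite /dsum_map /= !linearP. Qed.

HB.instance Definition _ x y :=
  GRing.isLinear.Build k (V x * W x)%type (V y * W y)%type _
    (@dsum_map x y) (@dsum_map_linear x y).

Lemma dsum_id x : linfun (@dsum_map x x) = \1%VF.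
Proof.
by apply/lfunP => -[u v]; rewrite lfunE /= /dsum_map !rmap_id !id_lfunE.
Qed.

Lemma dsum_comp x y z : qle A z y -> qle A y x ->
  linfun (@dsum_map x z) = (linfun (@dsum_map y z) \o linfun (@dsum_map x y))%VF.
Proof.
move=> zy yx; apply/lfunP => -[u v].
by rewrite comp_lfunE !lfunE /= /dsum_map /= !(rmap_comp _ zy yx) !comp_lfunE.
Qed.

Definition dsum : rep :=
  @Rep (fun x => (V x * W x)%type : vectType k)
       (fun x y => linfun (@dsum_map x y)) dsum_id dsum_comp.
End DirectSum.

Lemma zero_id (x : R) : (0 : 'Hom('rV[k]_0, 'rV[k]_0)) = \1%VF.
Proof. by apply/lfunP => u; rewrite !thinmx0. Qed.

Lemma zero_comp (x y z : R) : qle A z y -> qle A y x ->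
  (0 : 'Hom('rV[k]_0, 'rV[k]_0)) = (0 \o (0 : 'Hom('rV[k]_0, 'rV[k]_0)))%VF.
Proof. by move=> _ _; apply/lfunP => u; rewrite !thinmx0. Qed.

Definition zero_rep : rep :=
  @Rep (fun _ => 'rV[k]_0 : vectType k) (fun _ _ => 0) zero_id zero_comp.

Definition dsums (Vs : seq rep) : rep := foldr dsum zero_rep Vs.

Record itvl := Itvl {
  iset :> set R;
  iset_itv : is_interval iset;
  iset_neq0 : iset !=set0 }.

Section IntervalRep.
Variable I : itvl.

(* M_I(x) is 'rV[k]_1 if x is in I and 'rV[k]_0 otherwise; the 1 x 1 matrix
   [const_mx 1] is the identity. *)
Definition Mdim (x : R) : nat := `[< iset I x >].
Definition Mmap (x y : R) : 'Hom('rV[k]_(Mdim x), 'rV[k]_(Mdim y)) :=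
  linfun (mulmxr (const_mx 1 : 'M[k]_(Mdim x, Mdim y))).

Lemma Mmap_id x : Mmap x x = \1%VF.
Proof.
apply/lfunP => u; rewrite lfunE id_lfunE /= -[RHS]mulmx1; congr (_ *m _).
by rewrite /Mdim; case: asboolP => _; apply/matrixP => i j;
  rewrite !mxE ?ord1 //; case: i.
Qed.

Lemma Mmap_comp x y z : qle A z y -> qle A y x ->
  Mmap x z = (Mmap y z \o Mmap x y)%VF.
Proof.
move=> zy yx; apply/lfunP => u; rewrite comp_lfunE !lfunE /= -mulmxA.
congr (_ *m _); apply/matrixP => i j; rewrite !mxE.
have Ix : iset I x by move: i {u}; rewrite /Mdim; case: asboolP => // _ [].
have Iz : iset I z by move: j {u}; rewrite /Mdim; case: asboolP => // _ [].
have Iy : iset I y.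
  by case: (qle_between zy yx) => le_y; [exact: (iset_itv Iz Ix)
    | exact: (iset_itv Ix Iz)].
rewrite (eq_bigr (fun=> 1)); last by move=> l _; rewrite !mxE mulr1.
by rewrite sumr_const card_ord /Mdim asboolT.
Qed.

Definition M : rep :=
  @Rep (fun x => 'rV[k]_(Mdim x) : vectType k) Mmap Mmap_id Mmap_comp.
End IntervalRep.

Definition supp_P (a : R) : set R := [set x | qle A x a].
Definition supp_Pl (a : R) : set R := [set x | qle A x a /\ x < a].
Definition supp_Pr (a : R) : set R := [set x | qle A x a /\ a < x].
Definition supp_I (a : R) : set R := [set x | qle A a x].
Definition supp_Il (a : R) : set R := [set x | qle A a x /\ x < a].
Definition supp_Ir (a : R) : set R := [set x | qle A a x /\ a < x].

(* [proj_at I e]: I is the support of an indecomposable projective at e. *)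
Definition proj_at (I : set R) (e : \bar R) : Prop :=
  match e with
  | EFin a => [\/ I = supp_P a, I = supp_Pl a | I = supp_Pr a]
  | +oo%E => exists2 n, is_source A n /\ qs A n = +oo%E &
                        I = [set x | (qs A (n - 1) <= x%:E)%E]
  | -oo%E => exists2 n, is_source A n /\ qs A n = -oo%E &
                        I = [set x | (x%:E <= qs A (n + 1))%E]
  end.

Definition inj_at (I : set R) (e : \bar R) : Prop :=
  match e with
  | EFin a => [\/ I = supp_I a, I = supp_Il a | I = supp_Ir a]
  | +oo%E => exists2 n, is_sink A n /\ qs A n = +oo%E &
                        I = [set x | (qs A (n - 1) <= x%:E)%E]
  | -oo%E => exists2 n, is_sink A n /\ qs A n = -oo%E &
                        I = [set x | (x%:E <= qs A (n + 1))%E]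
  end.

Definition is_proj (I : set R) : Prop := exists e, proj_at I e.
Definition is_inj (I : set R) : Prop := exists e, inj_at I e.

Definition in_repk (V : rep) : Prop :=
  exists ps : seq itvl, (forall P, List.In P ps -> is_proj P) /\
  exists p : rhom (dsums (map M ps)) V, forall x, limg (p x) = fullv.

(* The isomorphism classes of indecomposables of rep_k(A_R), that is the points
   of the AR-space: each of them contains M_I for exactly one interval I. *)
Record indec := Indec {
  indec_itv :> itvl;
  indec_in_repk : in_repk (M indec_itv) }.

(* Q is isomorphic to the direct sum of the M_C for C in cs, i.e. the list cs
   consists of the indecomposable summands of Q with their multiplicities. *)
Definition decomposes (Q : rep) (cs : seq indec) : Prop :=
  isomorphic Q (dsums [seq M (indec_itv C) | C <- cs]).

Definition eatan (e : \bar R) : R :=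
  match e with
  | EFin x => atan x
  | +oo%E => pi / 2
  | -oo%E => - (pi / 2)
  end.

Definition ycoord (n : int) : R := eatan (qs A n).

(* Negz m is -(m+1). *)
Definition xcoord (n : int) : R :=
  match n with
  | Posz m => \sum_(1 <= j < m.+1)
      (-1) ^+ j.+1 * (ycoord j%:Z - ycoord (j%:Z - 1))
  | Negz m => \sum_(1 <= j < m.+2)
      (-1) ^+ j * (ycoord (- j%:Z) - ycoord (- j%:Z + 1))
  end.

Definition is_coord (a : \bar R) (p : R * R) : Prop :=
  (exists2 n, qidx A n /\ qs A n = a & p = (xcoord n, ycoord n)) \/
  (exists n t, [/\ segment A n, (qs A n < a < qs A (n + 1))%E, 0 < t < 1,
     eatan a = (1 - t) * ycoord n + t * ycoord (n + 1) &
     p = ((1 - t) * xcoord n + t * xcoord (n + 1),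
          (1 - t) * ycoord n + t * ycoord (n + 1))]).

Definition coord (a : \bar R) : R * R := xget (0, 0) [set p | is_coord a p].

Definition kappaM (a : \bar R) : R := (coord a).1 + (coord a).2 + pi / 2.
Definition kappaP (a : \bar R) : R := (coord a).1 - (coord a).2 - pi / 2.

Definition lambda (w : R) : R :=
  let u := w - (Num.floor (w / (2 * pi)))%:~R * (2 * pi) in
  if u <= pi then u - pi / 2 else - u + 3 * pi / 2.

Definition lo (I : set R) : \bar R := ereal_inf (EFin @` I).
Definition hi (I : set R) : \bar R := ereal_sup (EFin @` I).
Definition has_lo (I : set R) : Prop := exists2 x, I x & x%:E = lo I.
Definition has_hi (I : set R) : Prop := exists2 x, I x & x%:E = hi I.

(* The sign in kappa^* for an endpoint: [lo_minus] (resp. [hi_minus]) holds when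
   it is minus. For an endpoint strictly between s_n and s_(n+1) it is minus if
   and only if s_n is a sink. At an endpoint s_n it is the sign of the nearby
   endpoints lying outside the interval if s_n belongs to the interval, and of
   the nearby endpoints lying inside otherwise. Thus at a source a lower endpoint
   has sign minus if and only if it is included, and an upper endpoint if and
   only if it is excluded; at a sink it is the other way around. (With the sign
   of a source at a sink s_0, the projective M_[a,s_0] and its nonisomorphic
   quotient M_[a,s_0[, s_(-1) < a < s_0, would have the same image under Gamma
   and the same position.) At an infinite endpoint both signs give the same value
   of Gamma. *)
Definition lo_minus (I : set R) : Prop :=
  (exists n, [/\ segment A n, (qs A n < lo I < qs A (n + 1))%E
               & ~~ odd_idx n]) \/
  (exists n, [/\ qidx A n, qs A n = lo I
               & if odd_idx n then has_lo I else ~ has_lo I]).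

Definition hi_minus (I : set R) : Prop :=
  (exists n, [/\ segment A n, (qs A n < hi I < qs A (n + 1))%E
               & ~~ odd_idx n]) \/
  (exists n, [/\ qidx A n, qs A n = hi I
               & if odd_idx n then ~ has_hi I else has_hi I]).

Definition kappa_lo (I : set R) : R :=
  if `[< lo_minus I >] then kappaM (lo I) else kappaP (lo I).

Definition kappa_hi (I : set R) : R :=
  if `[< hi_minus I >] then kappaM (hi I) else kappaP (hi I).

Definition gamma_x (I : set R) : R :=
  (kappa_lo I + kappa_hi I) / 2 + (if `[< hi_minus I >] then 0 else pi).

Definition segment_set (n : int) : set R := [set x | in_segment A n x].

Inductive is_Gamma (I : set R) : R * R -> Prop :=
| Gamma_proj e : proj_at I e -> is_Gamma I (coord e)
| Gamma_inj_simple n x : is_source A n -> qs A n = x%:E ->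
    I = [set x] -> is_inj I ->
    is_Gamma I (xcoord n + pi, - ycoord n)
| Gamma_simple n a : segment A n -> (qs A n < a%:E < qs A (n + 1))%E ->
    I = [set a] -> ~ is_proj I -> ~ is_inj I ->
    is_Gamma I
      (if odd_idx n
       then ((coord a%:E).1 - (coord a%:E).2 + pi / 2, pi / 2)
       else ((coord a%:E).1 + (coord a%:E).2 + pi / 2, - (pi / 2)))
| Gamma_segment n : segment A n -> I = segment_set n -> ~ is_proj I ->
    is_Gamma I
      (if odd_idx n
       then (xcoord (n + 1) + ycoord (n + 1) + pi / 2, - (pi / 2))
       else (xcoord (n + 1) - ycoord (n + 1) + pi / 2, pi / 2))
| Gamma_other : ~ is_proj I -> ~ (exists x, I = [set x]) ->
    ~ (exists2 n, segment A n & I = segment_set n) ->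
    is_Gamma I (gamma_x I, lambda (gamma_x I - kappa_lo I)).

Definition Gamma (I : set R) : R * R := xget (0, 0) [set p | is_Gamma I p].

Definition Gamma_shift (n : int) (I : set R) : R * R :=
  ((Gamma I).1 + n%:~R * pi, (-1) ^ n * (Gamma I).2).

Definition AR_sequence (N L : indec) (E : rep)
    (f : rhom (M N) E) (g : rhom E (M L)) : Prop :=
  [/\ short_exact f g, ~ is_section f, ~ is_retraction g,
      (forall (X : indec) (h : rhom (M N) (M X)), X <> N -> rhom_nonzero h ->
         exists h' : rhom E (M X), forall x, (h' x \o f x)%VF = h x) &
      (forall (X : indec) (h : rhom (M X) (M L)), X <> L -> rhom_nonzero h ->
         exists h' : rhom (M X) E, forall x, (g x \o h' x)%VF = h x)].

Definition same_lo (I J : set R) : Prop :=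
  lo I = lo J /\ (has_lo I <-> has_lo J).
Definition same_hi (I J : set R) : Prop :=
  hi I = hi J /\ (has_hi I <-> has_hi J).

Definition labelled_AR (V1 V2 V3 V4 : indec) : Prop :=
  (exists f g, @AR_sequence V1 V4 (dsum (M V2) (M V3)) f g) /\
  same_lo V2 V1 /\ same_hi V3 V1.

Definition proj_inj_position (V : indec) (p : nat) : Prop :=
  exists a : R,
  (iset V = supp_P a /\ p = 4%N) \/ (iset V = supp_Pr a /\ p = 2%N) \/
  (iset V = supp_Pl a /\ p = 3%N) \/ (iset V = supp_I a /\ p = 1%N) \/
  (iset V = supp_Ir a /\ p = 3%N) \/ (iset V = supp_Il a /\ p = 2%N).

Definition on_boundary (p : R * R) : Prop := p.2 = pi / 2 \/ p.2 = - (pi / 2).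

Inductive is_position (V : indec) : nat -> Prop :=
| Position_top : (Gamma V).2 = pi / 2 -> is_position V 3%N
| Position_bottom : (Gamma V).2 = - (pi / 2) -> is_position V 2%N
| Position_proj_inj p : ~ on_boundary (Gamma V) ->
    proj_inj_position V p -> is_position V p
| Position_AR V1 V2 V3 V4 p : ~ on_boundary (Gamma V) ->
    ~ (exists q, proj_inj_position V q) ->
    labelled_AR V1 V2 V3 V4 ->
    [\/ V = V1 /\ p = 1%N, V = V2 /\ p = 2%N, V = V3 /\ p = 3%N | V = V4 /\ p = 4%N] ->
    is_position V p.

Definition position (V : indec) : nat := xget 1%N [set p | is_position V p].

Definition corner (p : nat) : R * R :=
  match p with
  | 1 => (0, 0)
  | 2 => (1, 1)
  | 3 => (1, -1)
  | _ => (2, 0)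
  end.

Definition diamond_dist (p q : nat) : int :=
  if p == q then 0
  else if (p, q) \in [:: (1, 4); (4, 1); (2, 3); (3, 2)]%N then 2 else 1.

(* Slopes live in R u {oo}, with None for oo. *)
Definition slope (p q : R * R) : option R :=
  if p.1 == q.1 then None else Some ((q.2 - p.2) / (q.1 - p.1)).

(* p comes first: it is to the left of q if the slope r of the segment from p to
   q has |r| <= 1, and below q if |r| > 1. *)
Definition comes_first (p q : R * R) : bool :=
  match slope p q with
  | Some r => if `|r| <= 1 then p.1 < q.1 else p.2 < q.2
  | None => p.2 < q.2
  end.

Definition fpos (p : nat) : int :=
  match p with 1 => 0 | 2 => 1 | 3 => 1 | _ => 2 end.
Definition gpos (p : nat) : int :=
  match p with 2 => 1 | 3 => -1 | _ => 0 end.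

Definition entry (m : seq (seq int)) (p q : nat) : int :=
  nth 0 (nth [::] m p.-1) q.-1.

Definition mx_up : seq (seq int) :=
  [:: [:: 0; 1; 1; 2]; [:: -1; 0; 0; 1]; [:: 0; 1; 0; 1]; [:: -1; 0; -1; 0]].
Definition mx_down : seq (seq int) :=
  [:: [:: 0; 1; 1; 2]; [:: 0; 0; 1; 1]; [:: -1; 0; 0; 1]; [:: -1; -1; 0; 0]].

Definition zdist_dir (r : option R) (p q : nat) : int :=
  match r with
  | None => gpos q - gpos p
  | Some r => if r == 1 then entry mx_up p q
              else if r == -1 then entry mx_down p q
              else if `|r| < 1 then fpos q - fpos p
              else gpos q - gpos p
  end.

Definition zdist (V W : indec) : int :=
  if Gamma V == Gamma W then diamond_dist (position V) (position W)
  else if comes_first (Gamma V) (Gamma W)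
       then zdist_dir (slope (Gamma V) (Gamma W)) (position V) (position W)
       else zdist_dir (slope (Gamma V) (Gamma W)) (position W) (position V).

Definition dist (V W : indec) : R * int :=
  (Num.sqrt (((Gamma V).1 - (Gamma W).1) ^+ 2 +
             ((Gamma V).2 - (Gamma W).2) ^+ 2), zdist V W).

Definition dlt (a b : R * int) : bool :=
  (a.1 < b.1) || ((a.1 == b.1) && (a.2 < b.2)).

Definition segment_pre (U W : indec) (l : set indec) : Prop :=
  [/\ l U, l W,
      (forall V, l V -> dist U V + dist V W = dist U W) &
      (forall V1 V2 V3, l V1 -> l V2 -> l V3 ->
         dlt (dist V1 V2) (dist V1 V3) -> dlt (dist V2 V3) (dist V1 V3) ->
         dist V1 V2 + dist V2 V3 = dist V1 V3)].

Definition line_segment (U W : indec) (l : set indec) : Prop :=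
  segment_pre U W l /\
  (forall l', segment_pre U W l' -> l `<=` l' -> l' = l).

Definition degenerate (U W : indec) : Prop := dist U W = (0, 0).

Definition slope_offset (r : option R) : R * R :=
  match r with
  | None => (0, 2)
  | Some r => if r == 1 then (1, 1) else if r == -1 then (1, -1)
              else if `|r| < 1 then (2, 0) else (0, 2)
  end.

Definition slope2_dir (r : option R) (p q : nat) : option R :=
  let c := corner p in
  let c' := corner q + slope_offset r in
  if c == c' then
    match r with
    | None => None
    | Some r => if (r == 1) || (r == -1) then Some r
                else if `|r| < 1 then Some 0 else None
    end
  else slope c c'.

(* The slope (r_1, r_2) of a nondegenerate line segment, which depends only on
   its endpoints. *)
Definition seg_slope (U W : indec) : option R * option R :=
  if Gamma U == Gamma W then
    let r := slope (corner (position U)) (corner (position W)) in (r, r)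
  else
    let r := slope (Gamma U) (Gamma W) in
    (r, if comes_first (Gamma U) (Gamma W)
        then slope2_dir r (position U) (position W)
        else slope2_dir r (position W) (position U)).

Definition slope_pm11 (s : option R * option R) : Prop :=
  s = (Some 1, Some 1) \/ s = (Some (-1), Some (-1)).

(* The sides have slopes 1 and -1 and may have length 0: for instance, if the
   image of f : V -> W is simple then the rectangle attached to f is flat. *)
Definition pm1_rectangle (P : R * R) (s t : R) : seq (R * R) :=
  [:: P; P + (s, s); P + (t, - t); P + (s + t, s - t)].

End Representations.

(* Main.v *)
From HB Require Import structures.
Require Import Defs.
From mathcomp Require Import all_boot all_order all_algebra.
From mathcomp Require Import all_classical all_reals all_analysis.
From mathcomp Require Import zify ring lra.

(* Proof idea. In the coordinates u = x - y - pi/2 and v = x + y + pi/2 the strip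
   is u <= v <= u + 2 pi, the lines of slope 1 and -1 are the lines u = const and
   v = const, and [1] is (u, v) |-> (v, u + 2 pi). All the clauses (G1)-(G5) turn
   out to say the same: u depends only on the lower end of the interval and v
   only on the upper end, each end being viewed as a cut of the real line
   ([GammaE]). If V -> W is nonzero, then at each end either V and W have the same
   cut, or the part of V or W beyond the end of the other one is a summand of the
   kernel or cokernel; the direction of the arrows at the cut makes the new label
   of this summand that of W or of [1]V, and this gives the rectangle.
   Every label belongs to exactly two cuts, and the position of an interval
   records which of the two it has at each end ([positionE]). As W and a summand
   of the cokernel share a cut, they lie on a line of slope 1 or -1 and the
   corresponding coordinates of their positions agree. *)

Set Implicit Arguments.
Unset Strict Implicit.
Unset Printing Implicit Defensive.

Import Order.TTheory GRing.Theory Num.Theory.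
Import numFieldNormedType.Exports.

Local Open Scope classical_set_scope.
Local Open Scope ring_scope.

(** * Segments of the quiver *)

Section Segments.
Context {R : realType} (A : quiver R).
Implicit Types (m n : int) (a b : \bar R) (x y z : R).

(** The obstacle is that [Gamma] and [position] are picked by [xget] from relations, and that most
    positions refer to an arbitrary Auslander-Reiten sequence; so existence is needed as well as the
    value for every candidate. What makes this manageable is that the conditions [lo_le] and [hi_le]
    which a nonzero morphism imposes at the two ends are linear orders on the admissible cuts,
    compatible with the labels: at lower ends the odd cuts come first, from right to left, and then
    the even ones, from left to right; at upper ends the even cuts come first. Two cuts with one
    label are neighbours in these orders, and there are no other neighbours. Hence an
    Auslander-Reiten sequence has to step from the first to the second cut of such a pair at both
    ends, and the bit [csig] says which of the two a cut is. The corner of the diamond with bits i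
    and j is (i + j, j - i), the same linear map, up to scale, as from (u, v) to (x, y). Thus
    sharing a cut has the same effect on both components of a slope. *)

Lemma qs_lt m n : qidx A m -> qidx A n -> (qs A m < qs A n)%E = (m < n).
Proof.
move=> Dm Dn; apply/idP/idP => [|lt_mn]; last exact: quiver_incr.
by apply: contraTT; rewrite -!leNgt => /(qs_le Dn Dm).
Qed.

Lemma qs_inj m n : qidx A m -> qidx A n -> qs A m = qs A n -> m = n.
Proof.
move=> Dm Dn e; apply/eqP; rewrite eq_le !leNgt -(qs_lt Dn Dm) -(qs_lt Dm Dn).
by rewrite e ltxx.
Qed.

Lemma qidx_succ n : qidx A n -> (qs A n < +oo)%E -> qidx A (n + 1).
Proof.
move=> Dn lt_n; case: (quiver_pinf A) => [[m Dm em]|]; last exact.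
apply: (quiver_convex Dn Dm); rewrite lerDl ler01 /= lezD1.
by rewrite -(qs_lt Dn Dm) em.
Qed.

Lemma qidx_pred n : qidx A n -> (-oo < qs A n)%E -> qidx A (n - 1).
Proof.
move=> Dn lt_n; case: (quiver_ninf A) => [[m Dm em]|]; last exact.
have lt_mn : m < n by rewrite -(qs_lt Dm Dn) em.
by apply: (quiver_convex Dm Dn); apply/andP; split; lia.
Qed.

(** The infimum of the values [s * u n], multiplied back by [s], is a limit point; the sign [s]
    treats decreasing and increasing sequences at once. *)
Lemma monotone_limit_point (S : set R) (u : nat -> R) (s : R) :
  (s = 1 \/ s = -1) -> (forall n : nat, S (u n)) -> (forall n : nat, s * u n.+1 < s * u n) ->
  (exists x, forall n : nat, x < s * u n) -> limit_point S !=set0.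
Proof.
move=> hs Su decr [x lbx].
pose E := range (fun n : nat => s * u n).
have hE : has_inf E.
  by split; [exists (s * u 0%N); exists 0%N|exists x => _ [n _ <-]; apply/ltW].
have ss : s * s = 1 by case: hs => ->; lra.
exists (s * inf E) => W /nbhs_ballP[e /= e0 We].
have [_ [n _ <-] lt_n] := inf_adherent e0 hE.
have lb_n : inf E <= s * u n.+1 by apply: ge_inf; [exact: hE.2|exists n.+1].
have dn : s * u n.+1 < s * u n := decr n.
exists (u n); split=> //.
- apply/eqP => eq_n.
  have un_inf : s * u n = inf E by rewrite eq_n mulrA ss mul1r.
  by move: (le_lt_trans lb_n dn); rewrite un_inf ltxx.
- apply: We; rewrite /ball /=; rewrite ltr_norml.
  by case: hs ss lt_n lb_n dn => ->; move=> *; apply/andP; split; lra.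
Qed.

(** If [-oo] has no integer index, the indices go down forever; if all [qs A n] stayed at or above
    [x], they would accumulate, against [quiver_discrete]. *)
Lemma qs_lt_real x : exists2 n, qidx A n & (qs A n < x%:E)%E.
Proof.
case: (quiver_ninf A) => [[n Dn en]|Hpred]; first by exists n; rewrite ?en ?ltNyr.
apply: contrapT => no.
have ge_x n : qidx A n -> (x%:E <= qs A n)%E.
  by move=> Dn; rewrite leNgt; apply/negP => lt_n; apply: no; exists n.
(* The sequence starts at index -1 because [qs A 0] may be [+oo]. *)
have D k : qidx A (- k%:Z - 1).
  elim: k => [|k IH]; first by rewrite oppr0; exact/Hpred/quiver_idx0.
  by have := Hpred _ IH; congr (qidx A _); lia.
have val k : exists2 z, qS A z & qs A (- k%:Z - 1) = z%:E.
  case: (quiver_val (D k)) => // e.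
    by have := ge_x _ (D k); rewrite e.
  have := quiver_incr (D k) (quiver_idx0 A); rewrite e => /(_ ltac:(lia)).
  by rewrite ltNge leey.
pose u k := fine (qs A (- k%:Z - 1)).
have ue k : qs A (- k%:Z - 1) = (u k)%:E by rewrite /u; case: (val k) => z _ ->.
have [l] : limit_point (qS A) !=set0; last by rewrite quiver_discrete.
apply: (@monotone_limit_point _ u 1); first by left.
- by move=> k; case: (val k) => z Sz e; rewrite /u e.
- by move=> k; rewrite !mul1r -lte_fin -!ue; apply: quiver_incr => //; lia.
- exists (x - 1) => k; rewrite mul1r ltrBlDr.
  have := ge_x _ (D k); rewrite ue lee_fin => le_k.
  by apply: (le_lt_trans le_k); rewrite ltrDl.
Qed.

Lemma qs_gt_real x : exists2 n, qidx A n & (x%:E < qs A n)%E.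
Proof.
case: (quiver_pinf A) => [[n Dn en]|Hsucc]; first by exists n; rewrite ?en ?ltry.
apply: contrapT => no.
have le_x n : qidx A n -> (qs A n <= x%:E)%E.
  by move=> Dn; rewrite leNgt; apply/negP => lt_n; apply: no; exists n.
have D k : qidx A (k%:Z + 1).
  elim: k => [|k IH]; first by rewrite add0r; have := Hsucc _ (quiver_idx0 A); rewrite add0r.
  by have := Hsucc _ IH; congr (qidx A _); lia.
have val k : exists2 z, qS A z & qs A (k%:Z + 1) = z%:E.
  case: (quiver_val (D k)) => // e; last by have := le_x _ (D k); rewrite e.
  have := quiver_incr (quiver_idx0 A) (D k); rewrite e => /(_ ltac:(lia)).
  by rewrite ltNge leNye.
pose u k := fine (qs A (k%:Z + 1)).
have ue k : qs A (k%:Z + 1) = (u k)%:E by rewrite /u; case: (val k) => z _ ->.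
have [l] : limit_point (qS A) !=set0; last by rewrite quiver_discrete.
apply: (@monotone_limit_point _ u (-1)); first by right.
- by move=> k; case: (val k) => z Sz e; rewrite /u e.
- by move=> k; rewrite !mulN1r ltrN2 -lte_fin -!ue; apply: quiver_incr => //; lia.
- exists (- x - 1) => k; rewrite mulN1r.
  by have := le_x _ (D k); rewrite ue lee_fin => le_k; lra.
Qed.

Lemma last_true (P : pred nat) k : P 0%N -> ~~ P k -> exists2 j, P j & ~~ P j.+1.
Proof.
elim: k => [->//|k IH] P0 nP; case: (boolP (P k)) => Pk; first by exists k.
exact: IH.
Qed.

(** Applied to the properties of being [<= x] and [< x], it yields the segments just right and just
    left of [x]. *)
Lemma locate (P : pred (\bar R)) : (forall a b, (a <= b)%E -> P b -> P a) ->
  (exists2 n, qidx A n & P (qs A n)) -> (exists2 n, qidx A n & ~~ P (qs A n)) ->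
  exists n, [/\ segment A n, P (qs A n) & ~~ P (qs A (n + 1))].
Proof.
move=> Pmon [m Dm Pm] [p Dp Pp].
have lt_mp : m < p.
  by rewrite ltNge; apply: contra Pp => /(qs_le Dp Dm) le; exact: Pmon Pm.
have [d ed] : exists d : nat, p = m + d%:Z by exists `|p - m|%N; lia.
have D j : (j <= d)%N -> qidx A (m + j%:Z).
  by move=> le_j; apply: (quiver_convex Dm Dp); apply/andP; split; lia.
have [] := @last_true (fun j => (j <= d)%N && P (qs A (m + j%:Z))) d.+1.
- by rewrite addr0.
- by rewrite ltnn.
move=> j /andP[le_j Pj] nPj.
have lt_j : (j < d)%N.
  by rewrite ltn_neqAle le_j andbT; apply/eqP => e; move: Pp; rewrite ed -e Pj.
exists (m + j%:Z); move: nPj; rewrite lt_j /=.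
have -> : m + j.+1%:Z = m + j%:Z + 1 by lia.
have D1 : qidx A (m + j%:Z + 1).
  by have -> : m + j%:Z + 1 = m + j.+1%:Z; [lia|exact: D].
by split=> //; split=> //; exact: D.
Qed.

Lemma seg_right x : exists2 n, segment A n & (qs A n <= x%:E < qs A (n + 1))%E.
Proof.
have [m Dm lt_m] := qs_lt_real x; have [p Dp lt_p] := qs_gt_real x.
have mono a b : (a <= b)%E -> (b <= x%:E)%E -> (a <= x%:E)%E by exact: le_trans.
case: (@locate (fun a => (a <= x%:E)%E) mono) => [||n [Sn le_n gt_n]].
- by exists m => //; exact: ltW.
- by exists p => //; rewrite -ltNge.
by exists n => //; rewrite le_n ltNge gt_n.
Qed.

Lemma seg_left x : exists2 n, segment A n & (qs A n < x%:E <= qs A (n + 1))%E.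
Proof.
have [m Dm lt_m] := qs_lt_real x; have [p Dp lt_p] := qs_gt_real x.
have mono a b : (a <= b)%E -> (b < x%:E)%E -> (a < x%:E)%E by exact: le_lt_trans.
case: (@locate (fun a => (a < x%:E)%E) mono) => [||n [Sn le_n gt_n]].
- by exists m.
- by exists p => //; rewrite -leNgt ltW.
by exists n => //; rewrite le_n leNgt gt_n.
Qed.

End Segments.

(** * Cuts of the real line *)

Section CutOrder.
Context {R : realType}.
Implicit Types (a b : \bar R) (x y z : R).

(* [(a, false)] is the cut just below [a] and [(a, true)] the cut just above;
   the ends of the line are [(-oo, false)] and [(+oo, true)]. *)
Definition cut : Type := (\bar R * bool)%type.
Implicit Types c d e : cut.

Definition below c x : bool :=
  if c.2 then (c.1 < x%:E)%E else (c.1 <= x%:E)%E.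

(** The excluded pairs cut the line at the same places as [(-oo, false)] and [(+oo, true)]; without
    them a cut is determined by the points above it, see [below_inj]. *)
Definition proper c : bool :=
  (c != (-oo%E, true)) && (c != (+oo%E, false)).

Definition clt c d : bool :=
  ((c.1 < d.1)%E || [&& c.1 == d.1, ~~ c.2 & d.2]).

Lemma ereal_between a b : (a < b)%E -> exists x, (a < x%:E < b)%E.
Proof.
case: a => [a| |]; case: b => [b| |] //.
- rewrite lte_fin => lt_ab; exists ((a + b) / 2); rewrite !lte_fin.
  by apply/andP; split; lra.
- by move=> _; exists (a + 1); rewrite lte_fin ltrDl ltr01 ltry.
- by move=> _; exists (b - 1); rewrite lte_fin ltrBlDr ltrDl ltr01 ltNyr.
- by move=> _; exists 0; rewrite ltNyr ltry.
Qed.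

Lemma below_le c x y : x <= y -> below c x -> below c y.
Proof.
rewrite /below -lee_fin => le_xy; case: c.2 => h; first exact: lt_le_trans le_xy.
exact: le_trans le_xy.
Qed.

Lemma below_gt c x y : below c y -> ~~ below c x -> x < y.
Proof. by move=> cy; apply: contraNT; rewrite -leNgt => /below_le; apply. Qed.

Lemma clt_below c d x : clt c d -> below d x -> below c x.
Proof.
case: c d => [a s] [b t]; rewrite /clt /below /= => /orP[lt_ab|].
  have imp : (b <= x%:E)%E -> if s then (a < x%:E)%E else (a <= x%:E)%E.
    by move=> /(lt_le_trans lt_ab); case: s => // /ltW.
  by case: t => // /ltW.
by case/and3P => /eqP -> /negbTE -> -> /ltW.
Qed.

Lemma clt_total c d : c <> d -> clt c d \/ clt d c.
Proof.
case: c d => [a s] [b t]; rewrite /clt /= => ne.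
case: (ltgtP a b) => [||e]; [by left|by right|]; subst b.
by case: s t ne => -[] //= _; [right|left].
Qed.

Lemma clt_trans : transitive clt.
Proof.
move=> [b t] [a s] [c u]; rewrite /clt /=.
case/orP => [lt_ab|/and3P[/eqP -> h1 h2]] /orP[lt_bc|/and3P[/eqP <- h3 h4]].
- by rewrite (lt_trans lt_ab).
- by rewrite lt_ab.
- by rewrite lt_bc.
- by rewrite h2 in h3.
Qed.

Lemma clt_irr c : clt c c = false.
Proof. by rewrite /clt ltxx eqxx; case: c.2. Qed.

Lemma clt_asym c d : clt c d -> clt d c = false.
Proof. by move=> cd; apply/negP => /(clt_trans cd); rewrite clt_irr. Qed.

Lemma below_clt c d x : below c x -> ~~ below d x -> clt c d.
Proof.
move=> cx ndx; case: (pselect (c = d)) => [e|/clt_total[//|dc]].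
  by rewrite -e cx in ndx.
by rewrite (clt_below dc cx) in ndx.
Qed.

Lemma clt_between c d : proper c -> proper d -> clt c d ->
  exists2 x, below c x & ~~ below d x.
Proof.
case: c d => [a s] [b t]; rewrite /proper /clt /below /= => pc pd /orP[lt_ab|].
  case: (ereal_between lt_ab) => x /andP[ax xb]; exists x.
    by case: s {pc} => //; exact: ltW.
  by case: t {pd}; rewrite -?leNgt -?ltNge //; exact: ltW.
case/and3P => /eqP e; subst b; move: pc pd; case: s t => -[] //.
rewrite !xpair_eqE /=; case: a => //= r _ _ _ _.
by exists r; rewrite -?leNgt.
Qed.

Lemma below_inj c d : proper c -> proper d -> below c =1 below d -> c = d.
Proof.
move=> pc pd e; case: (pselect (c = d)) => // /clt_total[] lt.
  by case: (clt_between pc pd lt) => x; rewrite e => ->.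
by case: (clt_between pd pc lt) => x; rewrite e => ->.
Qed.

Definition itv c d : set R := [set x | below c x && ~~ below d x].

Lemma itv_interval c d : is_interval (itv c d).
Proof.
move=> x y /andP[cx dx] /andP[cy dy] z /andP[xz zy]; apply/andP; split.
  exact: below_le xz cx.
by apply: contra dy; exact: below_le.
Qed.

Lemma itv_clt c d x : itv c d x -> clt c d.
Proof. by case/andP; exact: below_clt. Qed.

Lemma itv_neq0 c d : proper c -> proper d -> clt c d -> itv c d !=set0.
Proof.
by move=> pc pd /(clt_between pc pd)[x cx dx]; exists x; apply/andP.
Qed.

Definition mkitv c d (pc : proper c) (pd : proper d) (cd : clt c d) : itvl :=
  Itvl (@itv_interval c d) (itv_neq0 pc pd cd).

(** An infinite infimum is never attained, so without the first conjunct an end at [-oo] would give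
    the improper cut [(-oo, true)]; similarly for [chi]. *)
Definition clo (I : set R) : cut := (lo I, `[< lo I <> -oo%E /\ ~ has_lo I >]).
Definition chi (I : set R) : cut := (hi I, `[< hi I = +oo%E \/ has_hi I >]).

Lemma proper_clo (I : @itvl R) : proper (clo I).
Proof.
rewrite /proper /clo !xpair_eqE; apply/andP; split; apply/negP => /andP[/eqP e].
  by rewrite e; case: asboolP => // -[].
have [x Ix] := iset_neq0 I.
have : (lo I <= x%:E)%E by apply: ereal_inf_lbound; exists x.
by rewrite e.
Qed.

Lemma proper_chi (I : @itvl R) : proper (chi I).
Proof.
rewrite /proper /chi !xpair_eqE; apply/andP; split; apply/negP => /andP[/eqP e].
  have [x Ix] := iset_neq0 I.
  have : (x%:E <= hi I)%E by apply: ereal_sup_ubound; exists x.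
  by rewrite e.
by case: asboolP => // h _; apply: h; left.
Qed.

Lemma itvlE (I : @itvl R) : iset I = itv (clo I) (chi I).
Proof.
apply/seteqP; split => x; rewrite /itv /= /below /=.
  move=> Ix.
  have le_lo : (lo I <= x%:E)%E by apply: ereal_inf_lbound; exists x.
  have le_hi : (x%:E <= hi I)%E by apply: ereal_sup_ubound; exists x.
  apply/andP; split.
    case: asboolP => // -[_ no]; rewrite lt_neqAle le_lo andbT.
    by apply/eqP => e; apply: no; exists x.
  case: asboolP => [_|no]; rewrite -?leNgt // -ltNge lt_neqAle le_hi andbT.
  by apply/eqP => e; apply: no; right; exists x.
case/andP => lo_x hi_x.
have [y Iy yx] : exists2 y, iset I y & y <= x.
  have lt_y : (lo I < x%:E)%E -> exists2 y, iset I y & y <= x.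
    move=> /ereal_inf_lt[_ [y Iy <-]]; rewrite lte_fin => /ltW; by exists y.
  move: lo_x; case: asboolP => [_ /lt_y//|h].
  rewrite le_eqVlt => /predU1P[e|/lt_y//].
  case: (pselect (has_lo I)) => [[y Iy ey]|no].
    by exists y => //; move: ey; rewrite e => -[->].
  by exfalso; apply: h; split=> //; rewrite e.
have [z Iz xz] : exists2 z, iset I z & x <= z.
  have lt_z : (x%:E < hi I)%E -> exists2 z, iset I z & x <= z.
    move=> /ereal_sup_gt[_ [z Iz <-]]; rewrite lte_fin => /ltW; by exists z.
  move: hi_x; case: asboolP => [h|_]; rewrite -?leNgt -?ltNge; last exact: lt_z.
  rewrite le_eqVlt => /predU1P[e|/lt_z//].
  case: h => [h|[z Iz ez]]; first by rewrite h in e.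
  by exists z => //; move: ez; rewrite -e => -[->].
by apply: (iset_itv Iy Iz); apply/andP.
Qed.

Lemma itvlP (I : @itvl R) x :
  iset I x <-> below (clo I) x && ~~ below (chi I) x.
Proof. by rewrite {1}itvlE. Qed.

Lemma clo_clt_chi (I : @itvl R) : clt (clo I) (chi I).
Proof. by have [x /itvlP] := iset_neq0 I; exact: itv_clt. Qed.

(** Left of a point of the interval only the lower cut decides membership, right of it only the
    upper one. This is how the cuts of an explicitly given support are read off. *)
Lemma itv_cuts (I : @itvl R) c d : proper c -> proper d -> iset I = itv c d ->
  clo I = c /\ chi I = d.
Proof.
move=> pc pd e; have [z Iz] := iset_neq0 I.
have H x : below (clo I) x && ~~ below (chi I) x = below c x && ~~ below d x.
  by apply/idP/idP => [/itvlP|h]; [rewrite e|apply/itvlP; rewrite e].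
have [cz dz] : below c z /\ ~~ below d z by move: Iz; rewrite e => /andP.
have [cz' dz'] : below (clo I) z /\ ~~ below (chi I) z by move/itvlP/andP: Iz.
split; apply: below_inj; rewrite ?proper_clo ?proper_chi // => x.
  case: (leP x z) => [xz|/ltW zx]; last by rewrite (below_le zx cz) (below_le zx cz').
  have nd g : ~~ below g z -> ~~ below g x by apply: contra; exact: below_le.
  by move: (H x); rewrite !nd // !andbT.
case: (leP z x) => [zx|/ltW xz].
  by move: (H x); rewrite (below_le zx cz) (below_le zx cz') /= => /negb_inj.
have nd g : ~~ below g z -> ~~ below g x by apply: contra; exact: below_le.
by rewrite !(negbTE (nd _ _)).
Qed.

End CutOrder.

(** * Cuts and arrows *)

Section CutIndex.
Context {R : realType} (A : quiver R).
Implicit Types (c d : @cut R) (m n : int) (x y z : R).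

(* [s_n^-] is given the index [n - 1] and [s_n^+] the index [n], also when
   [s_n] is infinite and there is no such segment. *)
Inductive cidx : @cut R -> int -> Prop :=
| Cidx_left n (a : R) : segment A n -> (qs A n < a%:E <= qs A (n + 1))%E ->
    cidx (a%:E, false) n
| Cidx_right n (a : R) : segment A n -> (qs A n <= a%:E < qs A (n + 1))%E ->
    cidx (a%:E, true) n
| Cidx_ninf n : segment A n -> qs A n = -oo%E -> cidx (-oo%E, false) (n - 1)
| Cidx_pinf n : segment A n -> qs A (n + 1) = +oo%E -> cidx (+oo%E, true) (n + 1).

(** An interval supports an object of the category if and only if both its cuts are of this kind
    ([adm_in_repk], [in_repk_adm]): an infinite end is allowed only if that infinity has an integer
    index. *)
Definition cadm c : Prop := exists n, cidx c n.

(* Arrows cross an odd cut from left to right and an even one from right to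
   left. *)
Definition codd c : bool := `[< exists2 n, cidx c n & odd_idx n >].

Lemma seg_inj_left m n (a : \bar R) : segment A m -> segment A n ->
  (qs A m < a <= qs A (m + 1))%E -> (qs A n < a <= qs A (n + 1))%E -> m = n.
Proof.
move=> [Dm Dm1] [Dn Dn1] /andP[m1 m2] /andP[n1 n2].
have := lt_le_trans m1 n2; have := lt_le_trans n1 m2.
by rewrite !qs_lt //; lia.
Qed.

Lemma seg_inj_right m n (a : \bar R) : segment A m -> segment A n ->
  (qs A m <= a < qs A (m + 1))%E -> (qs A n <= a < qs A (n + 1))%E -> m = n.
Proof.
move=> [Dm Dm1] [Dn Dn1] /andP[m1 m2] /andP[n1 n2].
have := le_lt_trans m1 n2; have := le_lt_trans n1 m2.
by rewrite !qs_lt //; lia.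
Qed.

Lemma cidx_inj c m n : cidx c m -> cidx c n -> m = n.
Proof.
move=> h; move: h n => -[{}m a|{}m a|{}m|{}m] Sm hm n h.
- by inversion h; subst; exact: seg_inj_left hm _.
- by inversion h; subst; exact: seg_inj_right hm _.
- inversion h as [| |p Sp hp e|]; congr (_ - 1).
  by apply: (qs_inj Sm.1 Sp.1); rewrite hm hp.
- inversion h as [| | |p Sp hp e]; apply: (qs_inj Sm.2 Sp.2).
  by rewrite hm hp.
Qed.

Lemma coddE c n : cidx c n -> codd c = odd_idx n.
Proof.
move=> cn; apply/asboolP/idP => [[m /(cidx_inj cn)-> //]|]; by exists n.
Qed.

Lemma cadm_proper c : cadm c -> proper c.
Proof. by case=> n []. Qed.

Lemma cadm_real x b : cadm (x%:E, b).
Proof.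
case: b; first by have [n Sn hn] := seg_right A x; exists n; exact: Cidx_right.
by have [n Sn hn] := seg_left A x; exists n; exact: Cidx_left.
Qed.

Lemma seg_ninf n : qidx A n -> qs A n = -oo%E -> segment A n.
Proof. by move=> Dn en; split=> //; apply: qidx_succ => //; rewrite en. Qed.

Lemma seg_pinf n : qidx A n -> qs A n = +oo%E -> segment A (n - 1).
Proof.
by move=> Dn en; split; rewrite ?subrK //; apply: qidx_pred => //; rewrite en.
Qed.

Lemma cadm_left n : qidx A n -> (qs A n < +oo)%E -> cadm (qs A n, false).
Proof.
move=> Dn lt; case: (quiver_val Dn) => [e|e|[x _ ->]]; last exact: cadm_real.
  by exists (n - 1); rewrite e; apply: Cidx_ninf => //; exact: seg_ninf.
by rewrite e in lt.
Qed.

Lemma cidx_left n : qidx A n -> (qs A n < +oo)%E -> cidx (qs A n, false) (n - 1).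
Proof.
move=> Dn lt; case: (quiver_val Dn) => [e|e|[x _ e]]; last 1 first.
- have Dn' : qidx A (n - 1) by apply: qidx_pred => //; rewrite e ltNyr.
  rewrite e; apply: Cidx_left; first by split; rewrite ?subrK.
  by rewrite subrK -e lexx andbT; apply: quiver_incr => //; lia.
- by rewrite e; apply: Cidx_ninf => //; exact: seg_ninf.
- by rewrite e in lt.
Qed.

Lemma cidx_right n : qidx A n -> (-oo < qs A n)%E -> cidx (qs A n, true) n.
Proof.
move=> Dn lt; case: (quiver_val Dn) => [e|e|[x _ e]]; last 1 first.
- have Dn' : qidx A (n + 1) by apply: qidx_succ => //; rewrite e ltry.
  rewrite e; apply: Cidx_right => //.
  by rewrite -e lexx; apply: quiver_incr => //; lia.
- by rewrite e in lt.
- rewrite e -[n](subrK 1); apply: Cidx_pinf; rewrite ?subrK //.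
  exact: seg_pinf.
Qed.

Lemma cidx_seg c n x z : segment A n -> in_segment A n x -> in_segment A n z ->
  ~~ below c x -> below c z -> cidx c n.
Proof.
case: c => [a b] Sn /andP[x1 x2] /andP[z1 z2]; rewrite /below /=.
have fin : forall r : \bar R, (x%:E <= r <= z%:E)%E -> exists a, r = a%:E.
  by move=> [r _|/andP[_]|/andP[]] //; exists r.
case: b; rewrite -?leNgt -?ltNge => h1 h2.
  have [r e] : exists r, a = r%:E by apply: fin; rewrite h1 ltW.
  subst a; apply: Cidx_right => //.
  by rewrite (le_trans x1 h1) (lt_le_trans h2 z2).
have [r e] : exists r, a = r%:E by apply: fin; rewrite h2 ltW.
subst a; apply: Cidx_left => //.
by rewrite (le_lt_trans x1 h1) (le_trans h2 z2).
Qed.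

(** The points are moved towards the cut until both lie in the closed segment carrying its index. A
    cut at infinity separates no points. *)
Lemma cross_seg c n x z : cidx c n -> ~~ below c x -> below c z ->
  exists x' z', [/\ x <= x', z' <= z, ~~ below c x' & below c z'] /\
    [/\ segment A n, in_segment A n x' & in_segment A n z'].
Proof.
case=> {c n} [n a Sn|n a Sn|n Sn e|n Sn e]; rewrite /below /= /in_segment.
- rewrite -?ltNge => /andP[n1 n2] xa az.
  have [w wa] : exists2 w, (x <= w) & (qs A n <= w%:E < a%:E)%E.
    case: (leP (qs A n) x%:E) => [le|gt]; first by exists x; rewrite // le xa.
    have [w /andP[h1 h2]] := ereal_between n1.
    exists w; last by rewrite h2 ltW.
    by rewrite -lee_fin ltW // (lt_trans gt h1).
  move=> /andP[nw lt_wa]; exists w, a.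
  rewrite -ltNge lexx lt_wa n2 (ltW n1) nw (le_trans (ltW lt_wa) n2).
  by split=> //; split=> //; rewrite -lee_fin.
- rewrite -?leNgt => /andP[n1 n2] xa az.
  have [w wz] : exists2 w, (w <= z) & (a%:E < w%:E <= qs A (n + 1))%E.
    case: (leP z%:E (qs A (n + 1))) => [le|gt]; first by exists z; rewrite // le az.
    have [w /andP[h1 h2]] := ereal_between n2.
    exists w; last by rewrite h1 ltW.
    by rewrite -lee_fin ltW // (lt_trans h2 gt).
  move=> /andP[lt_aw wn]; exists a, w.
  rewrite -leNgt lexx lt_aw n1 (ltW n2) wn (le_trans n1 (ltW lt_aw)).
  by split=> //; split=> //; rewrite -lee_fin.
- by rewrite leNye.
- by move=> _; rewrite ltNge leey.
Qed.

Lemma qle_seg n x y : segment A n -> in_segment A n x -> in_segment A n y ->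
  x <= y -> if odd_idx n then qle A y x else qle A x y.
Proof. by move=> Sn hx hy xy; case: ifP => o; exists n; split; rewrite ?o. Qed.

Lemma cross_qle c x z : cadm c -> ~~ below c x -> below c z ->
  exists x' z', [/\ x <= x', z' <= z, ~~ below c x' & below c z'] /\
    if codd c then qle A z' x' else qle A x' z'.
Proof.
move=> [n cn] nx bz; have [x' [z' [h [Sn hx hz]]]] := cross_seg cn nx bz.
exists x', z'; split=> //; rewrite (coddE cn); apply: qle_seg => //.
by case: h => _ _ nx' bz'; apply/ltW/(below_gt bz' nx').
Qed.

(** Comparable points share a closed segment, and a cut separating two points of a segment has the
    index of this segment. *)
Lemma qle_cross c x z : below c z -> ~~ below c x ->
  (qle A x z -> ~~ codd c) /\ (qle A z x -> codd c).
Proof.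
move=> bz nx; have lt_xz := below_gt bz nx.
split=> -[n [Sn h1 h2]].
  rewrite (coddE (cidx_seg Sn h1 h2 nx bz)); case: ifP => // _ le.
  by rewrite leNgt lt_xz in le.
rewrite (coddE (cidx_seg Sn h2 h1 nx bz)); case: ifP => // _ le.
by rewrite leNgt lt_xz in le.
Qed.

(** An interval is connected through arrows: the point reached is comparable to the next turning
    point, one segment at a time. This makes the scalar of a morphism constant and keeps the pieces
    of a kernel or cokernel from breaking up. *)
Lemma conn (P : set R) x y : x <= y ->
  (forall a b, x <= a <= y -> x <= b <= y -> qle A a b -> (P a <-> P b)) ->
  (P x <-> P y).
Proof.
have [m [Dm Dm1] /andP[mx xm1]] := seg_right A x.
have [n [Dn Dn1] /andP[ny yn1]] := seg_right A y.
move=> xy; have le_mn : m <= n.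
  by rewrite -ltzD1 -(qs_lt Dm Dn1) (le_lt_trans mx) // (le_lt_trans _ yn1).
have [k ek] : exists k : nat, n = m + k%:Z by exists `|n - m|%N; lia.
elim: k x m Dm Dm1 mx xm1 xy {le_mn} ek => [|k IH] x m Dm Dm1 mx xm1 xy ek H.
  rewrite addr0 in ek; subst n.
  have Hx : x <= x <= y by rewrite lexx.
  have Hy : x <= y <= y by rewrite lexx xy.
  have := @qle_seg m x y (conj Dm Dm1); rewrite /in_segment mx ny (ltW xm1) (ltW yn1).
  move/(_ isT isT xy); case: ifP => _ q; first by have [] := H _ _ Hy Hx q.
  by have [] := H _ _ Hx Hy q.
have le1 : m + 1 <= n by lia.
have ty := le_trans (qs_le Dm1 Dn le1) ny.
have [s es] : exists s, qs A (m + 1) = s%:E.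
  by move: ty xm1; case: (qs A (m + 1)) => [s _ _| |] //; exists s.
move: (ty) (xm1); rewrite es lee_fin lte_fin => sy /ltW xs.
have Hx : x <= x <= y by rewrite lexx.
have Hs : x <= s <= y by rewrite xs.
have Ps : P x <-> P s.
  have := @qle_seg m x s (conj Dm Dm1).
  rewrite /in_segment mx (ltW xm1) es lee_fin lexx (le_trans mx) // => /(_ isT isT xs).
  by case: ifP => _ q; [have [] := H _ _ Hs Hx q|have [] := H _ _ Hx Hs q].
have D2 : qidx A (m + 1 + 1) by apply: (quiver_convex Dm1 Dn1); apply/andP; split; lia.
rewrite Ps; apply: (IH s (m + 1)) => //.
- by rewrite es.
- by rewrite -es; apply: quiver_incr => //; lia.
- lia.
- move=> a b /andP[a1 a2] /andP[b1 b2]; apply: H.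
    by rewrite a2 (le_trans xs).
  by rewrite b2 (le_trans xs).
Qed.

End CutIndex.

(** * Labels of cuts *)

Section Labels.
Context {R : realType} (A : quiver R).
Implicit Types (a b : \bar R) (c d : @cut R) (m n : int) (x y z : R).

Lemma eatan_lt a b : (a < b)%E -> eatan a < eatan b.
Proof.
have hpi : (- (pi / 2) < pi / 2 :> R) by have := pi_gt0 R; lra.
case: a b => [a| |] [b| |] //= lt.
- exact: lt_atan.
- exact: atan_ltpi2.
- exact: atan_gtNpi2.
Qed.

Lemma eatan_le a b : (a <= b)%E -> eatan a <= eatan b.
Proof. by rewrite le_eqVlt => /predU1P[->//|/eatan_lt/ltW]. Qed.

Lemma eatan_bounds a : - (pi / 2) <= eatan a <= pi / 2.
Proof.
by have := eatan_le (leNye a); have := eatan_le (leey a) => /= -> ->.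
Qed.

Definition arrow_sign n : R := if odd_idx n then -1 else 1.

(** The sums for positive and for negative indices are two halves of one recurrence over all
    integers, and only this recurrence is used afterwards. *)
Lemma xcoordS n : xcoord A (n + 1) =
  xcoord A n + arrow_sign n * (ycoord A (n + 1) - ycoord A n).
Proof.
case: n => [n|n].
  have -> : Posz n + 1 = Posz n.+1 by lia.
  rewrite /xcoord big_nat_recr //= /arrow_sign /odd_idx /=; congr (_ + _ * (_ - _)).
    by rewrite -signr_odd /= negbK; case: odd; rewrite ?expr0 ?expr1.
  by congr ycoord; lia.
case: n => [|n].
  rewrite /xcoord /= big_nil big_nat1 /arrow_sign /odd_idx /= expr1.
  have -> : Negz 0 + 1 = 0 by [].
  have -> : Negz 0 = - 1%N%:Z by [].
  by lra.
have -> : Negz n.+1 + 1 = Negz n by lia.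
rewrite /xcoord [in RHS]big_nat_recr //= /arrow_sign /odd_idx.
have -> : - (n.+2)%:Z = Negz n.+1 by [].
have -> : Negz n.+1 + 1 = Negz n by lia.
have -> : (-1) ^+ n.+2 = (if odd `|Negz n.+1| then -1 else 1) :> R.
  by rewrite -signr_odd -[`|Negz n.+1|%N]/(n.+2); case: odd; rewrite ?expr0 ?expr1.
by ring.
Qed.

(** A turning point belongs to two segments. The affine formula holds up to both ends of a segment,
    so the clauses agree and the chosen coordinates are well defined. *)
Lemma is_coordE n a p : segment A n -> (qs A n <= a <= qs A (n + 1))%E ->
  is_coord A a p ->
  p = (xcoord A n + arrow_sign n * (eatan a - ycoord A n), eatan a).
Proof.
move=> Sn /andP[h1 h2] [[m [Dm em] ->]|[m [t [Sm /andP[m1 m2] _ -> ->]]]].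
  rewrite -em /ycoord; move: h1 h2; rewrite -em.
  rewrite le_eqVlt => /predU1P[e|lt1].
    by have -> := qs_inj Sn.1 Dm e; rewrite subrr mulr0 addr0.
  rewrite le_eqVlt => /predU1P[e|lt2].
    by have -> := qs_inj Dm Sn.2 e; rewrite xcoordS.
  move: lt1 lt2; rewrite (qs_lt Sn.1 Dm) (qs_lt Dm Sn.2); lia.
have e : n = m.
  have := le_lt_trans h1 m2; have := lt_le_trans m1 h2.
  by rewrite (qs_lt Sn.1 Sm.2) (qs_lt Sm.1 Sn.2); lia.
by subst m; congr (_, _); rewrite xcoordS; ring.
Qed.

Lemma is_coord_ex n a : segment A n -> (qs A n <= a <= qs A (n + 1))%E ->
  exists p, is_coord A a p.
Proof.
move=> Sn /andP[]; rewrite le_eqVlt => /predU1P[e _|lt1].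
  by exists (xcoord A n, ycoord A n); left; exists n => //; split=> //; exact: Sn.1.
rewrite le_eqVlt => /predU1P[e|lt2].
  exists (xcoord A (n + 1), ycoord A (n + 1)); left; exists (n + 1) => //.
  by split=> //; exact: Sn.2.
have y1 : ycoord A n < eatan a := eatan_lt lt1.
have y2 : eatan a < ycoord A (n + 1) := eatan_lt lt2.
pose t := (eatan a - ycoord A n) / (ycoord A (n + 1) - ycoord A n).
have d0 : 0 < ycoord A (n + 1) - ycoord A n by lra.
eexists; right; exists n, t; split=> //.
- by rewrite lt1 lt2.
- by rewrite /t; apply/andP; split; [apply: divr_gt0; lra|rewrite ltr_pdivrMr //; lra].
- by rewrite /t; field; rewrite gt_eqF.
Qed.

Lemma coordE n a : segment A n -> (qs A n <= a <= qs A (n + 1))%E ->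
  Defs.coord A a = (xcoord A n + arrow_sign n * (eatan a - ycoord A n), eatan a).
Proof.
move=> Sn h; apply: (is_coordE Sn h); have [p hp] := is_coord_ex Sn h.
exact: (xgetI _ hp).
Qed.

Definition on_segment n a : Prop := segment A n /\ (qs A n <= a <= qs A (n + 1))%E.

Definition aadm a : Prop := exists n, on_segment n a.

Lemma segment_bounds n : segment A n ->
  on_segment n (qs A n) /\ on_segment n (qs A (n + 1)).
Proof.
move=> Sn; have le : (qs A n <= qs A (n + 1))%E by apply: qs_le; [exact: Sn.1|exact: Sn.2|lia].
by split; split=> //; rewrite lexx ?andbT.
Qed.

Lemma aadm_qs n : qidx A n -> aadm (qs A n).
Proof.
move=> Dn; case: (ltP (qs A n) +oo%E) => [lt|].
  by exists n; apply: (segment_bounds _).1; split=> //; exact: qidx_succ.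
rewrite leye_eq => /eqP e; exists (n - 1).
have := (segment_bounds (seg_pinf Dn e)).2.
by rewrite subrK.
Qed.

Local Notation U := (kappaP A).
Local Notation V := (kappaM A).

Lemma kappaMP a : aadm a -> V a = U a + 2 * eatan a + pi.
Proof. by move=> [n [Sn h]]; rewrite /kappaM /kappaP (coordE Sn h) /=; lra. Qed.

(** The curve of the points [(x_a, y_a)] has slope 1 over an even segment and slope -1 over an odd
    one ([kappa_odd]). Hence only [kappaM] separates the points of an even segment and only [kappaP]
    those of an odd one, which dictates the choice in [lab_lo] and [lab_hi]. *)
Lemma kappa_even n a b : on_segment n a -> on_segment n b -> ~~ odd_idx n ->
  U a = U b /\ V b = V a + 2 * (eatan b - eatan a).
Proof.
move=> [Sn ha] [_ hb] /negbTE o; rewrite /kappaM /kappaP (coordE Sn ha) (coordE Sn hb).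
by rewrite /arrow_sign o /=; split; lra.
Qed.

Lemma kappa_odd n a b : on_segment n a -> on_segment n b -> odd_idx n ->
  V a = V b /\ U b = U a - 2 * (eatan b - eatan a).
Proof.
move=> [Sn ha] [_ hb] o; rewrite /kappaM /kappaP (coordE Sn ha) (coordE Sn hb).
by rewrite /arrow_sign o /=; split; lra.
Qed.

Lemma kappa_mono a b : aadm a -> aadm b -> (a <= b)%E -> V a <= V b /\ U b <= U a.
Proof.
have seg m (p q : \bar R) : on_segment m p -> on_segment m q -> (p <= q)%E ->
    V p <= V q /\ U q <= U p.
  move=> hx hy /eatan_le le; case: (boolP (odd_idx m)) => o.
    by have [-> ->] := kappa_odd hx hy o; lra.
  by have [-> ->] := kappa_even hx hy o; lra.
move=> [m ha] [n hb] ab.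
have [le_mn|lt_nm] := leP m n; last first.
  have e : a = b.
    apply/eqP; rewrite eq_le ab; case: hb ha => Sn /andP[_ hb] [Sm /andP[ha _]].
    by apply: (le_trans hb); apply: (le_trans _ ha); apply: qs_le; [exact: Sn.2|exact: Sm.1|lia].
  by subst b; rewrite !lexx.
have [k ek] : exists k : nat, n = m + k%:Z by exists `|n - m|%N; lia.
elim: k m a ha ab {le_mn} ek => [|k IH] m a ha ab ek.
  by rewrite addr0 in ek; subst n; exact: seg ha hb ab.
have Sm := ha.1; have [_ hs] := segment_bounds Sm.
have D2 : segment A (m + 1).
  split; first exact: Sm.2.
  by apply: (quiver_convex Sm.1 hb.1.2); apply/andP; split; lia.
have sb : (qs A (m + 1) <= b)%E.
  case: hb => -[Dn _] /andP[hb _]; apply: (le_trans _ hb).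
  by apply: qs_le => //; [exact: Sm.2|lia].
have [v1 u1] := seg _ _ _ ha hs (proj2 (andP ha.2)).
have [] := IH (m + 1) (qs A (m + 1)) _ sb _; [exact: (segment_bounds D2).1|lia|].
by split; lra.
Qed.

(** The gaps [U a <= V a] and [V b <= U b + 2 * pi] amount to [eatan a >= - (pi / 2)] and
    [eatan b <= pi / 2], so they close only at infinity. The chain places the labels in the
    strip. *)
Lemma kappa_bounds a b : aadm a -> aadm b -> (a <= b)%E ->
  [/\ U b <= U a, U a <= V a, V a <= V b & V b <= U b + 2 * pi].
Proof.
move=> ha hb ab; have [v u] := kappa_mono ha hb ab; split=> //.
  by rewrite (kappaMP ha); have /andP[] := eatan_bounds a; lra.
by rewrite (kappaMP hb); have /andP[] := eatan_bounds b; lra.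
Qed.

(** The last three inequalities say that [[a, b]] meets the even segment in more than a point, and
    [V] grows strictly there; [p] and [q] below are the ends of this overlap. *)
Lemma V_lt n a b : segment A n -> ~~ odd_idx n -> aadm a -> aadm b ->
  (a < b)%E -> (a < qs A (n + 1))%E -> (qs A n < b)%E -> V a < V b.
Proof.
move=> Sn o ha hb ab an nb.
have nn : (qs A n < qs A (n + 1))%E.
  by rewrite (qs_lt Sn.1 Sn.2); lia.
have [p [hp ap pb pn]] : exists p, [/\ on_segment n p, (a <= p)%E, (p < b)%E &
    (p < qs A (n + 1))%E].
  have [le|lt] := leP (qs A n) a; first by exists a; split=> //; split=> //; rewrite le ltW.
  by exists (qs A n); split=> //; [exact: (segment_bounds Sn).1|exact: ltW].
have [q [hq pq qb]] : exists q, [/\ on_segment n q, (p < q)%E & (q <= b)%E].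
  have [le|lt] := leP b (qs A (n + 1)).
    by exists b; split=> //; split=> //; rewrite le ltW.
  by exists (qs A (n + 1)); split=> //; [exact: (segment_bounds Sn).2|exact: ltW].
have hp' : aadm p by exists n.
have hq' : aadm q by exists n.
have [v1 _] := kappa_mono ha hp' ap; have [v2 _] := kappa_mono hq' hb qb.
by have [_ v] := kappa_even hp hq o; have := eatan_lt pq; lra.
Qed.

Lemma U_lt n a b : segment A n -> odd_idx n -> aadm a -> aadm b ->
  (a < b)%E -> (a < qs A (n + 1))%E -> (qs A n < b)%E -> U b < U a.
Proof.
move=> Sn o ha hb ab an nb.
have nn : (qs A n < qs A (n + 1))%E.
  by rewrite (qs_lt Sn.1 Sn.2); lia.
have [p [hp ap pb pn]] : exists p, [/\ on_segment n p, (a <= p)%E, (p < b)%E &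
    (p < qs A (n + 1))%E].
  have [le|lt] := leP (qs A n) a; first by exists a; split=> //; split=> //; rewrite le ltW.
  by exists (qs A n); split=> //; [exact: (segment_bounds Sn).1|exact: ltW].
have [q [hq pq qb]] : exists q, [/\ on_segment n q, (p < q)%E & (q <= b)%E].
  have [le|lt] := leP b (qs A (n + 1)).
    by exists b; split=> //; split=> //; rewrite le ltW.
  by exists (qs A (n + 1)); split=> //; [exact: (segment_bounds Sn).2|exact: ltW].
have hp' : aadm p by exists n.
have hq' : aadm q by exists n.
have [_ v1] := kappa_mono ha hp' ap; have [_ v2] := kappa_mono hq' hb qb.
by have [_ v] := kappa_odd hp hq o; have := eatan_lt pq; lra.
Qed.

Lemma cadm_aadm c : cadm A c -> aadm c.1.
Proof.
case=> n [{}n a Sn /andP[h1 h2]|{}n a Sn /andP[h1 h2]|{}n Sn e|{}n Sn e] /=.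
- by exists n; split=> //; rewrite (ltW h1).
- by exists n; split=> //; rewrite h1 ltW.
- by rewrite -e; apply: aadm_qs; exact: Sn.1.
- by rewrite -e; apply: aadm_qs; exact: Sn.2.
Qed.

Lemma odd_idxB n : odd_idx (n - 1) = ~~ odd_idx n.
Proof. by rewrite -[in RHS](subrK 1 n) odd_idxS negbK. Qed.

Lemma cut_ninf c : cadm A c -> c.1 = -oo%E -> c = (-oo%E, false) /\
  exists n, [/\ segment A n, qs A n = -oo%E & odd_idx n = ~~ codd A c].
Proof.
case=> m cm; move: (coddE cm); case: cm => // n Sn en -> _; split=> //.
by exists n; rewrite odd_idxB negbK.
Qed.

Lemma cut_pinf c : cadm A c -> c.1 = +oo%E -> c = (+oo%E, true) /\
  exists n, [/\ segment A n, qs A (n + 1) = +oo%E & odd_idx n = ~~ codd A c].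
Proof.
case=> m cm; move: (coddE cm); case: cm => // n Sn en -> _; split=> //.
by exists n; rewrite odd_idxS negbK.
Qed.

Lemma clt_le c d : clt c d -> (c.1 <= d.1)%E.
Proof. by rewrite /clt => /orP[/ltW//|/and3P[/eqP->]]. Qed.

Lemma kappaMPninf a : aadm a -> V a = U a -> a = -oo%E.
Proof.
move=> ha e; apply/eqP; rewrite -leeNy_eq leNgt; apply/negP => /eatan_lt /=.
by move: (kappaMP ha); rewrite e; lra.
Qed.

Lemma kappaMPpinf a : aadm a -> V a = U a + 2 * pi -> a = +oo%E.
Proof.
move=> ha e; apply/eqP; rewrite -leye_eq leNgt; apply/negP => /eatan_lt /=.
by move: (kappaMP ha); rewrite e; lra.
Qed.

(** Equality leaves no room for an even segment between the two points. An even cut [(_, true)] on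
    the left, or [(_, false)] on the right, has its even segment just inside, and [V] would grow
    along it. *)
Lemma V_cuts c d : cadm A c -> cadm A d -> clt c d ->
  ~~ codd A c -> ~~ codd A d ->
  V c.1 <= V d.1 /\ (V c.1 = V d.1 -> ~~ c.2 /\ d.2).
Proof.
move=> hc hd cd; have ac := cadm_aadm hc; have ad := cadm_aadm hd.
have [le_V _] := kappa_mono ac ad (clt_le cd).
move=> oc od; split=> // e.
have nlt : ~ V c.1 < V d.1 by rewrite e ltxx.
split; apply: contrapT => /negP; rewrite ?negbK => t; apply: nlt.
  have lt : (c.1 < d.1)%E by move: cd; rewrite /clt t /= andbF orbF.
  case: hc oc ac lt {e cd le_V} t => n cn; rewrite (coddE cn).
  case: cn => // [m a Sm /andP[h1 h2] o ac lt|m Sm _ _ _]; last by rewrite ltNge leey.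
  by move=> _; apply: (V_lt Sm) => //; exact: le_lt_trans lt.
have lt : (c.1 < d.1)%E by move: cd; rewrite /clt (negbTE t) !andbF orbF.
case: hd od ad lt {e cd le_V} t => n dn; rewrite (coddE dn).
case: dn => // [m a Sm /andP[h1 h2] o ad lt|m Sm _ _ _]; last by rewrite ltNge leNye.
by move=> _; apply: (V_lt Sm) => //; exact: lt_le_trans h2.
Qed.

Lemma U_cuts c d : cadm A c -> cadm A d -> clt c d ->
  codd A c -> codd A d ->
  U d.1 <= U c.1 /\ (U c.1 = U d.1 -> ~~ c.2 /\ d.2).
Proof.
move=> hc hd cd; have ac := cadm_aadm hc; have ad := cadm_aadm hd.
have [_ le_V] := kappa_mono ac ad (clt_le cd).
move=> oc od; split=> // e.
have nlt : ~ U d.1 < U c.1 by rewrite e ltxx.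
split; apply: contrapT => /negP; rewrite ?negbK => t; apply: nlt.
  have lt : (c.1 < d.1)%E by move: cd; rewrite /clt t /= andbF orbF.
  case: hc oc ac lt {e cd le_V} t => n cn; rewrite (coddE cn).
  case: cn => // [m a Sm /andP[h1 h2] o ac lt|m Sm _ _ _]; last by rewrite ltNge leey.
  by move=> _; apply: (U_lt Sm) => //; exact: le_lt_trans lt.
have lt : (c.1 < d.1)%E by move: cd; rewrite /clt (negbTE t) !andbF orbF.
case: hd od ad lt {e cd le_V} t => n dn; rewrite (coddE dn).
case: dn => // [m a Sm /andP[h1 h2] o ad lt|m Sm _ _ _]; last by rewrite ltNge leNye.
by move=> _; apply: (U_lt Sm) => //; exact: lt_le_trans h2.
Qed.

Lemma lt_of_le_ne (u v : R) : u <= v -> (u = v -> False) -> u < v.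
Proof. by rewrite le_eqVlt => /predU1P[e /(_ e)|]. Qed.

Lemma ninf_lt c d : cadm A c -> cadm A d -> c.1 = -oo%E -> (c.1 < d.1)%E ->
  if codd A c then V c.1 < V d.1 else U d.1 < U c.1.
Proof.
move=> hc hd ci lt; have [_ [n [Sn en on]]] := cut_ninf hc ci.
have lt1 : (c.1 < qs A (n + 1))%E by rewrite ci -en (qs_lt Sn.1 Sn.2); lia.
have lt2 : (qs A n < d.1)%E by rewrite en -ci.
case: ifP on => _ on.
  by apply: (V_lt Sn) => //; [rewrite on|exact: cadm_aadm|exact: cadm_aadm].
by apply: (U_lt Sn) => //; exact: cadm_aadm.
Qed.

Lemma pinf_lt c d : cadm A c -> cadm A d -> d.1 = +oo%E -> (c.1 < d.1)%E ->
  if codd A d then V c.1 < V d.1 else U d.1 < U c.1.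
Proof.
move=> hc hd di lt; have [_ [n [Sn en on]]] := cut_pinf hd di.
have lt1 : (qs A n < d.1)%E by rewrite di -en (qs_lt Sn.1 Sn.2); lia.
have lt2 : (c.1 < qs A (n + 1))%E by rewrite en -di.
case: ifP on => _ on.
  by apply: (V_lt Sn) => //; [rewrite on|exact: cadm_aadm|exact: cadm_aadm].
by apply: (U_lt Sn) => //; exact: cadm_aadm.
Qed.

(** Equality in [kappa_bounds] forces an end at infinity, which [ninf_lt] and [pinf_lt] exclude. So
    an even and an odd cut never have the same label. *)
Lemma UV_cuts c d : cadm A c -> cadm A d -> ~~ codd A c -> codd A d ->
  U d.1 < V c.1 < U d.1 + 2 * pi.
Proof.
move=> hc hd oc od; have ac := cadm_aadm hc; have ad := cadm_aadm hd.
have ne : c <> d by move=> e; rewrite e od in oc.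
have [cd|dc] := leP c.1 d.1.
  have [h1 h2 h3 h4] := kappa_bounds ac ad cd; apply/andP; split.
    apply: lt_of_le_ne => [|e]; first by lra.
    have ci : c.1 = -oo%E by apply: kappaMPninf => //; lra.
    have lt : (c.1 < d.1)%E.
      rewrite lt_neqAle cd andbT; apply/eqP => e2; apply: ne.
      by rewrite (cut_ninf hc ci).1 (cut_ninf hd _).1 // -e2.
    by have := ninf_lt hc hd ci lt; rewrite (negbTE oc); lra.
  apply: lt_of_le_ne => [|e]; first by lra.
  have di : d.1 = +oo%E by apply: kappaMPpinf => //; lra.
  have lt : (c.1 < d.1)%E.
    rewrite lt_neqAle cd andbT; apply/eqP => e2; apply: ne.
    by rewrite (cut_pinf hd di).1 (cut_pinf hc _).1 // e2.
  by have := pinf_lt hc hd di lt; rewrite od; lra.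
have [h1 h2 h3 h4] := kappa_bounds ad ac (ltW dc); apply/andP; split.
  apply: lt_of_le_ne => [|e]; first by lra.
  have di : d.1 = -oo%E by apply: kappaMPninf => //; lra.
  by have := ninf_lt hd hc di dc; rewrite od; lra.
apply: lt_of_le_ne => [|e]; first by lra.
have ci : c.1 = +oo%E by apply: kappaMPpinf => //; lra.
by have := pinf_lt hd hc ci dc; rewrite (negbTE oc); lra.
Qed.

(* The u-coordinate of the intervals with lower end c, and the v-coordinate of
   those with upper end c. *)
Definition lab_lo c : R := if codd A c then U c.1 else V c.1.
Definition lab_hi c : R := if codd A c then U c.1 + 2 * pi else V c.1.
(* Distinguishes the two cuts with the same label. *)
Definition csig c : bool := c.2 (+) codd A c.

Lemma lab_lo_inj c d : cadm A c -> cadm A d -> lab_lo c = lab_lo d -> c <> d ->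
  csig c <> csig d.
Proof.
move=> hc hd e ne.
wlog cd : c d hc hd e ne / clt c d.
  move=> W; case: (clt_total ne) => [/W|dc]; first exact.
  by move=> e'; apply: (W d c) => // e''; apply: ne.
move: e; rewrite /lab_lo /csig; case: ifP => oc; case: ifP => od.
- by move=> e; have [_ /(_ e)[/negbTE -> ->]] := U_cuts hc hd cd oc od.
- by move=> e; have := UV_cuts hd hc (negbT od) oc; rewrite e ltxx.
- by move=> e; have := UV_cuts hc hd (negbT oc) od; rewrite e ltxx.
- by move=> e; have [_ /(_ e)[/negbTE -> ->]] := V_cuts hc hd cd (negbT oc) (negbT od).
Qed.

Lemma lab_hi_inj c d : cadm A c -> cadm A d -> lab_hi c = lab_hi d -> c <> d ->
  csig c <> csig d.
Proof.
move=> hc hd e; apply: lab_lo_inj => //.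
move: e; rewrite /lab_lo /lab_hi; case: ifP => oc; case: ifP => od.
- by move=> /addIr.
- by move=> e; have := UV_cuts hd hc (negbT od) oc; rewrite e ltxx andbF.
- by move=> e; have := UV_cuts hc hd (negbT oc) od; rewrite e ltxx andbF.
- by [].
Qed.

Lemma lab_bounds c d : cadm A c -> cadm A d -> clt c d ->
  lab_lo c <= lab_hi d <= lab_lo c + 2 * pi.
Proof.
move=> hc hd cd.
have [h1 h2 h3 h4] := kappa_bounds (cadm_aadm hc) (cadm_aadm hd) (clt_le cd).
by rewrite /lab_lo /lab_hi; case: ifP => oc; case: ifP => od; apply/andP; split; lra.
Qed.

(** On the lower boundary line the position is 2 by definition, and these are the bits that [pos_of]
    sends to 2; [lab_top] is the counterpart for position 3. *)
Lemma lab_bottom c d : cadm A c -> cadm A d -> clt c d -> lab_lo c = lab_hi d ->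
  csig c = false /\ csig d = true.
Proof.
move=> hc hd cd.
have [h1 h2 h3 h4] := kappa_bounds (cadm_aadm hc) (cadm_aadm hd) (clt_le cd).
rewrite /lab_lo /lab_hi /csig; case: ifP => oc; case: ifP => od e.
- have ci : c.1 = -oo%E by apply: kappaMPninf; [exact: cadm_aadm|lra].
  have di : d.1 = +oo%E by apply: kappaMPpinf; [exact: cadm_aadm|lra].
  have lt : (c.1 < d.1)%E by rewrite ci di.
  by have := ninf_lt hc hd ci lt; rewrite oc; lra.
- by have := UV_cuts hd hc (negbT od) oc; lra.
- by have := UV_cuts hc hd (negbT oc) od; lra.
- by have [_ /(_ e)[/negbTE -> ->]] := V_cuts hc hd cd (negbT oc) (negbT od).
Qed.

Lemma lab_top c d : cadm A c -> cadm A d -> clt c d ->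
  lab_hi d = lab_lo c + 2 * pi -> csig c = true /\ csig d = false.
Proof.
move=> hc hd cd.
have [h1 h2 h3 h4] := kappa_bounds (cadm_aadm hc) (cadm_aadm hd) (clt_le cd).
rewrite /lab_lo /lab_hi /csig; case: ifP => od; case: ifP => oc e.
- have e' : U c.1 = U d.1 by lra.
  by have [_ /(_ e')[/negbTE -> ->]] := U_cuts hc hd cd oc od.
- by have := UV_cuts hc hd (negbT oc) od; lra.
- by have := UV_cuts hd hc (negbT od) oc; lra.
- have ci : c.1 = -oo%E by apply: kappaMPninf; [exact: cadm_aadm|lra].
  have di : d.1 = +oo%E by apply: kappaMPpinf; [exact: cadm_aadm|lra].
  have lt : (c.1 < d.1)%E by rewrite ci di.
  by have := ninf_lt hc hd ci lt; rewrite ifF //; lra.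
Qed.

End Labels.

(** * The map Gamma in terms of cuts *)

Section GammaFormula.
Context {R : realType} (A : quiver R).
Implicit Types (a b : R) (c d : @cut R) (m n : int) (x y z : R) (I : @itvl R).

Local Notation U := (kappaP A).
Local Notation V := (kappaM A).

(* [up] selects the points above a, which support injectives, instead of those
   below a, which support projectives. *)
Definition cmp (up : bool) x a : Prop := if up then qle A a x else qle A x a.

(** [m] is the segment just left of [a] and [n] the one just right of it; they are equal unless [a]
    is a turning point. *)
Definition at_cut m n a : Prop :=
  [/\ segment A m, (qs A m < a%:E <= qs A (m + 1))%E,
      segment A n & (qs A n <= a%:E < qs A (n + 1))%E].

Lemma at_cut_ex a : exists m n, at_cut m n a.
Proof.
by have [m Sm hm] := seg_left A a; have [n Sn hn] := seg_right A a; exists m, n.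
Qed.

Lemma qle_refl x : qle A x x.
Proof.
have [n Sn /andP[h1 h2]] := seg_right A x.
by exists n; split; rewrite /in_segment ?h1 ?(ltW h2) ?lexx ?if_same.
Qed.

Lemma cmp_lt m n a up x : at_cut m n a -> x < a ->
  cmp up x a <-> (odd_idx m == up) && (qs A m <= x%:E)%E.
Proof.
case=> Sm hm _ _ xa; have m1 := proj2 (andP hm).
have xm1 : (x%:E <= qs A (m + 1))%E by apply: le_trans m1; rewrite lee_fin ltW.
have eqm p : segment A p -> in_segment A p x -> in_segment A p a -> p = m.
  move=> Sp /andP[h1 _] /andP[_ h2]; apply: (seg_inj_left Sp Sm _ hm).
  by rewrite h2 (le_lt_trans h1).
have seg_m : (qs A m <= x%:E)%E -> in_segment A m x /\ in_segment A m a.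
  by move=> h; rewrite /in_segment h xm1 m1 (le_trans h) // lee_fin ltW.
rewrite /cmp; case: up; split.
- move=> [p [Sp ha hx]]; rewrite (eqm p) //; case: ifP => _ h.
    by move: (hx); rewrite (eqm p Sp hx ha) => /andP[].
  by rewrite leNgt xa in h.
- move=> /andP[/eqP o /seg_m[hx ha]]; exists m; split=> //.
  by rewrite o ltW.
- move=> [p [Sp hx ha]]; rewrite (eqm p) //; case: ifP => _ h.
    by rewrite leNgt xa in h.
  by move: (hx); rewrite (eqm p Sp hx ha) => /andP[].
- move=> /andP[/eqP o /seg_m[hx ha]]; exists m; split=> //.
  by rewrite o ltW.
Qed.

Lemma cmp_gt m n a up x : at_cut m n a -> a < x ->
  cmp up x a <-> (odd_idx n != up) && (x%:E <= qs A (n + 1))%E.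
Proof.
case=> _ _ Sn hn ax; have n1 := proj1 (andP hn).
have nx : (qs A n <= x%:E)%E by apply: (le_trans n1); rewrite lee_fin ltW.
have eqsn p : segment A p -> in_segment A p x -> in_segment A p a -> p = n.
  move=> Sp /andP[_ h1] /andP[h2 _]; apply: (seg_inj_right Sp Sn _ hn).
  by rewrite h2 (lt_le_trans _ h1).
have seg_n : (x%:E <= qs A (n + 1))%E -> in_segment A n x /\ in_segment A n a.
  by move=> h; rewrite /in_segment h nx n1 (ltW (proj2 (andP hn))).
rewrite /cmp; case: up; split.
- move=> [p [Sp ha hx]]; rewrite (eqsn p) //; case: ifP => _ h.
    by rewrite leNgt ax in h.
  by move: (hx); rewrite (eqsn p Sp hx ha) => /andP[].
- move=> /andP[ho /seg_n[hx ha]]; exists n; split=> //.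
  by rewrite (negbTE (_ : ~~ odd_idx n)) ?ltW //; case: odd_idx ho.
- move=> [p [Sp hx ha]]; rewrite (eqsn p) //; case: ifP => _ h.
    by move: (hx); rewrite (eqsn p Sp hx ha) => /andP[].
  by rewrite leNgt ax in h.
- move=> /andP[ho /seg_n[hx ha]]; exists n; split=> //.
  by rewrite (_ : odd_idx n) ?ltW //; case: odd_idx ho.
Qed.

Lemma cmp_refl up a : cmp up a a.
Proof. by rewrite /cmp if_same; exact: qle_refl. Qed.

Lemma cmp_set m n a up : at_cut m n a ->
  [set x | cmp up x a] =
  itv (if odd_idx m == up then (qs A m, false) else (a%:E, false))
      (if odd_idx n != up then (qs A (n + 1), true) else (a%:E, true)).
Proof.
move=> h; have [Sm /andP[m1 m2] Sn /andP[n1 n2]] := h.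
apply/seteqP; split=> x; rewrite /itv /=; case: (ltgtP x a) => [xa|ax|->].
- move=> /(cmp_lt up h xa)/andP[-> mx].
  rewrite {1}/below /= mx /=; case: ifP => _; rewrite /below /= -leNgt.
    by rewrite (le_trans _ (ltW n2)) // lee_fin ltW.
  by rewrite lee_fin ltW.
- move=> /(cmp_gt up h ax)/andP[-> mx].
  case: ifP => _; rewrite /below /= -leNgt mx andbT.
    by rewrite (le_trans (ltW m1)) // lee_fin ltW.
  by rewrite lee_fin ltW.
- by move=> _; do 2 case: ifP => _; rewrite /below /= -leNgt ?lexx ?(ltW m1) ?(ltW n2).
- case: (boolP (odd_idx m == up)) => o.
    by move=> /andP[h1 _]; apply/(cmp_lt up h xa); rewrite o.
  by rewrite {1}/below /= lee_fin leNgt xa.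
- case: (boolP (odd_idx n != up)) => o.
    by rewrite [X in ~~ X]/below /= -leNgt => /andP[_ h2]; apply/(cmp_gt up h ax); rewrite o.
  by rewrite [X in ~~ X]/below /= lte_fin ax andbF.
- by move=> _; exact: cmp_refl.
Qed.

Lemma cmp_set_lt m n a up : at_cut m n a ->
  [set x | cmp up x a /\ x < a] =
  if odd_idx m == up then itv (qs A m, false) (a%:E, false) else set0.
Proof.
move=> h; apply/seteqP; split=> x.
  case=> + xa; move/(cmp_lt up h xa)/andP => [-> mx].
  by rewrite /itv /= /below /= mx lee_fin leNgt xa.
case: ifP => // o /andP[h1]; rewrite /below /= lee_fin -ltNge => xa.
by split=> //; apply/(cmp_lt up h xa); rewrite o.
Qed.

Lemma cmp_set_gt m n a up : at_cut m n a ->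
  [set x | cmp up x a /\ a < x] =
  if odd_idx n != up then itv (a%:E, true) (qs A (n + 1), true) else set0.
Proof.
move=> h; apply/seteqP; split=> x.
  case=> + ax; move/(cmp_gt up h ax)/andP => [-> mx].
  by rewrite /itv /= /below /= lte_fin ax -leNgt.
case: ifP => // o /andP[]; rewrite /below /= lte_fin => ax; rewrite -leNgt => h1.
by split=> //; apply/(cmp_gt up h ax); rewrite o.
Qed.

Lemma cidx_lt m n a : at_cut m n a -> cidx A (a%:E, false) m.
Proof. by case=> Sm hm _ _; exact: Cidx_left. Qed.

Lemma cidx_gt m n a : at_cut m n a -> cidx A (a%:E, true) n.
Proof. by case=> _ _ Sn hn; exact: Cidx_right. Qed.

Lemma cidx_qs_lt m : segment A m -> cidx A (qs A m, false) (m - 1).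
Proof.
move=> Sm; apply: cidx_left; first exact: Sm.1.
by apply: (@lt_le_trans _ _ (qs A (m + 1))); rewrite ?leey // (qs_lt Sm.1 Sm.2); lia.
Qed.

Lemma cidx_qs_gt n : segment A n -> cidx A (qs A (n + 1), true) (n + 1).
Proof.
move=> Sn; apply: cidx_right; first exact: Sn.2.
by apply: (@le_lt_trans _ _ (qs A n)); rewrite ?leNye // (qs_lt Sn.1 Sn.2); lia.
Qed.

Lemma cidx_proper c n : cidx A c n -> proper c.
Proof. by move=> h; apply: (@cadm_proper _ A); exists n. Qed.

(** For [up = false] the two labels are those of the projective at [e]; for [up = true] they are
    those of its image under [1], which is where the injective at [e] lies. *)
Definition lab_lo_at up (e : \bar R) : R := if up then V e else U e.
Definition lab_hi_at up (e : \bar R) : R := if up then U e + 2 * pi else V e.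

(** If the support extends to the end of the segment left of [a], its cut is there and not at [a],
    but the kappa in question is constant on this segment. *)
Lemma lo_full m n a up : at_cut m n a ->
  let c := if odd_idx m == up then (qs A m, false) else (a%:E, false) in
  [/\ proper c, csig A c = ~~ up & lab_lo A c = lab_lo_at up a%:E].
Proof.
move=> h; have [Sm hm Sn hn] := h; rewrite /csig /lab_lo /lab_lo_at.
case: (eqVneq (odd_idx m) up) => [<-|ne] /=.
  have cm := cidx_qs_lt Sm; rewrite (coddE cm) odd_idxB; split=> //.
    exact: cidx_proper cm.
  have am : on_segment A m a%:E by split=> //; case/andP: hm => /ltW -> ->.
  have qm := (segment_bounds Sm).1.
  case: (boolP (odd_idx m)) => o /=.
    exact: (kappa_odd qm am o).1.
  exact: (kappa_even qm am o).1.
have cm := cidx_lt h; rewrite (coddE cm).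
by case: (odd_idx m) up ne => -[].
Qed.

Lemma hi_full m n a up : at_cut m n a ->
  let c := if odd_idx n != up then (qs A (n + 1), true) else (a%:E, true) in
  [/\ proper c, csig A c = ~~ up & lab_hi A c = lab_hi_at up a%:E].
Proof.
move=> h; have [Sm hm Sn hn] := h; rewrite /csig /lab_hi /lab_hi_at.
case: (eqVneq (odd_idx n) up) => [<-|ne] /=.
  have cn := cidx_gt h; rewrite (coddE cn).
  by split=> //; case: (odd_idx n).
have cn := cidx_qs_gt Sn; rewrite (coddE cn) odd_idxS; split=> //.
- exact: cidx_proper cn.
- by case: (odd_idx n) up ne => -[].
have an : on_segment A n a%:E by split=> //; case/andP: hn => -> /ltW.
have qn := (segment_bounds Sn).2.
case: (boolP (odd_idx n)) ne => o; case: up => //= _.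
  by rewrite (kappa_odd an qn o).1.
by rewrite (kappa_even an qn o).1.
Qed.

Lemma full_labels I a up : iset I = [set x | cmp up x a] ->
  [/\ csig A (clo I) = ~~ up, csig A (chi I) = ~~ up,
      lab_lo A (clo I) = lab_lo_at up a%:E & lab_hi A (chi I) = lab_hi_at up a%:E].
Proof.
have [m [n h]] := at_cut_ex a; rewrite (cmp_set up h).
have [p1 s1 l1] := lo_full up h; have [p2 s2 l2] := hi_full up h.
by move=> /(itv_cuts p1 p2)[-> ->].
Qed.

Lemma left_cuts I a up : iset I = [set x | cmp up x a /\ x < a] ->
  exists m n, [/\ at_cut m n a, odd_idx m = up, clo I = (qs A m, false) &
  chi I = (a%:E, false)].
Proof.
have [m [n h]] := at_cut_ex a; rewrite (cmp_set_lt up h).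
case: eqP => [ho e|_ e]; last by have [x] := iset_neq0 I; rewrite e.
exists m, n; have [] := itv_cuts _ _ e => //.
by have [Sm _ _ _] := h; exact: cidx_proper (cidx_qs_lt Sm).
Qed.

Lemma left_labels I a up : iset I = [set x | cmp up x a /\ x < a] ->
  [/\ csig A (clo I) = ~~ up, csig A (chi I) = up,
      lab_lo A (clo I) = lab_lo_at up a%:E & lab_hi A (chi I) = lab_hi_at up a%:E].
Proof.
move=> /left_cuts[m [n [h o -> ->]]].
have [p1 s1 l1] := lo_full up h; move: p1 s1 l1; rewrite o eqxx => p1 s1 l1.
have ca := cidx_lt h; split=> //; first by rewrite /csig (coddE ca) o.
by rewrite /lab_hi (coddE ca) o.
Qed.

Lemma right_cuts I a up : iset I = [set x | cmp up x a /\ a < x] ->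
  exists m n, [/\ at_cut m n a, odd_idx n = ~~ up, clo I = (a%:E, true) &
  chi I = (qs A (n + 1), true)].
Proof.
have [m [n h]] := at_cut_ex a; rewrite (cmp_set_gt up h).
case: eqP => [_ e|o e] /=; first by have [x] := iset_neq0 I; rewrite e.
exists m, n; have [] := itv_cuts _ _ e => //.
  by have [_ _ Sn _] := h; exact: cidx_proper (cidx_qs_gt Sn).
by split=> //; case: (odd_idx n) up o => -[].
Qed.

Lemma right_labels I a up : iset I = [set x | cmp up x a /\ a < x] ->
  [/\ csig A (clo I) = up, csig A (chi I) = ~~ up,
      lab_lo A (clo I) = lab_lo_at up a%:E & lab_hi A (chi I) = lab_hi_at up a%:E].
Proof.
move=> /right_cuts[m [n [h o -> ->]]].
have [p1 s1 l1] := hi_full up h; move: p1 s1 l1; rewrite o.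
have -> : ~~ up != up by case: up {o}.
move=> p1 s1 l1.
have ca := cidx_gt h; split=> //; first by rewrite /csig (coddE ca) o; case: (up).
by rewrite /lab_lo (coddE ca) o /lab_lo_at; case: up {o s1 l1}.
Qed.

Lemma proj_labels I e : proj_at A I e ->
  lab_lo A (clo I) = U e /\ lab_hi A (chi I) = V e.
Proof.
case: e => [a| |] /=.
- by case=> [/(@full_labels _ _ false)[]|/(@left_labels _ _ false)[]|/(@right_labels _ _ false)[]].
- case=> n [[Dn o] en] e; have Sn := seg_pinf Dn en.
  have e' : iset I = itv (qs A (n - 1), false) (+oo%E, true).
    by rewrite e; apply/seteqP; split=> x; rewrite /itv /below /= ?andbT.
  have c1 := cidx_qs_lt Sn; have c2 := cidx_qs_gt Sn; rewrite subrK en in c2.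
  have [-> ->] := itv_cuts (cidx_proper c1) (cidx_proper c2) e'.
  rewrite /lab_lo /lab_hi (coddE c1) (coddE c2) !odd_idxB ?negbK o /=.
  have on : ~~ odd_idx (n - 1) by rewrite odd_idxB o.
  have [s1 s2] := segment_bounds Sn; rewrite subrK en in s2.
  split; first exact: (kappa_even s1 s2 on).1.
  have ai : aadm A +oo%E by exists (n - 1).
  by rewrite (kappaMP ai) /=; lra.
- case=> n [[Dn o] en] e; have Sn := seg_ninf Dn en.
  have e' : iset I = itv (-oo%E, false) (qs A (n + 1), true).
    by rewrite e; apply/seteqP; split=> x; rewrite /itv /below /= -leNgt ?leNye.
  have c1 := cidx_qs_lt Sn; have c2 := cidx_qs_gt Sn; rewrite en in c1.
  have [-> ->] := itv_cuts (cidx_proper c1) (cidx_proper c2) e'.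
  rewrite /lab_lo /lab_hi (coddE c1) (coddE c2) odd_idxB odd_idxS o /=.
  have [s1 s2] := segment_bounds Sn; rewrite en in s1.
  split; last by rewrite (kappa_odd s1 s2 o).1.
  have ai : aadm A -oo%E by exists n.
  by rewrite (kappaMP ai) /=; lra.
Qed.

(** The inverse of [(x, y) |-> (x - y - pi / 2, x + y + pi / 2)]. *)
Definition gpt (u v : R) : R * R := ((u + v) / 2, (v - u) / 2 - pi / 2).

Lemma kappa_qs n : qidx A n ->
  V (qs A n) = xcoord A n + ycoord A n + pi / 2 /\
  U (qs A n) = xcoord A n - ycoord A n - pi / 2.
Proof.
move=> Dn; suff e : Defs.coord A (qs A n) = (xcoord A n, ycoord A n).
  by rewrite /kappaM /kappaP e.
have e : is_coord A (qs A n) (xcoord A n, ycoord A n) by left; exists n.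
have [m [Sm hm]] := aadm_qs Dn.
rewrite (coordE Sm hm); apply/esym; exact: is_coordE Sm hm e.
Qed.

Lemma gpt_coord (e : \bar R) : Defs.coord A e = gpt (U e) (V e).
Proof.
rewrite /gpt /kappaM /kappaP; case: (Defs.coord A e) => x y /=.
by congr (_, _); lra.
Qed.

Lemma single_cuts I x : iset I = [set x] -> clo I = (x%:E, false) /\ chi I = (x%:E, true).
Proof.
move=> e; apply: itv_cuts => //; rewrite e; apply/seteqP.
split=> y; rewrite /itv /below /= -leNgt !lee_fin.
  by move=> ->; rewrite lexx.
by move=> /le_anti.
Qed.

Lemma segment_cuts I n : segment A n -> iset I = segment_set A n ->
  clo I = (qs A n, false) /\ chi I = (qs A (n + 1), true).
Proof.
move=> Sn e; apply: itv_cuts; first exact: cidx_proper (cidx_qs_lt Sn).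
  exact: cidx_proper (cidx_qs_gt Sn).
by rewrite e; apply/seteqP; split=> y; rewrite /itv /below /= -leNgt.
Qed.

(** Only this branch occurs: the argument of [lambda] is half the difference of the two labels,
    which [lab_bounds] keeps between 0 and [pi]. *)
Lemma lambda_small (w : R) : 0 <= w <= pi -> lambda w = w - pi / 2.
Proof.
move=> /andP[w0 w1]; have p0 := pi_gt0 R.
have -> : lambda w = let u := w - 0%:~R * (2 * pi) in
    if u <= pi then u - pi / 2 else - u + 3 * pi / 2.
  rewrite /lambda; suff -> : Num.floor (w / (2 * pi)) = 0 by [].
  apply/Num.Theory.floor_def; rewrite divr_ge0 ?mulr_ge0 ?(ltW p0) //=.
  by rewrite ltr_pdivrMr ?mulr_gt0 //; lra.
by rewrite /= mul0r subr0 w1.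
Qed.

Lemma clo_left I (a : \bar R) : clo I = (a, false) -> a <> -oo%E -> has_lo I.
Proof.
case=> e; case: asboolP => // h _ ne; apply: contrapT => no.
by apply: h; rewrite e.
Qed.

Lemma clo_right I (a : \bar R) : clo I = (a, true) -> ~ has_lo I.
Proof. by case=> _; case: asboolP => // -[]. Qed.

Lemma chi_left I (a : \bar R) : chi I = (a, false) -> ~ has_hi I.
Proof. by case=> _; case: asboolP => // h _ no; apply: h; right. Qed.

Lemma chi_right I (a : \bar R) : chi I = (a, true) -> a <> +oo%E -> has_hi I.
Proof. by case=> e; case: asboolP => // -[|//]; rewrite e. Qed.

(** At [s_n] an included lower end is the cut of index [n - 1] and an excluded one the cut of index
    [n]. The sign convention thus comes down to the parity of the cut, as it does between turning
    points. *)
Lemma lo_minusP I : cadm A (clo I) -> lo I <> -oo%E ->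
  lo_minus A I <-> ~~ codd A (clo I).
Proof.
move=> hc ne; split.
- case=> -[n [Sn e o]].
    have [a ea] : exists a, lo I = a%:E.
      by move: e; case: (lo I) ne => [a|_|//]; [exists a|move=> /andP[_]; rewrite ltNge leey].
    suff cn : cidx A (clo I) n by rewrite (coddE cn).
    rewrite /clo ea in e *; case: asboolP => _.
      by apply: Cidx_right => //; case/andP: e => /ltW -> ->.
    by apply: Cidx_left => //; case/andP: e => -> /ltW.
  move: o; case: (boolP (odd_idx n)) => o hl.
    have cl : clo I = (qs A n, false).
      by rewrite /clo e; congr (_, _); apply/asboolP => -[].
    rewrite cl (coddE (cidx_left Sn _)) ?odd_idxB ?o //.
    by rewrite e; case: hl => x _ <-; rewrite ltry.
  have cl : clo I = (qs A n, true) by rewrite /clo e; congr (_, _); apply/asboolP.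
  by rewrite cl (coddE (cidx_right Sn _)) // e ltNye; apply/eqP.
- move: hc => [m cm]; rewrite (coddE cm); move eq_c: (clo I) cm => c cm.
  case: cm eq_c => [n a Sn /andP[h1 h2]|n a Sn /andP[h1 h2]|n Sn en|n Sn en] ec o.
  + have ea : lo I = a%:E by case: ec.
    move: h2; rewrite le_eqVlt => /predU1P[e|h2].
      right; exists (n + 1); split; [exact: Sn.2|by rewrite ea|].
      by rewrite odd_idxS o; exact: (clo_left ec).
    by left; exists n; split=> //; rewrite ea h1 h2.
  + have ea : lo I = a%:E by case: ec.
    move: h1; rewrite le_eqVlt => /predU1P[e|h1].
      right; exists n; split; [exact: Sn.1|by rewrite ea|].
      by rewrite (negbTE o); exact: clo_right ec.
    by left; exists n; split=> //; rewrite ea h1 h2.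
  + by case: ec => /ne.
  + have [x Ix] := iset_neq0 I.
    have : (lo I <= x%:E)%E by apply: ereal_inf_lbound; exists x.
    by case: ec => ->.
Qed.

Lemma hi_minusP I : cadm A (chi I) -> hi I <> +oo%E ->
  hi_minus A I <-> ~~ codd A (chi I).
Proof.
move=> hc ne; split.
- case=> -[n [Sn e o]].
    have [a ea] : exists a, hi I = a%:E.
      by move: e; case: (hi I) ne => [a|//|_]; [exists a|rewrite ltNge leNye].
    suff cn : cidx A (chi I) n by rewrite (coddE cn).
    rewrite /chi ea in e *; case: asboolP => _.
      by apply: Cidx_right => //; case/andP: e => /ltW -> ->.
    by apply: Cidx_left => //; case/andP: e => -> /ltW.
  move: o; case: (boolP (odd_idx n)) => o hh.
    have cl : chi I = (qs A n, false).
      by rewrite /chi e; congr (_, _); apply/asboolP => -[].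
    by rewrite cl (coddE (cidx_left Sn _)) ?odd_idxB ?o // e ltey; apply/eqP.
  have cl : chi I = (qs A n, true).
    by rewrite /chi e; congr (_, _); apply/asboolP; right.
  rewrite cl (coddE (cidx_right Sn _)) // e.
  by case: hh => x _ <-; rewrite ltNyr.
- move: hc => [m cm]; rewrite (coddE cm); move eq_c: (chi I) cm => c cm.
  case: cm eq_c => [n a Sn /andP[h1 h2]|n a Sn /andP[h1 h2]|n Sn en|n Sn en] ec o.
  + have ea : hi I = a%:E by case: ec.
    move: h2; rewrite le_eqVlt => /predU1P[e|h2].
      right; exists (n + 1); split; [exact: Sn.2|by rewrite ea|].
      by rewrite odd_idxS o; exact: chi_left ec.
    by left; exists n; split=> //; rewrite ea h1 h2.
  + have ea : hi I = a%:E by case: ec.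
    move: h1; rewrite le_eqVlt => /predU1P[e|h1].
      right; exists n; split; [exact: Sn.1|by rewrite ea|].
      by rewrite (negbTE o); exact: (chi_right ec).
    by left; exists n; split=> //; rewrite ea h1 h2.
  + have [x Ix] := iset_neq0 I.
    have : (x%:E <= hi I)%E by apply: ereal_sup_ubound; exists x.
    by case: ec => ->.
  + by case: ec => /ne.
Qed.

Lemma kappa_loE I : cadm A (clo I) -> kappa_lo A I = lab_lo A (clo I).
Proof.
move=> hc; rewrite /kappa_lo /lab_lo /=.
(* At [-oo] the two kappas coincide; at [+oo] they differ by [2 * pi], which the term added in
   [kappa_hiE] absorbs. *)
have [e|ne] := pselect (lo I = -oo%E).
  have h := cadm_aadm hc; rewrite /= e in h *.
  by have := kappaMP h => /= h'; do 2 case: ifP => _; rewrite ?h'; lra.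
by case: asboolP => [/(lo_minusP hc ne)/negbTE->|] // h; case: ifP => // /negbT/(lo_minusP hc ne).
Qed.

Lemma kappa_hiE I : cadm A (chi I) ->
  kappa_hi A I + (if `[< hi_minus A I >] then 0 else 2 * pi) = lab_hi A (chi I).
Proof.
move=> hc; rewrite /kappa_hi /lab_hi /=.
have [e|ne] := pselect (hi I = +oo%E).
  have h := cadm_aadm hc; rewrite /= e in h *.
  by have := kappaMP h => /= h'; do 2 case: ifP => _; rewrite ?h'; lra.
case: asboolP => [/(hi_minusP hc ne)/negbTE->|]; first by rewrite addr0.
by move=> h; case: ifP => // /negbT/(hi_minusP hc ne).
Qed.

Lemma simple_not_inj I x n : iset I = [set x] -> segment A n ->
  (qs A n < x%:E < qs A (n + 1))%E -> ~ is_inj A I.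
Proof.
move=> e Sn /andP[nx xn] [[a| |]] /=; have [cl ch] := single_cuts e;
  have c1 : cidx A (x%:E, false) n by apply: Cidx_left; rewrite // nx ltW.
- have c2 : cidx A (x%:E, true) n by apply: Cidx_right; rewrite // xn ltW.
  case.
  (* The two cuts of a full support have equal [csig], the two cuts at an interior point of a
     segment do not. *)
  + move=> /(@full_labels _ _ true)[]; rewrite cl ch /csig (coddE c1) (coddE c2) /=.
    by case: odd_idx.
  + by move=> /(@left_cuts _ _ true)[p [q []]]; rewrite ch.
  + by move=> /(@right_cuts _ _ true)[p [q []]]; rewrite cl.
- case=> m [[Dm _] em] e2; have Sm := seg_pinf Dm em.
  have e' : iset I = itv (qs A (m - 1), false) (+oo%E, true).
    by rewrite e2; apply/seteqP; split=> y; rewrite /itv /below /= ?andbT.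
  by have [] := itv_cuts (cidx_proper (cidx_qs_lt Sm)) _ e'; rewrite ?ch.
- case=> m [[Dm _] em] e2; have Sm := seg_ninf Dm em.
  have e' : iset I = itv (-oo%E, false) (qs A (m + 1), true).
    by rewrite e2; apply/seteqP; split=> y; rewrite /itv /below /= -leNgt ?leNye.
  by have [] := itv_cuts _ (cidx_proper (cidx_qs_gt Sm)) e'; rewrite ?cl.
Qed.

(** The right-hand side does not depend on the clause, so the clauses agree wherever they overlap
    and [Gamma] is well defined. *)
Lemma is_GammaE I p : cadm A (clo I) -> cadm A (chi I) -> is_Gamma A I p ->
  p = gpt (lab_lo A (clo I)) (lab_hi A (chi I)).
Proof.
move=> hc hd [e|n x|n x|n|] {p}.
- by move=> /proj_labels[-> ->]; exact: gpt_coord.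
- move=> [Dn o] en e _; have [-> ->] := single_cuts e.
  have c1 := cidx_left Dn; rewrite en ltry in c1; have {}c1 := c1 isT.
  have c2 := cidx_right Dn; rewrite en ltNyr in c2; have {}c2 := c2 isT.
  have [v u] := kappa_qs Dn; rewrite en in v u.
  rewrite /lab_lo /lab_hi (coddE c1) (coddE c2) odd_idxB o /= v u /gpt.
  by congr (_, _); lra.
- move=> Sn /andP[nx xn] e _ _; have [-> ->] := single_cuts e.
  have c1 : cidx A (x%:E, false) n by apply: Cidx_left; rewrite // nx ltW.
  have c2 : cidx A (x%:E, true) n by apply: Cidx_right; rewrite // xn ltW.
  rewrite /lab_lo /lab_hi (coddE c1) (coddE c2) gpt_coord /gpt /=.
  by case: odd_idx; congr (_, _); lra.
- move=> Sn e _; have [-> ->] := segment_cuts Sn e.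
  have c1 := cidx_qs_lt Sn; have c2 := cidx_qs_gt Sn.
  have [v u] := kappa_qs Sn.2; have [s1 s2] := segment_bounds Sn.
  rewrite /lab_lo /lab_hi (coddE c1) (coddE c2) odd_idxB odd_idxS /=.
  case: (boolP (odd_idx n)) => o /=.
    by rewrite (kappa_odd s1 s2 o).1 v /gpt; congr (_, _); lra.
  by rewrite (kappa_even s1 s2 o).1 u /gpt; congr (_, _); lra.
- move=> _ _ _.
  have e1 := kappa_loE hc; have e2 := kappa_hiE hd.
  have b := lab_bounds hc hd (clo_clt_chi I).
  rewrite e1 /gamma_x; move: e2 b; rewrite e1.
  set L := lab_lo A _; set H := lab_hi A _.
  have -> : (L + kappa_hi A I) / 2 + (if `[< hi_minus A I >] then 0 else pi) =
    (L + (kappa_hi A I + (if `[< hi_minus A I >] then 0 else 2 * pi))) / 2.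
    by case: ifP => _; lra.
  move=> -> /andP[b1 b2]; rewrite lambda_small; last by apply/andP; split; lra.
  by rewrite /gpt; congr (_, _); lra.
Qed.

Lemma is_Gamma_ex I : exists p, is_Gamma A I p.
Proof.
case: (pselect (is_proj A I)) => [[e he]|np]; first by eexists; apply: Gamma_proj he.
case: (pselect (exists x, iset I = [set x])) => [[x e]|ns].
  have [n Sn hn] := seg_right A x.
  (* The simple representation at a turning point is injective at a source and, against [np],
     projective at a sink. *)
  move/andP: (hn) => [+ xn]; rewrite le_eqVlt => /predU1P[en|nx].
    have [m [n' h]] := at_cut_ex x.
    have [Sm hm Sn' hn'] := h; have en' := seg_inj_right Sn' Sn hn' hn; subst n'.
    have em : m = n - 1.
      have c1 := cidx_lt h; have := cidx_left Sn.1; rewrite en ltry => /(_ isT).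
      by move=> /(cidx_inj c1).
    have single up : odd_idx n = up -> iset I = [set y | cmp up y x].
      move=> o; rewrite (cmp_set up h) em odd_idxB o eqxx.
      have -> : (~~ up == up) = false by case: (up).
      rewrite e; apply/seteqP; split=> y; rewrite /itv /below /= -leNgt !lee_fin.
        by move=> ->; rewrite lexx.
      by move=> /le_anti.
    case: (boolP (odd_idx n)) => o; last first.
      by exfalso; apply: np; exists x%:E; apply: Or31; apply: (single false); apply: negbTE.
    eexists; apply: (Gamma_inj_simple (n := n) (x := x)) => //.
      by split=> //; exact: Sn.1.
    by exists x%:E; apply: Or31; exact: (single true).
  have hn2 : (qs A n < x%:E < qs A (n + 1))%E by rewrite nx xn.
  eexists; apply: (Gamma_simple Sn hn2 e np).
  exact: simple_not_inj hn2.
case: (pselect (exists2 n, segment A n & iset I = segment_set A n)) => [[n Sn e]|nseg].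
  by eexists; apply: (Gamma_segment Sn e np).
by eexists; apply: Gamma_other.
Qed.

Lemma GammaE I : cadm A (clo I) -> cadm A (chi I) ->
  Gamma A I = gpt (lab_lo A (clo I)) (lab_hi A (chi I)).
Proof.
move=> hc hd; apply: (is_GammaE hc hd); have [p hp] := is_Gamma_ex I.
exact: (xgetI _ hp).
Qed.

End GammaFormula.

(** * Morphisms between interval representations *)

Section Homs.
Context {R : realType} (k : fieldType) (A : quiver R).
Implicit Types (x y z : R) (I J K : @itvl R).

(** The spaces have dimension 0 or 1 only propositionally. The all-ones matrix spans the linear maps
    between them in all four cases, so no casts are needed. *)
Definition onem m n : 'Hom('rV[k]_m, 'rV[k]_n) :=
  linfun (mulmxr (const_mx 1 : 'M[k]_(m, n))).

Lemma onem_comp m n p : (onem n p \o onem m n)%VF = n%:R *: onem m p.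
Proof.
apply/lfunP => u; rewrite comp_lfunE scale_lfunE !lfunE /= -mulmxA scalemxAr.
congr (_ *m _); apply/matrixP => i j; rewrite !mxE (eq_bigr (fun=> 1)).
  by rewrite sumr_const card_ord mulr1.
by move=> l _; rewrite !mxE mulr1.
Qed.

Lemma onem0 m n : m = 0%N \/ n = 0%N -> onem m n = 0.
Proof.
by move=> [->|->]; apply/lfunP => u; rewrite !lfunE /=; apply/rowP => i;
  [rewrite !mxE big_ord0|case: i].
Qed.

Lemma onem_neq0 : onem 1 1 != 0.
Proof.
apply/eqP => /(congr1 (fun g : 'Hom('rV[k]_1, 'rV[k]_1) => (g (const_mx 1) : 'rV[k]_1) ord0 ord0)) /=.
rewrite zero_lfunE lfunE /= !mxE big_ord1 !mxE mulr1 => /eqP.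
by rewrite oner_eq0.
Qed.

Lemma onem_id m : (m <= 1)%N -> onem m m = \1%VF.
Proof.
case: m => [|[|m]] // _; first by rewrite onem0; [apply/lfunP => u; rewrite !thinmx0|left].
apply/lfunP => u; rewrite lfunE id_lfunE /= -[RHS]mulmx1; congr (_ *m _).
by apply/matrixP => i j; rewrite !mxE !ord1.
Qed.

(** The sum has one term if the target is a line and none if it is zero, which gives the coefficient
    without a case distinction. *)
Lemma onemE m n (g : 'Hom('rV[k]_m, 'rV[k]_n)) : (m <= 1)%N -> (n <= 1)%N ->
  g = (\sum_j g (const_mx 1) ord0 j) *: onem m n.
Proof.
move=> + n1; case: m g => [|[|m]] // g _; first by rewrite onem0 ?scaler0; [apply/lfunP => u; rewrite thinmx0 !linear0|left].
case: n g n1 => [|[|n]] // g _; first by rewrite onem0 ?scaler0; [apply/lfunP => u; rewrite !thinmx0|right].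
apply/lfunP => u; have -> : u = u ord0 ord0 *: const_mx 1.
  by apply/rowP => i; rewrite ord1 !mxE mulr1.
rewrite !linearZ /=; congr (_ *: _); rewrite scale_lfunE lfunE /= big_ord1.
by apply/rowP => i; rewrite ord1 !mxE big_ord1 !mxE !mulr1.
Qed.

Lemma Mdim_le1 I x : (Mdim I x <= 1)%N.
Proof. by rewrite /Mdim; case: asboolP. Qed.

Lemma Mdim1 I x : iset I x -> Mdim I x = 1%N.
Proof. by rewrite /Mdim => Ix; rewrite asboolT. Qed.

Lemma Mdim0 I x : ~ iset I x -> Mdim I x = 0%N.
Proof. by rewrite /Mdim => Ix; rewrite asboolF. Qed.

Lemma M_rmapE I x y : rmap (M k A I) x y = onem (Mdim I x) (Mdim I y).
Proof. by []. Qed.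

Lemma M_zero I x (u : M k A I x) : ~ iset I x -> u = 0.
Proof. by move=> /Mdim0 e; move: u; rewrite /= e => u; rewrite thinmx0. Qed.

Section Scalar.
Variables (I J : @itvl R) (f : rhom (M k A I) (M k A J)).

Definition sc x : k := \sum_j (f x : 'Hom('rV_(Mdim I x), 'rV_(Mdim J x))) (const_mx 1) ord0 j.

Lemma scE x : f x = sc x *: onem (Mdim I x) (Mdim J x).
Proof. by apply: onemE; exact: Mdim_le1. Qed.

Lemma sc_out x : ~ (iset I x /\ iset J x) -> sc x = 0.
Proof.
move=> no; rewrite /sc; case: (pselect (iset J x)) => Jx; last first.
  by move: (f x) => /=; rewrite (Mdim0 Jx) => g; rewrite big_ord0.
have /Mdim0 I0 : ~ iset I x by move=> Ix; apply: no.
move: (f x) => /=; rewrite I0 => g; rewrite big1 // => j _.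
by rewrite [const_mx _]thinmx0 linear0 mxE.
Qed.

Lemma sc_nat x y : qle A y x -> iset I x -> iset J y -> sc y = sc x.
Proof.
move=> yx Ix Jy; have := rhom_nat f yx.
rewrite (scE y) (scE x) !M_rmapE -!(comp_lfunZl, comp_lfunZr) !onem_comp.
have n0 : onem (Mdim I x) (Mdim J y) != 0.
  by rewrite (Mdim1 Ix) (Mdim1 Jy) onem_neq0.
rewrite !scalerA => /eqP.
rewrite -subr_eq0 -scalerBl scaler_eq0 (negbTE n0) orbF subr_eq0 => /eqP.
have s0 : (Mdim I y)%:R = 1 :> k \/ sc y = 0.
  by case: (pselect (iset I y)) => [/Mdim1->|no]; [left|right; apply: sc_out => -[]].
have s1 : (Mdim J x)%:R = 1 :> k \/ sc x = 0.
  by case: (pselect (iset J x)) => [/Mdim1->|no]; [left|right; apply: sc_out => -[]].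
by case: s0 s1 => [->|->] [->|->]; rewrite ?mulr1 ?mul1r ?mul0r ?mulr0.
Qed.

Lemma sc_const x y : iset I x -> iset J x -> iset I y -> iset J y -> sc x = sc y.
Proof.
wlog xy : x y / x <= y.
  by move=> W Ix Jx Iy Jy; case: (leP x y) => [|/ltW] le; [|symmetry]; exact: W.
move=> Ix Jx Iy Jy.
have H z : x <= z <= y -> iset I z /\ iset J z.
  by move=> zz; split; [exact: (iset_itv Ix Iy)|exact: (iset_itv Jx Jy)].
suff : [set z | sc x = sc z] x <-> [set z | sc x = sc z] y by case=> h _; exact: h.
apply: (conn (A := A)) => // a b /H[Ia Ja] /H[Ib Jb] ab /=.
by rewrite (sc_nat ab Ib Ja).
Qed.

End Scalar.

(** The naturality condition for a nonzero multiple of the all-ones maps; squares starting outside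
    [I] or ending outside [J] commute trivially. *)
Definition arrow_ok I J : Prop :=
  forall x y, qle A y x -> iset I x -> iset J y -> (iset J x <-> iset I y).

Definition meets I J : Prop := exists x, iset I x /\ iset J x.

Lemma nonzero_hom I J (f : rhom (M k A I) (M k A J)) : rhom_nonzero f ->
  [/\ arrow_ok I J, meets I J & exists2 c, c != 0 &
      forall x, f x = c *: onem (Mdim I x) (Mdim J x)].
Proof.
case=> x fx; have [Ix Jx] : iset I x /\ iset J x.
  by apply: contrapT => no; apply: fx; rewrite scE (sc_out f no) scale0r.
have c0 : sc f x != 0 by apply/eqP => e; apply: fx; rewrite scE e scale0r.
have cst y : iset I y -> iset J y -> sc f y = sc f x.
  by move=> Iy Jy; exact: sc_const.
split; last 2 first.
- by exists x.
- exists (sc f x) => // y; rewrite scE.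
  case: (pselect (iset I y /\ iset J y)) => [[Iy Jy]|no]; first by rewrite cst.
  rewrite onem0 ?scaler0 //; case: (pselect (iset I y)) => [Iy|/Mdim0->]; last by left.
  by right; apply: Mdim0 => Jy; apply: no.
move=> y z zy Iy Jz; have e := sc_nat f zy Iy Jz; split.
  move=> Jy; apply: contrapT => Iz; move: c0; rewrite -(cst y Iy Jy) -e.
  by rewrite sc_out ?eqxx // => -[].
move=> Iz; apply: contrapT => Jy; move: c0; rewrite -(cst z Iz Jz) e.
by rewrite sc_out ?eqxx // => -[].
Qed.

Lemma chom_nat I J (c : k) (h : arrow_ok I J) x y : qle A y x ->
  (c *: onem (Mdim I y) (Mdim J y) \o rmap (M k A I) x y)%VF =
  (rmap (M k A J) x y \o c *: onem (Mdim I x) (Mdim J x))%VF.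
Proof.
move=> yx; rewrite !M_rmapE -!(comp_lfunZl, comp_lfunZr) !onem_comp.
case: (pselect (iset I x)) => [Ix|/Mdim0 I0]; last first.
  by rewrite (_ : onem (Mdim I x) (Mdim J y) = 0) ?scaler0 //; apply: onem0; left.
case: (pselect (iset J y)) => [Jy|/Mdim0 J0]; last first.
  by rewrite (_ : onem (Mdim I x) (Mdim J y) = 0) ?scaler0 //; apply: onem0; right.
do 2 congr (_ *: _); case: (pselect (iset J x)) => Jx.
  by rewrite (Mdim1 Jx) (Mdim1 ((h _ _ yx Ix Jy).1 Jx)).
by rewrite (Mdim0 Jx) Mdim0 // => Iy; apply/Jx/(h _ _ yx Ix Jy).
Qed.

Definition chom I J c h : rhom (M k A I) (M k A J) :=
  @RHom R k A (M k A I) (M k A J) (fun x => c *: onem (Mdim I x) (Mdim J x))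
    (@chom_nat I J c h).

Lemma chom_nonzero I J c (h : arrow_ok I J) : c != 0 -> meets I J ->
  rhom_nonzero (chom c h).
Proof.
move=> c0 [x [Ix Jx]]; exists x => /= /eqP; rewrite (Mdim1 Ix) (Mdim1 Jx).
by rewrite scaler_eq0 (negbTE c0) (negbTE onem_neq0).
Qed.

Lemma onem_comp3 I J K x : (iset I x -> iset K x -> iset J x) ->
  (onem (Mdim J x) (Mdim K x) \o onem (Mdim I x) (Mdim J x))%VF =
  onem (Mdim I x) (Mdim K x).
Proof.
move=> H; rewrite onem_comp; case: (pselect (iset I x)) => [Ix|/Mdim0->].
  case: (pselect (iset K x)) => [Kx|/Mdim0->]; first by rewrite (Mdim1 (H Ix Kx)) scale1r.
  by rewrite !onem0 ?scaler0 //; right.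
by rewrite !onem0 ?scaler0 //; left.
Qed.

Lemma arrow_ok_eq I J : iset I = iset J -> arrow_ok I J.
Proof. by move=> e x y _; rewrite e. Qed.

Lemma iso_eq I J (f : rhom (M k A I) (M k A J)) :
  iset I = iset J -> rhom_nonzero f -> is_iso f.
Proof.
move=> e /nonzero_hom[_ _ [c c0 fE]]; exists (chom c^-1 (arrow_ok_eq (esym e))).
move=> x; rewrite /= fE -!(comp_lfunZl, comp_lfunZr) !scalerA mulfV // mulVf //.
rewrite !scale1r !onem_comp3 ?e // !onem_id ?Mdim_le1 //.
Qed.

End Homs.

(** * Nonzero morphisms in terms of cuts *)

Section HomCuts.
Context {R : realType} (A : quiver R).
Implicit Types (x y z : R) (I J K : @itvl R) (c d : @cut R).

(** The parity condition concerns the cut that separates the image from a part of the kernel or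
    cokernel: arrows must run into the kernel and out of the cokernel. At the lower end this is the
    greater of the two cuts, at the upper end ([hi_le]) the smaller one. *)
Definition lo_le c d : Prop :=
  [\/ c = d, clt c d /\ ~~ codd A d | clt d c /\ codd A c].

Definition hi_le c d : Prop :=
  [\/ c = d, clt c d /\ ~~ codd A c | clt d c /\ codd A d].

Lemma lo_le_even c d : lo_le c d -> clt c d -> ~~ codd A d.
Proof.
by case=> [->|[]//|[dc _]] cd; [rewrite clt_irr in cd|rewrite (clt_asym dc) in cd].
Qed.

Lemma lo_le_odd c d : lo_le c d -> clt d c -> codd A c.
Proof.
by case=> [->|[dc _]|[]//] cd; [rewrite clt_irr in cd|rewrite (clt_asym dc) in cd].
Qed.

Lemma hi_le_even c d : hi_le c d -> clt c d -> ~~ codd A c.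
Proof.
by case=> [->|[]//|[dc _]] cd; [rewrite clt_irr in cd|rewrite (clt_asym dc) in cd].
Qed.

Lemma hi_le_odd c d : hi_le c d -> clt d c -> codd A d.
Proof.
by case=> [->|[dc _]|[]//] cd; [rewrite clt_irr in cd|rewrite (clt_asym dc) in cd].
Qed.

Lemma lo_le_below a b c x : lo_le a b -> lo_le b c -> below a x -> below c x ->
  below b x.
Proof.
move=> ab bc ax cx; apply: contraT => bx.
by have := lo_le_even ab (below_clt ax bx); rewrite (lo_le_odd bc (below_clt cx bx)).
Qed.

Lemma hi_le_below a b c x : hi_le a b -> hi_le b c -> ~~ below a x -> ~~ below c x ->
  ~~ below b x.
Proof.
move=> ab bc ax cx; apply/negP => bx.
by have := hi_le_even bc (below_clt bx cx); rewrite (hi_le_odd ab (below_clt bx ax)).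
Qed.

(* If I and J meet, this is equivalent to Hom(M_I, M_J) <> 0. *)
Definition le_itv I J : Prop := lo_le (clo I) (clo J) /\ hi_le (chi I) (chi J).

(** With [onem_comp3] this shows that the composite of all-ones maps through [J] is again the
    all-ones map. *)
Lemma le_itv_mid I J K x : le_itv I J -> le_itv J K ->
  iset I x -> iset K x -> iset J x.
Proof.
move=> [l1 h1] [l2 h2] /itvlP/andP[a1 b1] /itvlP/andP[a2 b2].
by apply/itvlP; rewrite (lo_le_below l1 l2) // (hi_le_below h1 h2).
Qed.

Lemma le_itv_arrow_ok I J : le_itv I J -> arrow_ok A I J.
Proof.
move=> [lo hi] x y yx /itvlP/andP[px qx] /itvlP/andP[ry ty].
split=> h; apply: contrapT => no.
- move/itvlP: h => /andP[rx tx].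
  have [py|py] := boolP (below (clo I) y); last first.
    by have := (qle_cross A px py).1 yx; rewrite (lo_le_odd lo (below_clt ry py)).
  have [qy|qy] := boolP (below (chi I) y); last by apply: no; apply/itvlP; rewrite py.
  by have := hi_le_even hi (below_clt qy ty); rewrite ((qle_cross A qy qx).2 yx).
- move/itvlP: h => /andP[py qy].
  have [rx|rx] := boolP (below (clo J) x); last first.
    by have := lo_le_even lo (below_clt px rx); rewrite ((qle_cross A ry rx).2 yx).
  have [tx|tx] := boolP (below (chi J) x); last by apply: no; apply/itvlP; rewrite rx.
  by have := (qle_cross A tx ty).1 yx; rewrite (hi_le_odd hi (below_clt tx qx)).
Qed.

Definition itv_adm I : Prop := cadm A (clo I) /\ cadm A (chi I).

(** If the parity were wrong, [cross_qle] would give an arrow across the cut with one end in both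
    intervals and the other in just one of them, in the direction that [arrow_ok] forbids. *)
Lemma arrow_ok_le_itv I J : itv_adm I -> itv_adm J -> meets I J ->
  arrow_ok A I J -> le_itv I J.
Proof.
move=> [ap aq] [ar at_] [z [Iz Jz]] ok.
move/itvlP: (Iz) => /andP[pz qz]; move/itvlP: (Jz) => /andP[rz tz].
have inI x : below (clo I) x -> x <= z -> iset I x.
  by move=> px xz; apply/itvlP; rewrite px; apply: contra qz; exact: below_le.
have inJ x : below (clo J) x -> x <= z -> iset J x.
  by move=> px xz; apply/itvlP; rewrite px; apply: contra tz; exact: below_le.
have inI' x : ~~ below (chi I) x -> z <= x -> iset I x.
  by move=> px xz; apply/itvlP; rewrite px andbT; exact: below_le pz.
have inJ' x : ~~ below (chi J) x -> z <= x -> iset J x.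
  by move=> px xz; apply/itvlP; rewrite px andbT; exact: below_le rz.
split.
- case: (pselect (clo I = clo J)) => [e|ne]; first exact: Or31.
  case: (clt_total ne) => lt; [apply: Or32|apply: Or33]; split=> //.
    apply/negP => od; have [x px rx] := clt_between (proper_clo I) (proper_clo J) lt.
    have [x' [z' [[xx' zz' rx' rz'] ]]] := cross_qle ar rx rz; rewrite od => q.
    have xz' := ltW (below_gt rz rx').
    have px' : below (clo I) x' by exact: below_le px.
    have Ix' := inI _ px' xz'; have Jz' := inJ _ rz' zz'.
    have Iz' : iset I z'.
      by apply: inI => //; apply: below_le px'; exact: ltW (below_gt rz' rx').
    have /itvlP/andP[] := (ok _ _ q Ix' Jz').2 Iz'.
    by rewrite (negbTE rx').
  apply: contraT => od; have [x rx px] := clt_between (proper_clo J) (proper_clo I) lt.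
  have [x' [z' [[xx' zz' px' pz'] ]]] := cross_qle ap px pz; rewrite (negbTE od) => q.
  have xz' := ltW (below_gt pz px').
  have rx' : below (clo J) x' by exact: below_le rx.
  have Jx' := inJ _ rx' xz'; have Iz' := inI _ pz' zz'.
  have Jz' : iset J z'.
    by apply: inJ => //; apply: below_le rx'; exact: ltW (below_gt pz' px').
  have /itvlP/andP[] := (ok _ _ q Iz' Jx').1 Jz'.
  by rewrite (negbTE px').
- case: (pselect (chi I = chi J)) => [e|ne]; first exact: Or31.
  case: (clt_total ne) => lt; [apply: Or32|apply: Or33]; split=> //.
    apply/negP => od; have [x qx tx] := clt_between (proper_chi I) (proper_chi J) lt.
    have [x' [z' [[zx' z'x qx' qz'] ]]] := cross_qle aq qz qx; rewrite od => q.
    have Ix' := inI' _ qx' zx'.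
    have tz' : ~~ below (chi J) z' by apply: contra tx; exact: below_le.
    have zz' := le_trans zx' (ltW (below_gt qz' qx')).
    have Jz' := inJ' _ tz' zz'.
    have Jx' : iset J x'.
      by apply: inJ' => //; apply: contra tz'; apply: below_le; exact: ltW (below_gt qz' qx').
    have /itvlP/andP[_] := (ok _ _ q Ix' Jz').1 Jx'.
    by rewrite qz'.
  apply: contraT => od; have [x tx qx] := clt_between (proper_chi J) (proper_chi I) lt.
  have [x' [z' [[zx' z'x tx' tz'] ]]] := cross_qle at_ tz tx; rewrite (negbTE od) => q.
  have Jx' := inJ' _ tx' zx'.
  have qz' : ~~ below (chi I) z' by apply: contra qx; exact: below_le.
  have zz' := le_trans zx' (ltW (below_gt tz' tx')).
  have Iz' := inI' _ qz' zz'.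
  have Ix' : iset I x'.
    by apply: inI' => //; apply: contra qz'; apply: below_le; exact: ltW (below_gt tz' tx').
  have /itvlP/andP[_] := (ok _ _ q Iz' Jx').2 Ix'.
  by rewrite tz'.
Qed.

(** Two strict steps go the same way by [qle_between], so their segments have the same parity; as
    they meet in [x], they are equal. *)
Lemma qle_trans y x z : qle A y x -> qle A x z -> qle A y z.
Proof.
move=> yx xz; have [e|/eqP nyx] := eqVneq y x; first by rewrite e.
have [e|/eqP nxz] := eqVneq x z; first by rewrite -e.
case: (yx) => n [Sn /andP[y1 y2] /andP[x1 x2] dn].
case: (xz) => m [Sm /andP[x3 x4] /andP[z1 z2] dm].
have lt_yx : (if odd_idx n then x < y else y < x).
  by move: dn; case: ifP => _; rewrite le_eqVlt => /predU1P[e|//]; case: nyx; rewrite e.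
have lt_xz : (if odd_idx m then z < x else x < z).
  by move: dm; case: ifP => _; rewrite le_eqVlt => /predU1P[e|//]; case: nxz; rewrite e.
suff e : n = m.
  subst m; exists n; split=> //; first by rewrite /in_segment y1.
    by rewrite /in_segment z1.
  by move: dn dm; case: ifP => _ h1 h2; [exact: le_trans h1|exact: le_trans h2].
have odd_eq : odd_idx n = odd_idx m.
  by case: (qle_between yx xz) => /andP[h1 h2]; move: lt_yx lt_xz;
    rewrite !ltNge h1 h2; do 2 case: odd_idx.
have idx p q : segment A p -> segment A q -> odd_idx p = odd_idx q ->
    (qs A p < qs A (q + 1))%E -> (qs A q <= qs A (p + 1))%E -> p = q.
  move=> [Dp Dp1] [Dq Dq1] o; rewrite (qs_lt Dp Dq1) leNgt (qs_lt Dp1 Dq) => h1 h2.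
  have [->//|e] : p = q \/ q = p + 1 by move: h1 h2; clear; lia.
  by move: o; rewrite e odd_idxS; case: odd_idx.
move: lt_yx lt_xz; rewrite -odd_eq; case: ifP => _ lt1 lt2.
  apply/esym; apply: idx => //; last exact: le_trans x4.
  by apply: (le_lt_trans z1); apply: (@lt_le_trans _ _ x%:E).
apply: idx => //; last exact: le_trans x2.
by apply: (le_lt_trans y1); apply: (@lt_le_trans _ _ x%:E).
Qed.

End HomCuts.

(** * Direct sums and projectives *)

Section RepOps.
Context {R : realType} (k : fieldType) (A : quiver R).
Implicit Types (x y z : R) (U V W : rep k A) (I J : @itvl R).

Lemma rcomp_nat U V W (g : rhom V W) (f : rhom U V) x y : qle A y x ->
  ((g y \o f y) \o rmap U x y)%VF = (rmap W x y \o (g x \o f x))%VF.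
Proof.
by move=> yx; rewrite -comp_lfunA (rhom_nat f yx) comp_lfunA (rhom_nat g yx) comp_lfunA.
Qed.

Definition rcomp U V W (g : rhom V W) (f : rhom U V) : rhom U W :=
  RHom (rcomp_nat g f).

Section Pair.
Variables V W : rep k A.

Definition pair_fun U (f : rhom U V) (g : rhom U W) x (u : U x) : dsum V W x :=
  (f x u, g x u).

Lemma pair_fun_linear U (f : rhom U V) (g : rhom U W) x : linear (@pair_fun U f g x).
Proof. by move=> c u v; rewrite /pair_fun !linearP. Qed.

HB.instance Definition _ U (f : rhom U V) (g : rhom U W) x :=
  GRing.isLinear.Build k (U x) (dsum V W x) _ (@pair_fun U f g x)
    (@pair_fun_linear U f g x).

Lemma rpair_nat U (f : rhom U V) (g : rhom U W) x y : qle A y x ->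
  (linfun (@pair_fun U f g y) \o rmap U x y)%VF =
  (rmap (dsum V W) x y \o linfun (@pair_fun U f g x))%VF.
Proof.
move=> yx; apply/lfunP => u; rewrite !comp_lfunE !lfunE /= /pair_fun /dsum_map /=.
by rewrite -!comp_lfunE (rhom_nat f yx) (rhom_nat g yx).
Qed.

Definition rpair U (f : rhom U V) (g : rhom U W) : rhom U (dsum V W) :=
  RHom (rpair_nat f g).

Definition copair_fun U (f : rhom V U) (g : rhom W U) x (u : dsum V W x) : U x :=
  f x u.1 + g x u.2.

Lemma copair_fun_linear U (f : rhom V U) (g : rhom W U) x :
  linear (@copair_fun U f g x).
Proof.
by move=> c u v; rewrite /copair_fun /= !linearP /= scalerDr addrACA.
Qed.

HB.instance Definition _ U (f : rhom V U) (g : rhom W U) x :=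
  GRing.isLinear.Build k (dsum V W x) (U x) _ (@copair_fun U f g x)
    (@copair_fun_linear U f g x).

Lemma rcopair_nat U (f : rhom V U) (g : rhom W U) x y : qle A y x ->
  (linfun (@copair_fun U f g y) \o rmap (dsum V W) x y)%VF =
  (rmap U x y \o linfun (@copair_fun U f g x))%VF.
Proof.
move=> yx; apply/lfunP => u; rewrite !comp_lfunE !lfunE /= /copair_fun /dsum_map /=.
by rewrite linearD /= -!comp_lfunE (rhom_nat f yx) (rhom_nat g yx).
Qed.

Definition rcopair U (f : rhom V U) (g : rhom W U) : rhom (dsum V W) U :=
  RHom (rcopair_nat f g).

Lemma rid_nat U x y : qle A y x -> (\1 \o rmap U x y)%VF = (rmap U x y \o \1)%VF.
Proof. by move=> _; rewrite comp_lfun1l comp_lfun1r. Qed.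

Definition rid U : rhom U U := RHom (@rid_nat U).

Lemma rzero_nat U U' x y : qle A y x ->
  (0 \o rmap U x y)%VF = (rmap U' x y \o 0)%VF.
Proof. by move=> _; rewrite comp_lfun0l comp_lfun0r. Qed.

Definition rzero U U' : rhom U U' :=
  @RHom R k A U U' (fun x => 0) (@rzero_nat U U').

Definition rinl : rhom V (dsum V W) := rpair (rid V) (rzero V W).
Definition rinr : rhom W (dsum V W) := rpair (rzero W V) (rid W).
Definition rfst : rhom (dsum V W) V := rcopair (rid V) (rzero W V).
Definition rsnd : rhom (dsum V W) W := rcopair (rzero V W) (rid W).

Lemma rpairE U (f : rhom U V) (g : rhom U W) x (u : U x) :
  rpair f g x u = (f x u, g x u).
Proof. by rewrite /= lfunE. Qed.

Lemma rcopairE U (f : rhom V U) (g : rhom W U) x (u : dsum V W x) :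
  rcopair f g x u = f x u.1 + g x u.2.
Proof. by rewrite /= lfunE. Qed.

Lemma rinlE x (v : V x) : rinl x v = (v, 0).
Proof. by rewrite rpairE /= id_lfunE zero_lfunE. Qed.

Lemma rinrE x (v : W x) : rinr x v = (0, v).
Proof. by rewrite rpairE /= id_lfunE zero_lfunE. Qed.

Lemma rfstE x (u : dsum V W x) : rfst x u = u.1.
Proof. by rewrite rcopairE /= id_lfunE zero_lfunE addr0. Qed.

Lemma rsndE x (u : dsum V W x) : rsnd x u = u.2.
Proof. by rewrite rcopairE /= id_lfunE zero_lfunE add0r. Qed.

Lemma dsum_splitE x (u : dsum V W x) :
  u = rinl x (rfst x u) + rinr x (rsnd x u).
Proof.
rewrite rinlE rinrE rfstE rsndE; case: u => a b.
by congr (_, _); rewrite /= ?addr0 ?add0r.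
Qed.

End Pair.

Lemma dsums_zero (ps : seq (@itvl R)) x :
  (forall P, List.In P ps -> ~ iset P x) ->
  forall u : dsums [seq M k A P | P <- ps] x, u = 0.
Proof.
elim: ps => [_ u|P ps IH H u]; first by rewrite [LHS]thinmx0.
case: u => u v; rewrite (IH _ v); last by move=> Q hQ; apply: H; right.
by rewrite (M_zero u); [|apply: H; left].
Qed.

Lemma const_mx1_neq0 n : n = 1%N -> (const_mx 1 : 'rV[k]_n) <> 0.
Proof.
move=> -> /rowP/(_ ord0); rewrite !mxE => /eqP.
by rewrite oner_eq0.
Qed.

Lemma in_repk_support I : in_repk (M k A I) ->
  exists ps : seq (@itvl R), (forall P, List.In P ps -> is_proj A P) /\
  forall x, iset I x -> exists2 P, List.In P ps & iset P x.
Proof.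
case=> ps [hps [p hp]]; exists ps; split=> // x Ix.
apply: contrapT => no.
have z := @dsums_zero ps x; have {}z := z (fun P hP Px => no (ex_intro2 _ _ P hP Px)).
have : (const_mx 1 : 'rV_(Mdim I x)) \in limg (p x) by rewrite hp memvf.
case/memv_imgP => u _; rewrite (z u) linear0 => /(const_mx1_neq0 (Mdim1 Ix)) //.
Qed.

End RepOps.

(** * Intervals belonging to the category *)

Section InRepk.
Context {R : realType} (k : fieldType) (A : quiver R).
Implicit Types (x y z : R) (m n : int) (U V W : rep k A) (I J P : @itvl R).

Lemma limg_full (aT rT : vectType k) (f : 'Hom(aT, rT)) :
  (forall v, exists u, f u = v) -> limg f = fullv.
Proof.
move=> H; apply/eqP; rewrite eqEsubv subvf; apply/subvP => v _.
by case: (H v) => u <-; apply: memv_img; exact: memvf.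
Qed.

Lemma chom_onto P I (h : arrow_ok A P I) x (v : M k A I x) : iset P x ->
  exists u, chom 1 h x u = v.
Proof.
move=> Px; exists (onem k (Mdim I x) (Mdim P x) v); rewrite /= scale1r -comp_lfunE.
by rewrite onem_comp3 // onem_id ?Mdim_le1 // id_lfunE.
Qed.

Lemma cover_hom I (ps : seq (@itvl R)) :
  (forall P, List.In P ps -> arrow_ok A P I) ->
  exists p : rhom (dsums [seq M k A P | P <- ps]) (M k A I),
    forall P x, List.In P ps -> iset P x -> forall v, exists u, p x u = v.
Proof.
elim: ps => [_|P ps IH H]; first by exists (rzero _ _).
have [p hp] := IH (fun Q hQ => H Q (or_intror hQ)).
exists (rcopair (chom 1 (H P (or_introl erefl))) p) => Q x [<-|hQ] Qx v.
  have [u hu] := chom_onto (H P (or_introl erefl)) v Qx.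
  by exists (u, 0); rewrite rcopairE hu linear0 addr0.
by have [u hu] := hp Q x hQ Qx v; exists (0, u); rewrite rcopairE hu linear0 add0r.
Qed.

Lemma in_repk_cover I (ps : seq (@itvl R)) :
  (forall P, List.In P ps -> is_proj A P /\ arrow_ok A P I) ->
  (forall x, iset I x -> exists2 P, List.In P ps & iset P x) ->
  in_repk (M k A I).
Proof.
move=> H cov; exists ps; split=> [P /H[]//|].
have [p hp] := cover_hom (fun P hP => (H P hP).2).
exists p => x; apply: limg_full => v; case: (pselect (iset I x)) => [|no].
  by move=> /cov[P hP Px]; exact: hp hP Px v.
by exists 0; rewrite linear0 (M_zero v no).
Qed.

Definition mk_supp (S : set R) c d (e : S = itv c d) (x : R) (Sx : S x) : @itvl R :=
  Itvl (eq_ind_r (fun S => is_interval S) (@itv_interval R c d) e)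
    (ex_intro _ x Sx).

(** The support of a projective is closed under arrows, and a point passed on the way from [a] to a
    point of [I] lies in [I]. In the variants below, points of [I] approaching an open or infinite
    end take the role of [a]. *)
Lemma cover_arrow_ok_P I a (h : iset I a) (P : @itvl R) : iset P = supp_P A a ->
  arrow_ok A P I.
Proof.
move=> e x y yx; rewrite e /supp_P /= => xa Iy; split=> [_|_]; first exact: qle_trans xa.
by case: (qle_between yx xa) => b; [exact: (iset_itv Iy h)|exact: (iset_itv h Iy)].
Qed.

Lemma cover_arrow_ok_Pl I a (h : forall x, x < a -> exists2 z, iset I z & x < z)
  (P : @itvl R) : iset P = supp_Pl A a -> arrow_ok A P I.
Proof.
move=> e x y yx; rewrite e /supp_Pl /= => -[xa lt] Iy; have ya := qle_trans yx xa.
have yxa : y <= x.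
  by case: (qle_between yx xa) => /andP[] // ax; rewrite leNgt lt in ax.
have [z Iz xz] := h x lt; split=> [_|_]; first by split=> //; exact: le_lt_trans lt.
by apply: (iset_itv Iy Iz); rewrite yxa ltW.
Qed.

Lemma cover_arrow_ok_Pr I a (h : forall x, a < x -> exists2 z, iset I z & z < x)
  (P : @itvl R) : iset P = supp_Pr A a -> arrow_ok A P I.
Proof.
move=> e x y yx; rewrite e /supp_Pr /= => -[xa lt] Iy; have ya := qle_trans yx xa.
have yxa : x <= y.
  by case: (qle_between yx xa) => /andP[h1 h2] //; rewrite leNgt lt in h2.
have [z Iz xz] := h x lt; split=> [_|_]; first by split=> //; exact: lt_le_trans yxa.
by apply: (iset_itv Iz Iy); rewrite yxa ltW.
Qed.

Lemma cover_arrow_ok_pinf I m (h : forall x, exists2 z, iset I z & x < z)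
    (P : @itvl R) : segment A m -> ~~ odd_idx m -> qs A (m + 1) = +oo%E ->
  iset P = [set x | (qs A m <= x%:E)%E] -> arrow_ok A P I.
Proof.
move=> Sm o em e x y yx; rewrite e /= => mx Iy.
have my : (qs A m <= y%:E)%E.
  have [//|ym] := boolP (below (qs A m, false) y).
  have := (qle_cross A (c := (qs A m, false)) mx ym).1 yx.
  by rewrite (coddE (cidx_qs_lt Sm)) odd_idxB o.
split=> // _; have [z Iz xz] := h x.
have yx' : y <= x.
  rewrite leNgt; apply/negP => xy.
  have cx : cidx A (x%:E, true) m by apply: Cidx_right; rewrite // mx em ltry.
  have := (qle_cross A (c := (x%:E, true)) (x := x) (z := y) _ _).2.
  by rewrite /below /= lte_fin xy ltxx (coddE cx) (negbTE o) => /(_ isT isT yx).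
by apply: (iset_itv Iy Iz); rewrite yx' ltW.
Qed.

Lemma cover_arrow_ok_ninf I m (h : forall x, exists2 z, iset I z & z < x)
    (P : @itvl R) : segment A m -> odd_idx m -> qs A m = -oo%E ->
  iset P = [set x | (x%:E <= qs A (m + 1))%E] -> arrow_ok A P I.
Proof.
move=> Sm o em e x y yx; rewrite e /= => mx Iy.
have my : (y%:E <= qs A (m + 1))%E.
  rewrite leNgt; apply/negP => ym.
  have := (qle_cross A (c := (qs A (m + 1), true)) (x := x) (z := y) _ _).2.
  by rewrite /below /= ym -leNgt mx (coddE (cidx_qs_gt Sm)) odd_idxS o => /(_ isT isT yx).
split=> // _; have [z Iz xz] := h x.
have yx' : x <= y.
  rewrite leNgt; apply/negP => xy.
  have cx : cidx A (x%:E, false) m by apply: Cidx_left; rewrite // mx em ltNyr.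
  have := (qle_cross A (c := (x%:E, false)) (x := y) (z := x) _ _).1.
  by rewrite /below /= lee_fin -ltNge lte_fin xy lexx (coddE cx) o => /(_ isT isT yx).
by apply: (iset_itv Iz Iy); rewrite yx' ltW.
Qed.

Lemma exists_supp up a : exists P : @itvl R, iset P = [set x | cmp A up x a].
Proof.
have [m [n h]] := at_cut_ex A a.
by exists (mk_supp (cmp_set up h) (cmp_refl A up a)).
Qed.

Lemma exists_supp_lt a x : qle A x a -> x < a ->
  exists P : @itvl R, iset P = supp_Pl A a.
Proof.
move=> h1 h2; have [m [n h]] := at_cut_ex A a.
have e : supp_Pl A a = itv (qs A m, false) (a%:E, false).
  have := cmp_set_lt false h; rewrite /= -/(supp_Pl A a) => e; rewrite e.
  have : supp_Pl A a x by []. 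
  by rewrite e; case: ifP.
by exists (mk_supp e (conj h1 h2)).
Qed.

Lemma exists_supp_gt a x : qle A x a -> a < x ->
  exists P : @itvl R, iset P = supp_Pr A a.
Proof.
move=> h1 h2; have [m [n h]] := at_cut_ex A a.
have e : supp_Pr A a = itv (a%:E, true) (qs A (n + 1), true).
  have := cmp_set_gt false h; rewrite /= -/(supp_Pr A a) => e; rewrite e.
  have : supp_Pr A a x by []. 
  by rewrite e; case: ifP.
by exists (mk_supp e (conj h1 h2)).
Qed.

(* On one segment a single projective covers I: the one at the end of I in the
   direction of the source. *)
Lemma cover_segment I m : segment A m -> exists ps : seq (@itvl R),
  (forall P, List.In P ps -> is_proj A P /\ arrow_ok A P I) /\
  (forall x, iset I x -> in_segment A m x -> exists2 P, List.In P ps & iset P x).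
Proof.
move=> Sm; pose T : set R := [set x | iset I x /\ in_segment A m x].
case: (pselect (T !=set0)) => [[x0 Tx0]|nT]; last first.
  by exists [::]; split=> // x Ix hx; exfalso; apply: nT; exists x.
have one (P : @itvl R) : is_proj A P -> arrow_ok A P I -> T `<=` iset P ->
    exists ps : seq (@itvl R),
    (forall P, List.In P ps -> is_proj A P /\ arrow_ok A P I) /\
    (forall x, iset I x -> in_segment A m x -> exists2 P, List.In P ps & iset P x).
  move=> h1 h2 h3; exists [:: P]; split=> [Q [<-|]//|x Ix hx].
  by exists P; [left|apply: h3].
case: (boolP (odd_idx m)) => o.
(* The source is on the left, so the projective sits at the infimum [e]: [P_e] if [e] is attained,
   [P_(e] if it is finite but not attained, and the projective at [-oo] otherwise. *)
- pose e := ereal_inf (EFin @` T).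
  have e_lb x : T x -> (e <= x%:E)%E by move=> Tx; apply: ereal_inf_lbound; exists x.
  have e_ge : (qs A m <= e)%E.
    by apply: le_ereal_inf_tmp => _ [x [_ /andP[h _]] <-].
  case: (pselect (exists2 a, T a & a%:E = e)) => [[a Ta ea]|no].
    have [P eP] := exists_supp false a.
    apply: (one P); first by exists a%:E; exact: Or31.
      by apply: (cover_arrow_ok_P Ta.1).
    move=> x Tx; rewrite eP /=; have := qle_seg Sm Ta.2 Tx.2; rewrite o; apply.
    by rewrite -lee_fin ea; exact: e_lb.
  have near x : (e < x%:E)%E -> exists2 z, T z & z < x.
    by move=> /ereal_inf_lt[_ [z Tz <-]]; exists z.
  have gt_e x : T x -> (e < x%:E)%E.
    by move=> Tx; rewrite lt_neqAle e_lb // andbT; apply/eqP => ee; apply: no; exists x.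
  move ee : e => e'; case: e' ee => [a| |] ee.
  + have lt x : T x -> qle A x a /\ a < x.
      move=> Tx; have ax : a < x by rewrite -lte_fin -ee; exact: gt_e.
      split=> //; have := @qle_seg R A m a x Sm; rewrite o; apply; last exact: ltW.
        rewrite /in_segment -ee e_ge /=; apply: (le_trans (e_lb _ Tx)).
        by case/andP: Tx.2.
      exact: Tx.2.
    have [P eP] := exists_supp_gt (lt _ Tx0).1 (lt _ Tx0).2.
    apply: (one P); first by exists a%:E; exact: Or33.
      apply: (cover_arrow_ok_Pr _ eP) => x ax.
      by have [|z Tz zx] := near x; [rewrite ee lte_fin|exists z => //; exact: Tz.1].
    by move=> x Tx; rewrite eP; exact: lt.
  + by have := gt_e _ Tx0; rewrite ee.
  + have em : qs A m = -oo%E by move: e_ge; rewrite ee leeNy_eq => /eqP.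
    have eT : [set x | (x%:E <= qs A (m + 1))%E] = itv (-oo%E, false) (qs A (m + 1), true).
      by apply/seteqP; split=> x; rewrite /itv /below /= -leNgt ?leNye.
    have h0 : [set x | (x%:E <= qs A (m + 1))%E] x0 by case/andP: Tx0.2.
    apply: (one (mk_supp eT h0)).
    * by exists -oo%E; exists m; split=> //; split=> //; exact: Sm.1.
    * apply: (@cover_arrow_ok_ninf I m) => // x.
      by have [|z Tz zx] := near x; [rewrite ee ltNyr|exists z => //; exact: Tz.1].
    * by move=> x [_ /andP[]].
- pose e := ereal_sup (EFin @` T).
  have e_ub x : T x -> (x%:E <= e)%E by move=> Tx; apply: ereal_sup_ubound; exists x.
  have e_le : (e <= qs A (m + 1))%E.
    by apply: ge_ereal_sup => _ [x [_ /andP[_ h]] <-].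
  case: (pselect (exists2 a, T a & a%:E = e)) => [[a Ta ea]|no].
    have [P eP] := exists_supp false a.
    apply: (one P); first by exists a%:E; exact: Or31.
      by apply: (cover_arrow_ok_P Ta.1).
    move=> x Tx; rewrite eP /=; have := qle_seg Sm Tx.2 Ta.2; rewrite (negbTE o); apply.
    by rewrite -lee_fin ea; exact: e_ub.
  have near x : (x%:E < e)%E -> exists2 z, T z & x < z.
    by move=> /ereal_sup_gt[_ [z Tz <-]]; exists z.
  have lt_e x : T x -> (x%:E < e)%E.
    by move=> Tx; rewrite lt_neqAle e_ub // andbT; apply/eqP => ee; apply: no; exists x.
  move ee : e => e'; case: e' ee => [a| |] ee.
  + have lt x : T x -> qle A x a /\ x < a.
      move=> Tx; have ax : x < a by rewrite -lte_fin -ee; exact: lt_e.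
      split=> //; have := @qle_seg R A m x a Sm; rewrite (negbTE o); apply; last exact: ltW.
        exact: Tx.2.
      rewrite /in_segment -ee e_le andbT; apply: (le_trans _ (e_ub _ Tx)).
      by case/andP: Tx.2.
    have [P eP] := exists_supp_lt (lt _ Tx0).1 (lt _ Tx0).2.
    apply: (one P); first by exists a%:E; exact: Or32.
      apply: (cover_arrow_ok_Pl _ eP) => x ax.
      by have [|z Tz zx] := near x; [rewrite ee lte_fin|exists z => //; exact: Tz.1].
    by move=> x Tx; rewrite eP; exact: lt.
  + have em : qs A (m + 1) = +oo%E by move: e_le; rewrite ee leye_eq => /eqP.
    have eT : [set x | (qs A m <= x%:E)%E] = itv (qs A m, false) (+oo%E, true).
      by apply/seteqP; split=> x; rewrite /itv /below /= ?andbT.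
    have h0 : [set x | (qs A m <= x%:E)%E] x0 by case/andP: Tx0.2.
    apply: (one (mk_supp eT h0)).
    * exists +oo%E; exists (m + 1); rewrite ?addrK //; split=> //; split=> //.
        exact: Sm.2.
      by rewrite odd_idxS.
    * apply: (@cover_arrow_ok_pinf I m) => // x.
      by have [|z Tz zx] := near x; [rewrite ee ltry|exists z => //; exact: Tz.1].
    * by move=> x [_ /andP[]].
  + by have := lt_e _ Tx0; rewrite ee.
Qed.

Lemma cover_segments I m (j : nat) : qidx A m -> qidx A (m + j%:Z) ->
  exists ps : seq (@itvl R),
  (forall P, List.In P ps -> is_proj A P /\ arrow_ok A P I) /\
  (forall x, iset I x -> (qs A m <= x%:E <= qs A (m + j%:Z))%E ->
     exists2 P, List.In P ps & iset P x).
Proof.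
move=> Dm; elim: j => [|j IH] Dj.
  case: (pselect (exists2 x, iset I x & x%:E = qs A m)) => [[x Ix ex]|no].
    have [P eP] := exists_supp false x; exists [:: P]; split.
      move=> Q [<-|//]; split; first by exists x%:E; exact: Or31.
      exact: (cover_arrow_ok_P Ix).
    move=> y Iy; rewrite addr0 => /le_anti ey; exists P; first by left.
    have -> : y = x by apply: EFin_inj; rewrite ex ey.
    by rewrite eP; exact: cmp_refl.
  exists [::]; split=> // y Iy; rewrite addr0 => /le_anti ey.
  by exfalso; apply: no; exists y.
have Dj' : qidx A (m + j%:Z) by apply: (quiver_convex Dm Dj); apply/andP; split; lia.
have ej : m + j.+1%:Z = m + j%:Z + 1 by lia.
have [ps [h1 h2]] := IH Dj'.
have Sj : segment A (m + j%:Z) by split; rewrite // -ej.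
have [qs' [h3 h4]] := cover_segment I Sj.
exists (ps ++ qs')%list; split.
  by move=> P /(@List.in_app_or _ ps qs' P)[/h1|/h3].
move=> x Ix /andP[x1 x2]; case: (leP x%:E (qs A (m + j%:Z))) => [le|/ltW ge].
  have [|P hP Px] := h2 x Ix; first by rewrite x1 le.
  by exists P => //; apply/List.in_or_app; left.
have [|P hP Px] := h4 x Ix; first by rewrite /in_segment ge -ej x2.
by exists P => //; apply/List.in_or_app; right.
Qed.

Lemma lo_index c : cadm A c -> exists2 m, qidx A m &
  forall x, below c x -> (qs A m <= x%:E)%E.
Proof.
case=> n [{}n a Sn /andP[h1 h2]|{}n a Sn /andP[h1 h2]|{}n Sn e|{}n Sn e];
  exists n; try exact: Sn.1; rewrite /below /= => x.
- exact: le_trans (ltW h1).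
- by move=> /ltW; exact: le_trans h1.
- by rewrite e leNye.
- by rewrite ltNge leey.
Qed.

Lemma hi_index c : cadm A c -> exists2 m, qidx A m &
  forall x, ~~ below c x -> (x%:E <= qs A m)%E.
Proof.
case=> n [{}n a Sn /andP[h1 h2]|{}n a Sn /andP[h1 h2]|{}n Sn e|{}n Sn e];
  exists (n + 1); try exact: Sn.2; rewrite /below /= => x.
- by rewrite -ltNge => /ltW le; exact: le_trans h2.
- by rewrite -leNgt => le; exact: le_trans (ltW h2).
- by rewrite leNye.
- by rewrite e leey.
Qed.

(** Admissible ends lie between two indexed elements, so finitely many segments cover the interval,
    and each needs at most one projective. *)
Lemma adm_in_repk I : itv_adm A I -> in_repk (M k A I).
Proof.
move=> [/lo_index[m Dm hm] /hi_index[n Dn hn]].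
have [x Ix] := iset_neq0 I.
have bnd y : iset I y -> (qs A m <= y%:E <= qs A n)%E.
  by move=> /itvlP/andP[h1 h2]; rewrite hm ?hn.
have [j ej] : exists j : nat, n = m + j%:Z.
  have /andP[h1 h2] := bnd x Ix.
  have : ~~ (n < m) by rewrite -(qs_lt Dn Dm) -leNgt (le_trans h1).
  by exists `|n - m|%N; lia.
subst n; have [ps [h1 h2]] := cover_segments I Dm Dn.
by apply: (in_repk_cover h1) => y Iy; apply: h2 => //; exact: bnd.
Qed.

Lemma qle_bounded_lt n x y : qidx A n -> (qs A n < x%:E)%E -> qle A y x \/ qle A x y ->
  (qs A n <= y%:E)%E.
Proof.
move=> Dn nx h; have [m [[Dm Dm1] [/andP[y1 _] /andP[_ x2]]]] :
    exists m, segment A m /\ (in_segment A m y /\ in_segment A m x).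
  by case: h => -[m [Sm h1 h2 _]]; exists m.
apply: le_trans y1; apply: qs_le => //.
by have := lt_le_trans nx x2; rewrite qs_lt // ltzD1.
Qed.

Lemma qle_bounded_gt n x y : qidx A n -> (x%:E < qs A n)%E -> qle A y x \/ qle A x y ->
  (y%:E <= qs A n)%E.
Proof.
move=> Dn nx h; have [m [[Dm Dm1] [/andP[_ y2] /andP[x1 _]]]] :
    exists m, segment A m /\ (in_segment A m y /\ in_segment A m x).
  by case: h => -[m [Sm h1 h2 _]]; exists m.
apply: (le_trans y2); apply: qs_le => //.
by have := le_lt_trans x1 nx; rewrite qs_lt // => h'; rewrite lezD1.
Qed.

(** When [-oo] has no integer index, every segment is bounded below, and a projective reaches at
    most two neighbouring segments. *)
Lemma proj_bounded_lo (P : @itvl R) : is_proj A P ->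
  (forall n, qidx A n -> qs A n <> -oo%E) ->
  exists2 n, qidx A n & forall x, iset P x -> (qs A n <= x%:E)%E.
Proof.
move=> [[a| |] /= h] no.
- have [n Dn nx] := qs_lt_real A a; exists n => //.
  by move=> x; case: h => ->; [|case|case] => xa *; apply: (qle_bounded_lt Dn nx); left.
- case: h => n [[Dn _] en] e; have Sn := seg_pinf Dn en.
  by exists (n - 1); [exact: Sn.1|rewrite e].
- by case: h => n [[Dn _] en]; case: (no n).
Qed.

Lemma proj_bounded_hi (P : @itvl R) : is_proj A P ->
  (forall n, qidx A n -> qs A n <> +oo%E) ->
  exists2 n, qidx A n & forall x, iset P x -> (x%:E <= qs A n)%E.
Proof.
move=> [[a| |] /= h] no.
- have [n Dn nx] := qs_gt_real A a; exists n => //.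
  by move=> x; case: h => ->; [|case|case] => xa *; apply: (qle_bounded_gt Dn nx); left.
- by case: h => n [[Dn _] en]; case: (no n).
- case: h => n [[Dn _] en] e; have Sn := seg_ninf Dn en.
  by exists (n + 1); [exact: Sn.2|rewrite e].
Qed.

Lemma projs_bounded_lo (ps : seq (@itvl R)) : (forall P, List.In P ps -> is_proj A P) ->
  (forall n, qidx A n -> qs A n <> -oo%E) ->
  exists2 n, qidx A n & forall P x, List.In P ps -> iset P x -> (qs A n <= x%:E)%E.
Proof.
move=> H no; elim: ps H => [_|P ps IH H]; first by exists 0 => //; exact: quiver_idx0.
have [n Dn hn] := IH (fun Q hQ => H Q (or_intror hQ)).
have [m Dm hm] := proj_bounded_lo (H P (or_introl erefl)) no.
exists (Num.min m n); first by case: leP.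
move=> Q x [<-|hQ] Qx.
  by apply: le_trans (hm _ Qx); apply: qs_le => //; [case: leP|rewrite ge_min lexx].
by apply: le_trans (hn _ _ hQ Qx); apply: qs_le => //; [case: leP|rewrite ge_min lexx orbT].
Qed.

Lemma projs_bounded_hi (ps : seq (@itvl R)) : (forall P, List.In P ps -> is_proj A P) ->
  (forall n, qidx A n -> qs A n <> +oo%E) ->
  exists2 n, qidx A n & forall P x, List.In P ps -> iset P x -> (x%:E <= qs A n)%E.
Proof.
move=> H no; elim: ps H => [_|P ps IH H]; first by exists 0 => //; exact: quiver_idx0.
have [n Dn hn] := IH (fun Q hQ => H Q (or_intror hQ)).
have [m Dm hm] := proj_bounded_hi (H P (or_introl erefl)) no.
exists (Num.max m n); first by case: leP.
move=> Q x [<-|hQ] Qx.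
  by apply: (le_trans (hm _ Qx)); apply: qs_le => //; [case: leP|rewrite le_max lexx].
by apply: (le_trans (hn _ _ hQ Qx)); apply: qs_le => //; [case: leP|rewrite le_max lexx orbT].
Qed.

(** Finitely many projectives cover the interval. If one of its ends were an infinity without
    integer index, a single indexed element would bound all of them on that side, hence also the
    interval. *)
Lemma in_repk_adm I : in_repk (M k A I) -> itv_adm A I.
Proof.
move=> /in_repk_support[ps [hps cov]]; split.
- have p := proper_clo I; case e: (clo I) p => [[a| |] b] p; first exact: cadm_real.
    by have := clo_clt_chi I; rewrite e /clt /= ltNge leey /= => /andP[_]; rewrite /proper in p;
      case: b e p => // e _ /andP[].
  have {p}-> : b = false by case: b p {e}.
  case: (pselect (exists2 n, qidx A n & qs A n = -oo%E)) => [[n Dn en]|no].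
    by rewrite -en; apply: cadm_left; rewrite ?en.
  exfalso; have [n Dn hn] := projs_bounded_lo hps (fun n Dn en => no (ex_intro2 _ _ n Dn en)).
  have : (qs A n <= lo I)%E.
    by apply: le_ereal_inf_tmp => _ [x Ix <-]; have [P hP Px] := cov x Ix; exact: hn hP Px.
  have -> : lo I = -oo%E by case: e.
  by rewrite leeNy_eq => /eqP en; apply: no; exists n.
- have p := proper_chi I; case e: (chi I) p => [[a| |] b] p; first exact: cadm_real.
    have {p}-> : b = true by case: b p {e}.
    case: (pselect (exists2 n, qidx A n & qs A n = +oo%E)) => [[n Dn en]|no].
      by exists n; rewrite -en; apply: cidx_right; rewrite ?en.
    exfalso; have [n Dn hn] := projs_bounded_hi hps (fun n Dn en => no (ex_intro2 _ _ n Dn en)).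
    have : (hi I <= qs A n)%E.
      by apply: ge_ereal_sup => _ [x Ix <-]; have [P hP Px] := cov x Ix; exact: hn hP Px.
    have -> : hi I = +oo%E by case: e.
    by rewrite leye_eq => /eqP en; apply: no; exists n.
  have [x Ix] := iset_neq0 I.
  have : (x%:E <= hi I)%E by apply: ereal_sup_ubound; exists x.
  have -> : hi I = -oo%E by case: e.
  by [].
Qed.

End InRepk.

(** * Kernels and cokernels *)

Section Decomposition.
Context {R : realType} (k : fieldType) (A : quiver R).
Implicit Types (x y z : R) (U V W Q : rep k A) (I J : @itvl R) (cs : seq (indec k A)).

Lemma dim_M I x : \dim {: M k A I x} = Mdim I x.
Proof. by rewrite dimvf dim_matrix [LHS]mul1n. Qed.

Lemma dim_dsums cs x :
  \dim {: dsums [seq M k A (indec_itv C) | C <- cs] x} =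
  count (fun C : indec k A => `[< iset C x >]) cs.
Proof.
elim: cs => [|C cs IH]; first by rewrite dimvf dim_matrix.
rewrite dimvf [count _ _]/= -IH dimvf.
transitivity (dim (M k A C x : vectType k) +
  dim (dsums [seq M k A (indec_itv D) | D <- cs] x : vectType k))%N; first by [].
by congr addn; rewrite dim_matrix [LHS]mul1n.
Qed.

Lemma iso_dim U V (f : rhom U V) x : is_iso f -> \dim {: U x} = \dim {: V x}.
Proof.
case=> r H; have [h1 h2] := H x.
have k0 : (fullv :&: lker (f x) = 0)%VS.
  apply/eqP; rewrite -subv0; apply/subvP => u; rewrite memv_cap memv_ker => /andP[_ /eqP e].
  by rewrite memv0 -[u]id_lfunE -h1 comp_lfunE e linear0.
rewrite -(limg_dim_eq k0) limg_full // => v; exists (r x v).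
by rewrite -comp_lfunE h2 id_lfunE.
Qed.

Lemma dsums_map0 cs x y :
  (forall C, List.In C cs -> ~ (iset (indec_itv C) x /\ iset (indec_itv C) y)) ->
  rmap (dsums [seq M k A (indec_itv C) | C <- cs]) x y = 0.
Proof.
elim: cs => [//|C cs IH H].
have e0 := IH (fun C' hC' => H C' (or_intror hC')).
apply/lfunP => -[u v]; rewrite zero_lfunE lfunE /= /dsum_map /= e0 zero_lfunE.
congr (_, _); have := H C (or_introl erefl).
have -> : Mmap k C x y = onem k (Mdim C x) (Mdim C y) by [].
move=> no; rewrite onem0 ?zero_lfunE //.
case: (pselect (iset C x)) => [Cx|/Mdim0->]; last by left.
by right; apply: Mdim0 => Cy; apply: no.
Qed.

(* Satisfied by the kernels and cokernels of maps between the M_I. *)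
Definition thin Q (D : set R) : Prop :=
  (forall x, \dim {: Q x} = `[< D x >]) /\
  (forall x y, qle A y x -> D x -> D y -> rmap Q x y <> 0).

Lemma count_In (T : Type) (P : pred T) (s : seq T) (a b : T) :
  List.In a s -> List.In b s -> P a -> P b -> (count P s <= 1)%N -> a = b.
Proof.
have pos (r : seq T) c : List.In c r -> P c -> (0 < count P r)%N.
  by elim: r => //= d r IH [->->//|/IH h /h]; rewrite addn_gt0 => ->; rewrite orbT.
elim: s => //= c s IH [->|ha] [->|hb] Pa Pb //.
- by rewrite Pa => h; have := pos _ _ hb Pb; lia.
- by rewrite Pb => h; have := pos _ _ ha Pa; lia.
- by move=> h; apply: IH => //; lia.
Qed.

Lemma count_gt0_In (T : Type) (P : pred T) (s : seq T) :
  (0 < count P s)%N -> exists2 a, List.In a s & P a.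
Proof.
elim: s => //= c s IH; case: (boolP (P c)) => Pc h; first by exists c; [left|].
by have [a ha Pa] := IH h; exists a; [right|].
Qed.

(** Indecomposables are listed with [List.In], whereas their supports live in an [eqType]; summands
    are therefore compared through their supports. *)
Lemma mem_map_In (T : Type) (S : eqType) (f : T -> S) (s : seq T) (b : S) :
  reflect (exists2 a, List.In a s & b = f a) (b \in map f s).
Proof.
elim: s => [|c s IH] /=; first by constructor => -[].
rewrite in_cons; case: eqP => [->|ne] /=; first by constructor; exists c; [left|].
apply: (iffP IH) => [[a ha e]|[a [<-|ha] e]]; [by exists a; [right|]|by case: ne|].
by exists a.
Qed.

Section Thin.
Variables (Q : rep k A) (D : set R) (cs : seq (indec k A)).
Hypotheses (QD : thin Q D) (Qcs : decomposes Q cs).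

Lemma thin_count x : count (fun C : indec k A => `[< iset C x >]) cs = `[< D x >].
Proof. by case: Qcs => f /(iso_dim x); rewrite dim_dsums QD.1. Qed.

Lemma thin_sub C x : List.In C cs -> iset (indec_itv C) x -> D x.
Proof.
move=> hC Cx; apply: contrapT => nD; have := thin_count x; rewrite (asboolF nD).
move=> c0; have : ~~ has (fun C : indec k A => `[< iset C x >]) cs by rewrite has_count c0.
move: c0 => _; elim: cs hC => //= C' s IH [->|hC]; first by rewrite asboolT.
by rewrite negb_or => /andP[_]; exact: IH.
Qed.

Lemma thin_cover x : D x -> exists2 C, List.In C cs & iset (indec_itv C) x.
Proof.
move=> Dx; have := thin_count x; rewrite asboolT // => e.
have [|C hC /asboolP Cx] := @count_gt0_In _ (fun C : indec k A => `[< iset C x >]) cs.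
  by rewrite e.
by exists C.
Qed.

Lemma thin_unique C C' x : List.In C cs -> List.In C' cs ->
  iset (indec_itv C) x -> iset (indec_itv C') x -> C = C'.
Proof.
move=> hC hC' Cx C'x.
apply: (@count_In _ (fun C : indec k A => `[< iset C x >]) cs) => //; try exact/asboolP.
by rewrite thin_count; case: `[< D x >].
Qed.

(** If no summand contained both ends of an arrow within [D], the map of [Q] along it would vanish;
    and the summand at a point is unique because the dimension there is 1. *)
Lemma thin_step C x y : List.In C cs -> qle A y x -> D x -> D y ->
  (iset (indec_itv C) x <-> iset (indec_itv C) y).
Proof.
move=> hC yx Dx Dy.
have [C' hC' [C'x C'y]] : exists2 C', List.In C' cs &
    iset (indec_itv C') x /\ iset (indec_itv C') y.
  apply: contrapT => no; apply: (QD.2 _ _ yx Dx Dy).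
  have e0 : rmap (dsums [seq M k A (indec_itv C) | C <- cs]) x y = 0.
    by apply: dsums_map0 => C' h hh; apply: no; exists C'.
  case: Qcs => f [r H]; have [h1 _] := H y.
  rewrite -[LHS]comp_lfun1l -h1 -comp_lfunA (rhom_nat f yx) e0.
  by rewrite comp_lfun0l comp_lfun0r.
split=> h; first by rewrite (thin_unique hC hC' h C'x).
by rewrite (thin_unique hC hC' h C'y).
Qed.

Lemma thin_component C x y : List.In C cs -> iset (indec_itv C) x -> x <= y \/ y <= x ->
  (forall z, x <= z <= y \/ y <= z <= x -> D z) -> iset (indec_itv C) y.
Proof.
move=> hC Cx [xy|yx] H.
  apply/(conn (A := A) (P := iset C) xy) => // a b ha hb ab.
  by apply: iff_sym; apply: thin_step => //; apply: H; left.
apply/(conn (A := A) (P := iset C) yx) => // a b ha hb ab.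
by apply: iff_sym; apply: thin_step => //; apply: H; right.
Qed.

Lemma thin_uniq : uniq [seq iset (indec_itv C) | C <- cs].
Proof.
have H x : (count (fun C : indec k A => `[< iset C x >]) cs <= 1)%N.
  by rewrite thin_count; case: `[< D x >].
elim: cs H => //= C s IH H; rewrite IH ?andbT; last first.
  by move=> x; have := H x; lia.
apply/negP => /mem_map_In[C' hC' e]; have [x Cx] := iset_neq0 C.
have := H x; rewrite (asboolT Cx) /= => h.
have C'x : iset C' x by rewrite -e.
suff : (0 < count (fun C : indec k A => `[< iset C x >]) s)%N by lia.
elim: s hC' {IH H h} => //= D' s IH [->|/IH]; first by rewrite asboolT.
by rewrite addn_gt0 => ->; rewrite orbT.
Qed.

(** Cuts in the wrong order give the empty list, so two cuts taken in both orders describe the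
    kernel part and the cokernel part at one end, of which at most one exists. *)
Definition pieces (c d : @cut R) : seq (set R) := if clt c d then [:: itv c d] else [::].

Lemma mem_pieces c d S : (S \in pieces c d) = clt c d && (S == itv c d).
Proof. by rewrite /pieces; case: ifP => _; rewrite ?inE. Qed.

(** The point [z] lies between the two intervals and outside [D], so no summand meets both; by
    [thin_component] a summand meeting one of them is all of it. *)
Lemma thin_pieces c1 d1 c2 d2 z :
  [/\ proper c1, proper d1, proper c2 & proper d2] ->
  (forall x, D x <-> itv c1 d1 x \/ itv c2 d2 x) ->
  below d1 z -> ~~ below c2 z ->
  perm_eq [seq iset (indec_itv C) | C <- cs] (pieces c1 d1 ++ pieces c2 d2).
Proof.
move=> [pc1 pd1 pc2 pd2] HD d1z c2z.
have nDz : ~ D z by case/HD => /andP[]; [rewrite d1z|rewrite (negbTE c2z)].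
have sub1 C x : List.In C cs -> iset (indec_itv C) x -> itv c1 d1 x ->
    iset (indec_itv C) = itv c1 d1.
  move=> hC Cx Lx; apply/seteqP; split=> y.
    move=> Cy; case/HD: (thin_sub hC Cy) => // /andP[c2y _]; exfalso; apply: nDz.
    apply: (thin_sub hC); apply: (iset_itv Cx Cy).
    rewrite (ltW (below_gt d1z (proj2 (andP Lx)))).
    by rewrite (ltW (below_gt c2y c2z)).
  move=> Ly; apply: (thin_component hC Cx).
    by case: (leP x y) => [|/ltW]; [left|right].
  by move=> w [] hw; apply/HD; left; [exact: itv_interval Lx Ly _ hw|exact: itv_interval Ly Lx _ hw].
have sub2 C x : List.In C cs -> iset (indec_itv C) x -> itv c2 d2 x ->
    iset (indec_itv C) = itv c2 d2.
  move=> hC Cx Lx; apply/seteqP; split=> y.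
    move=> Cy; case/HD: (thin_sub hC Cy) => // /andP[_ d1y]; exfalso; apply: nDz.
    apply: (thin_sub hC); apply: (iset_itv Cy Cx).
    rewrite (ltW (below_gt d1z d1y)).
    by rewrite (ltW (below_gt (proj1 (andP Lx)) c2z)).
  move=> Ly; apply: (thin_component hC Cx).
    by case: (leP x y) => [|/ltW]; [left|right].
  by move=> w [] hw; apply/HD; right; [exact: itv_interval Lx Ly _ hw|exact: itv_interval Ly Lx _ hw].
apply: uniq_perm; first exact: thin_uniq.
  rewrite cat_uniq /pieces; case: ifP => l1; case: ifP => l2 //=.
  rewrite orbF andbT inE; apply/eqP => e.
  have [x Lx] := itv_neq0 pc2 pd2 l2; have L1x : itv c1 d1 x by rewrite -e.
  have := below_gt d1z (proj2 (andP L1x)); have := below_gt (proj1 (andP Lx)) c2z.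
  by move=> h1 /(lt_trans h1); rewrite ltxx.
move=> S; rewrite mem_cat !mem_pieces; apply/mem_map_In/idP.
  move=> [C hC ->]; have [x Cx] := iset_neq0 C.
  case/HD: (thin_sub hC Cx) => Lx.
    by rewrite (sub1 C x) // eqxx (itv_clt Lx).
  by rewrite (sub2 C x) // eqxx (itv_clt Lx) orbT.
case/orP => /andP[l /eqP->].
  have [x Lx] := itv_neq0 pc1 pd1 l.
  have [|C hC Cx] := thin_cover (x := x); first by apply/HD; left.
  by exists C => //; rewrite (sub1 C x).
have [x Lx] := itv_neq0 pc2 pd2 l.
have [|C hC Cx] := thin_cover (x := x); first by apply/HD; right.
by exists C => //; rewrite (sub2 C x).
Qed.

End Thin.

Section KerCoker.
Variables (I J : @itvl R) (f : rhom (M k A I) (M k A J)).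
Hypothesis f_neq0 : rhom_nonzero f.

Lemma limg_dim x : \dim (limg (f x)) = `[< iset I x /\ iset J x >].
Proof.
have [_ _ [c c0 fE]] := nonzero_hom f_neq0; rewrite fE.
case: asboolP => [[Ix Jx]|no] /=.
  rewrite limg_full; first by rewrite dim_M (Mdim1 Jx).
  move=> v; exists (onem k (Mdim J x) (Mdim I x) (c^-1 *: v)).
  rewrite scale_lfunE -comp_lfunE onem_comp3 // onem_id ?Mdim_le1 // id_lfunE.
  by rewrite scalerA mulfV // scale1r.
have -> : onem k (Mdim I x) (Mdim J x) = 0.
  apply: onem0; case: (pselect (iset I x)) => [Ix|/Mdim0->]; last by left.
  by right; apply: Mdim0 => Jx; apply: no.
apply/eqP; rewrite scaler0 dimv_eq0 -subv0; apply/subvP => v /memv_imgP[u _ ->].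
by rewrite zero_lfunE mem0v.
Qed.

Lemma ones_neq0 x y : iset I x -> iset I y ->
  exists2 u : M k A I x, rmap (M k A I) x y u <> 0 & True.
Proof.
move=> Ix Iy; exists (const_mx 1) => //= e.
have : onem k (Mdim I x) (Mdim I y) (const_mx 1) = 0 by exact: e.
rewrite lfunE /= => e0; apply: (const_mx1_neq0 (k := k) (Mdim1 Iy)).
move: e0; rewrite (Mdim1 Ix) => <-.
by apply/rowP => i; rewrite !mxE big_ord1 !mxE mulr1.
Qed.

End KerCoker.

Lemma coker_thin I J (f : rhom (M k A I) (M k A J)) Q (g : rhom (M k A J) Q) :
  rhom_nonzero f -> is_coker f g -> thin Q (iset J `\` iset I).
Proof.
move=> f0 H; split=> [x|x y yx [Jx nIx] [Jy nIy] e].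
  have [kg ig] := H x; rewrite -ig.
  have := limg_ker_dim (g x) fullv; rewrite capfv kg limg_dim // dim_M.
  case: (pselect (iset J x)) => Jx; last first.
    by rewrite (Mdim0 Jx) => h; rewrite asboolF => [|[]//]; lia.
  rewrite (Mdim1 Jx); case: (pselect (iset I x)) => Ix.
    by rewrite asboolT // asboolF => [|[]//]; lia.
  by rewrite asboolF => [|[]//]; rewrite asboolT //; lia.
have [u nz _] := ones_neq0 Jx Jy; apply: nz.
(* At [y], outside [I], the image of [f] is zero, so [g y] is injective and the nonzero map of [M_J]
   along the arrow survives in [Q]. *)
have [kg _] := H y; have k0 : lker (g y) == 0%VS.
  by rewrite kg -dimv_eq0 limg_dim // asboolF // => -[].
move/lker0P: k0 => inj; apply: inj; rewrite linear0 -comp_lfunE (rhom_nat g yx) e.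
by rewrite comp_lfun0l zero_lfunE.
Qed.

Lemma ker_thin I J (f : rhom (M k A I) (M k A J)) K (i : rhom K (M k A I)) :
  rhom_nonzero f -> is_ker f i -> thin K (iset I `\` iset J).
Proof.
move=> f0 H; split=> [x|x y yx [Ix nJx] [Iy nJy] e].
  have [ki ii] := H x.
  have := limg_ker_dim (i x) fullv; rewrite capfv ki dimv0 add0n ii => <-.
  have := limg_ker_dim (f x) fullv; rewrite capfv limg_dim // dim_M.
  case: (pselect (iset I x)) => Ix; last first.
    by rewrite (Mdim0 Ix) => h; rewrite (@asboolF ((iset I `\` iset J) x)) => [|[]//]; lia.
  rewrite (Mdim1 Ix); case: (pselect (iset J x)) => Jx.
    by rewrite asboolT // asboolF => [|[]//]; lia.
  by rewrite asboolF => [|[]//]; rewrite asboolT //; lia.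
have [u nz _] := ones_neq0 Ix Iy; apply: nz.
have [_ ii] := H x.
have : u \in limg (i x).
  rewrite ii memv_ker; apply/eqP; have [_ _ [c c0 ->]] := nonzero_hom f0.
  by rewrite onem0 ?scaler0 ?zero_lfunE //; right; exact: Mdim0.
case/memv_imgP => v _ ->; rewrite -comp_lfunE -(rhom_nat i yx) e.
by rewrite comp_lfun0r zero_lfunE.
Qed.

End Decomposition.

(** * Auslander-Reiten sequences and positions *)

Section Pairs.
Context {R : realType} (A : quiver R).
Implicit Types (c d r : @cut R) (m n : int).

(* The pairs of cuts with the same label. *)
Inductive partners : @cut R -> @cut R -> Prop :=
| Pair_mid n (a : R) : segment A n -> (qs A n < a%:E < qs A (n + 1))%E ->
    partners (a%:E, false) (a%:E, true)
| Pair_end n : segment A n -> partners (qs A n, false) (qs A (n + 1), true).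

Lemma pair_first c : cadm A c -> ~~ c.2 -> exists d, partners c d.
Proof.
case=> n [{}n a Sn /andP[h1 h2]|//|{}n Sn e|//] _.
  move: h2; rewrite le_eqVlt => /predU1P[e|h2].
    exists (qs A (n + 1 + 1), true); rewrite e; apply: Pair_end; split; first exact: Sn.2.
    by apply: qidx_succ; rewrite -?e ?ltry //; exact: Sn.2.
  by exists (a%:E, true); apply: (Pair_mid Sn); rewrite h1.
by exists (qs A (n + 1), true); rewrite -e; exact: Pair_end.
Qed.

Lemma pair_second d : cadm A d -> d.2 -> exists c, partners c d.
Proof.
case=> n [//|{}n a Sn /andP[h1 h2]|//|{}n Sn e] _.
  move: h1; rewrite le_eqVlt => /predU1P[e|h1].
    have Dn : qidx A (n - 1) by apply: qidx_pred; rewrite ?e ?ltNyr //; exact: Sn.1.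
    have Sn' : segment A (n - 1) by split; rewrite // subrK; exact: Sn.1.
    by exists (qs A (n - 1), false); have := Pair_end Sn'; rewrite subrK e.
  by exists (a%:E, false); apply: (Pair_mid Sn); rewrite h1.
by exists (qs A n, false); rewrite -e; exact: Pair_end.
Qed.

Lemma pair_adm c d : partners c d -> [/\ cadm A c, cadm A d, clt c d & codd A c = codd A d].
Proof.
case=> [n a Sn /andP[h1 h2]|n Sn].
  have c1 : cidx A (a%:E, false) n by apply: Cidx_left; rewrite // h1 ltW.
  have c2 : cidx A (a%:E, true) n by apply: Cidx_right; rewrite // h2 ltW.
  split; [by exists n|by exists n| |by rewrite (coddE c1) (coddE c2)].
  by rewrite /clt eqxx orbT.
have c1 := cidx_qs_lt Sn; have c2 := cidx_qs_gt Sn.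
split; [by exists (n - 1)|by exists (n + 1)| |].
  by rewrite /clt /= (qs_lt Sn.1 Sn.2) ltrDl ltr01.
by rewrite (coddE c1) (coddE c2) odd_idxB odd_idxS.
Qed.

Lemma pair_snd c d : partners c d -> c.2 = false /\ d.2 = true.
Proof. by case. Qed.

(** Nothing lies between the two sides of a point. Between the outer cuts of a segment [n], which
    have indices [n - 1] and [n + 1], there are only cuts of index [n]. *)
Lemma pair_between c d r : partners c d -> cadm A r -> clt c r -> clt r d ->
  codd A r = ~~ codd A c.
Proof.
case=> [n a Sn _ _|n Sn]; rewrite /clt.
  case/orP => [h1|/and3P[/eqP e _ h1]] /orP[h2|/and3P[/eqP e' h2 _]].
  - by move: (lt_trans h1 h2); rewrite ltxx.
  - by move: h1; rewrite e' ltxx.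
  - by move: h2; rewrite -e ltxx.
  - by rewrite h1 in h2.
rewrite /=.
rewrite (coddE (cidx_qs_lt Sn)) odd_idxB negbK => ar h1 h2.
suff cn : cidx A r n by rewrite (coddE cn).
case: ar h1 h2 => m [{}m a Sm _|{}m a Sm _|{}m Sm _|{}m Sm _] /=.
- rewrite !andbF orbF andbT => h1 h2; apply: Cidx_left => //.
  by rewrite h1 le_eqVlt orbC.
- rewrite !andbT /= andbF orbF => h1 h2; apply: Cidx_right => //.
  by rewrite h2 andbT le_eqVlt orbC.
- by rewrite !andbF orbF ltNge leNye.
- by move=> _; rewrite andbF orbF ltNge leey.
Qed.

Lemma cut_tri c d : [\/ c = d, clt c d | clt d c].
Proof.
case: (pselect (c = d)) => [|/clt_total[]]; [exact: Or31|exact: Or32|exact: Or33].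
Qed.

(* Of two partners, the one which comes first, resp. last, for [lo_le] and [hi_le]. *)
Definition pfst c d := if codd A c then d else c.
Definition psnd c d := if codd A c then c else d.

(** In the order [lo_le] a cut of the other parity never comes between two cuts of one parity, and
    by [pair_between] no cut of their own parity lies between partners. So the second partner
    immediately follows the first; [lo_pred], [hi_succ] and [hi_pred] rest on the same argument. *)
Lemma lo_succ c d r : partners c d -> cadm A r -> lo_le A (pfst c d) r ->
  r <> pfst c d -> lo_le A (psnd c d) r.
Proof.
move=> cd ar; have [ac ad lt e] := pair_adm cd; have btw := pair_between cd ar.
rewrite /pfst /psnd; case: ifP => o H ne.
  case: (cut_tri c r) => [|cr|rc]; [exact: Or31| |by apply: Or33].
  apply: Or32; split=> //; case: (cut_tri r d) => [//|rd|dr].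
    by rewrite (btw cr rd) o.
  exact: lo_le_even H dr.
have cr : clt c r.
  case: (cut_tri c r) => [ec|//|rc]; first by rewrite ec in ne.
  by have := lo_le_odd H rc; rewrite o.
have er := lo_le_even H cr.
case: (cut_tri d r) => [|dr|rd]; [exact: Or31|exact: Or32|].
by rewrite (btw cr rd) o in er.
Qed.

Lemma lo_pred c d r : partners c d -> cadm A r -> lo_le A r (psnd c d) ->
  r <> psnd c d -> lo_le A r (pfst c d).
Proof.
move=> cd ar; have [ac ad lt e] := pair_adm cd; have btw := pair_between cd ar.
rewrite /pfst /psnd; case: ifP => o H ne.
  have cr : clt c r.
    case: (cut_tri c r) => [ec|//|rc]; first by rewrite ec in ne.
    by have := lo_le_even H rc; rewrite o.
  have od := lo_le_odd H cr.
  case: (cut_tri r d) => [|rd|dr]; [exact: Or31| |exact: Or33].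
  by rewrite (btw cr rd) o in od.
case: (cut_tri r c) => [|rc|cr]; [exact: Or31|by apply: Or32; rewrite o|].
apply: Or33; split=> //; case: (cut_tri r d) => [//|rd|dr].
  by rewrite (btw cr rd) o.
exact: lo_le_odd H dr.
Qed.

Lemma hi_succ c d r : partners c d -> cadm A r -> hi_le A (pfst c d) r ->
  r <> pfst c d -> hi_le A (psnd c d) r.
Proof.
move=> cd ar; have [ac ad lt e] := pair_adm cd; have btw := pair_between cd ar.
rewrite /pfst /psnd; case: ifP => o H ne.
  have rd : clt r d.
    case: (cut_tri r d) => [//|//|dr].
    by have := hi_le_even H dr; rewrite -e o.
  have od := hi_le_odd H rd.
  case: (cut_tri c r) => [|cr|rc]; [exact: Or31| |exact: Or33].
  by rewrite (btw cr rd) o in od.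
case: (cut_tri d r) => [|dr|rd]; [exact: Or31|by apply: Or32; rewrite -e o|].
apply: Or33; split=> //; case: (cut_tri c r) => [//|cr|rc].
- by move=> ec; rewrite ec in ne.
- by rewrite (btw cr rd) o.
- exact: hi_le_odd H rc.
Qed.

Lemma hi_pred c d r : partners c d -> cadm A r -> hi_le A r (psnd c d) ->
  r <> psnd c d -> hi_le A r (pfst c d).
Proof.
move=> cd ar; have [ac ad lt e] := pair_adm cd; have btw := pair_between cd ar.
rewrite /pfst /psnd; case: ifP => o H ne.
  case: (cut_tri r d) => [|rd|dr]; [exact: Or31| |by apply: Or33; rewrite -e].
  apply: Or32; split=> //; case: (cut_tri c r) => [|cr|rc].
  - by move=> ec; rewrite ec in ne.
  - by rewrite (btw cr rd) o.
  - exact: hi_le_even H rc.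
have rd : clt r d.
  case: (cut_tri r d) => [//|//|dr].
  by have := hi_le_odd H dr; rewrite -e o.
have er := hi_le_even H rd.
case: (cut_tri r c) => [|rc|cr]; [exact: Or31|exact: Or32|].
by rewrite (btw cr rd) o in er.
Qed.

Lemma lo_le_pair c d : partners c d -> lo_le A (pfst c d) (psnd c d).
Proof.
move=> cd; have [ac ad lt e] := pair_adm cd; rewrite /pfst /psnd; case: ifP => o.
  by apply: Or33; rewrite -e.
by apply: Or32; rewrite -e o.
Qed.

Lemma hi_le_pair c d : partners c d -> hi_le A (pfst c d) (psnd c d).
Proof.
move=> cd; have [ac ad lt e] := pair_adm cd; rewrite /pfst /psnd; case: ifP => o.
  by apply: Or33; rewrite o.
by apply: Or32; rewrite o.
Qed.

Lemma csig_pair c d : partners c d ->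
  csig A (pfst c d) = false /\ csig A (psnd c d) = true.
Proof.
move=> cd; have [ac ad lt e] := pair_adm cd; have [sc sd] := pair_snd cd.
rewrite /pfst /psnd /csig; case: ifP => o; rewrite ?sc ?sd -?e ?o; split=> //.
Qed.

Lemma lo_le_anti c d : lo_le A c d -> lo_le A d c -> c = d.
Proof.
move=> cd dc; case: (cut_tri c d) => // lt.
  by have := lo_le_even cd lt; rewrite (lo_le_odd dc lt).
by have := lo_le_even dc lt; rewrite (lo_le_odd cd lt).
Qed.

Lemma hi_le_anti c d : hi_le A c d -> hi_le A d c -> c = d.
Proof.
move=> cd dc; case: (cut_tri c d) => // lt.
  by have := hi_le_even cd lt; rewrite (hi_le_odd dc lt).
by have := hi_le_even dc lt; rewrite (hi_le_odd cd lt).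
Qed.

(** Cuts of index [n] accumulate at [c] from the right. They have the parity of [c] unless [c] is
    the end [-oo], of index [n - 1]; the second condition is phrased to allow for that end. The
    relation to [csig] is the same in all cases, so finite and infinite ends are treated
    together. *)
Definition germ_right c n : Prop :=
  [/\ odd_idx n = ~~ csig A c,
      forall d, cadm A d -> clt d c -> codd A c = odd_idx n,
      exists2 d, cadm A d & clt c d &
      forall d, cadm A d -> clt c d ->
        exists r, [/\ cidx A r n, clt c r & clt r d]].

Definition germ_left c n : Prop :=
  [/\ odd_idx n = csig A c,
      forall d, cadm A d -> clt c d -> codd A c = odd_idx n,
      exists2 d, cadm A d & clt d c &
      forall d, cadm A d -> clt d c ->
        exists r, [/\ cidx A r n, clt r c & clt d r]].

Lemma right_cut n c d : segment A n -> (qs A n <= c.1 < qs A (n + 1))%E ->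
  (c.1 < d.1)%E -> exists r, [/\ cidx A r n, clt c r & clt r d].
Proof.
move=> Sn /andP[h1 h2] lt.
have lt' : (c.1 < Order.min d.1 (qs A (n + 1)))%E by rewrite lt_min lt h2.
have [w /andP[w1 w2]] := ereal_between lt'.
move: w2; rewrite lt_min => /andP[w2 w3]; exists (w%:E, true); split.
- by apply: Cidx_right => //; rewrite w3 (le_trans h1) ?ltW.
- by rewrite /clt w1.
- by rewrite /clt w2.
Qed.

Lemma left_cut n c d : segment A n -> (qs A n < c.1 <= qs A (n + 1))%E ->
  (d.1 < c.1)%E -> exists r, [/\ cidx A r n, clt r c & clt d r].
Proof.
move=> Sn /andP[h1 h2] lt.
have lt' : (Order.max d.1 (qs A n) < c.1)%E by rewrite gt_max lt h1.
have [w /andP[w1 w2]] := ereal_between lt'.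
move: w1; rewrite gt_max => /andP[w1 w3]; exists (w%:E, false); split.
- by apply: Cidx_left => //; rewrite w3 (le_trans _ h2) ?ltW.
- by rewrite /clt w2.
- by rewrite /clt w1.
Qed.

Lemma germ c : cadm A c -> (exists n, germ_right c n) \/ (exists n, germ_left c n).
Proof.
case=> m cm; have oc := coddE cm; case: cm oc => n.
- move=> a Sn hn oc; right; exists n; split; [by rewrite /csig oc|by []| |].
  + exists (qs A n, false); first by exists (n - 1); exact: cidx_qs_lt.
    by rewrite /clt /=; case/andP: hn => ->.
  + move=> d ad lt; apply: (left_cut Sn) => //.
    by move: lt; rewrite /clt /= !andbF orbF.
- move=> a Sn hn oc; left; exists n; split; [by rewrite /csig oc /= negbK|by []| |].
  + exists (qs A (n + 1), true); first by exists (n + 1); exact: cidx_qs_gt.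
    by rewrite /clt /=; case/andP: hn => _ ->.
  + move=> d ad lt; apply: (right_cut Sn) => //.
    by move: lt; rewrite /clt /= andbF orbF.
- move=> Sn e oc; left; exists n; split.
  + by rewrite /csig oc odd_idxB /= negbK.
  + by move=> d ad; rewrite /clt /= !andbF orbF ltNge leNye.
  + exists (qs A (n + 1), true); first by exists (n + 1); exact: cidx_qs_gt.
    by rewrite /clt /= -e (qs_lt Sn.1 Sn.2) ltrDl ltr01.
  + move=> d ad lt; apply: (right_cut Sn).
      by rewrite /= e lexx -e (qs_lt Sn.1 Sn.2) ltrDl ltr01.
    move: lt; rewrite /clt /= => /orP[//|/andP[/eqP ed d2]].
    by have := cut_ninf ad (esym ed); case=> ed'; rewrite ed' in d2.
- move=> Sn e oc; right; exists n; split.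
  + by rewrite /csig oc odd_idxS /=; case: odd_idx.
  + by move=> d ad; rewrite /clt /= andbF orbF ltNge leey.
  + exists (qs A n, false); first by exists (n - 1); exact: cidx_qs_lt.
    by rewrite /clt /= -e (qs_lt Sn.1 Sn.2) ltrDl ltr01.
  + move=> d ad lt; apply: (left_cut Sn).
      by rewrite /= e lexx andbT -e (qs_lt Sn.1 Sn.2) ltrDl ltr01.
    move: lt; rewrite /clt /= => /orP[//|/and3P[/eqP ed d2 _]].
    by have := cut_pinf ad ed; case=> ed'; rewrite ed' in d2.
Qed.

(** [r] is chosen closer to [c] than [d] and than a candidate neighbour [d'], if the latter lies on
    that side. *)
Lemma germ_right2 c n d d' : germ_right c n -> cadm A d -> cadm A d' -> clt c d ->
  exists r, [/\ cidx A r n, clt c r, clt r d & clt c d' -> clt r d'].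
Proof.
case=> _ _ _ H ad ad' cd.
case: (boolP (clt c d')) => cd'; last first.
  by have [r [h1 h2 h3]] := H d ad cd; exists r.
case: (cut_tri d d') => [e|lt|lt].
- by have [r [h1 h2 h3]] := H d ad cd; exists r; split=> //; rewrite -e.
- have [r [h1 h2 h3]] := H d ad cd; exists r; split=> // _; exact: clt_trans lt.
- have [r [h1 h2 h3]] := H d' ad' cd'; exists r; split=> //; exact: clt_trans lt.
Qed.

Lemma germ_left2 c n d d' : germ_left c n -> cadm A d -> cadm A d' -> clt d c ->
  exists r, [/\ cidx A r n, clt r c, clt d r & clt d' c -> clt d' r].
Proof.
case=> _ _ _ H ad ad' cd.
case: (boolP (clt d' c)) => cd'; last first.
  by have [r [h1 h2 h3]] := H d ad cd; exists r.
case: (cut_tri d d') => [e|lt|lt].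
- by have [r [h1 h2 h3]] := H d ad cd; exists r; split=> //; rewrite -e.
- have [r [h1 h2 h3]] := H d' ad' cd'; exists r; split=> //; exact: clt_trans h3.
- have [r [h1 h2 h3]] := H d ad cd; exists r; split=> // _; exact: clt_trans h3.
Qed.

Lemma clt_neq c d : clt c d -> c <> d.
Proof. by move=> lt e; rewrite e clt_irr in lt. Qed.

(* A cut [c] with [csig c] has no immediate successor for [lo_le] or [hi_le], and
   one with [~~ csig c] has no immediate predecessor. *)
Lemma lo_no_succ c q c' : cadm A c -> cadm A q -> cadm A c' -> clt c q -> csig A c ->
  exists r, [/\ cadm A r, clt r q, r <> c, lo_le A c r &
    ~ (lo_le A c c' /\ c' <> c /\ lo_le A c' r)].
Proof.
move=> ac aq ac' cq s; case: (germ ac) => -[n g]; have [on ex [e ae he] _] := g.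
  have [r [h1 h2 h3 h4]] := germ_right2 g aq ac' cq; have er := coddE h1.
  rewrite on s /= in er.
  exists r; split=> //; [by exists n|exact/nesym/clt_neq|by apply: Or32; rewrite er|].
  case=> l1 [ne l2]; case: (cut_tri c c') => [e1|lt|lt]; first by rewrite e1 in ne.
    by have := lo_le_even l1 lt; rewrite (lo_le_odd l2 (h4 lt)).
  by have := lo_le_odd l1 lt; rewrite (ex _ ac' lt) on s.
have [r [h1 h2 h3 h4]] := germ_left2 g ae ac' he; have er := coddE h1.
rewrite on s in er; have oc := ex _ aq cq; rewrite on s in oc.
exists r; split=> //; [by exists n|exact: clt_trans cq|exact: clt_neq|exact: Or33|].
case=> l1 [ne l2]; case: (cut_tri c c') => [e1|lt|lt]; first by rewrite e1 in ne.
  by have := lo_le_even l1 lt; rewrite (lo_le_odd l2 (clt_trans h2 lt)).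
by have := lo_le_even l2 (h4 lt); rewrite er.
Qed.

Lemma lo_no_pred c q c' : cadm A c -> cadm A q -> cadm A c' -> clt c q -> ~~ csig A c ->
  exists r, [/\ cadm A r, clt r q, r <> c, lo_le A r c &
    ~ (lo_le A c' c /\ c' <> c /\ lo_le A r c')].
Proof.
move=> ac aq ac' cq /negbTE s; case: (germ ac) => -[n g]; have [on ex [e ae he] _] := g.
  have [r [h1 h2 h3 h4]] := germ_right2 g aq ac' cq; have er := coddE h1.
  rewrite on s /= in er.
  exists r; split=> //; [by exists n|exact/nesym/clt_neq|exact: Or33|].
  case=> l1 [ne l2]; case: (cut_tri c c') => [e1|lt|lt]; first by rewrite e1 in ne.
    by have := lo_le_even l2 (h4 lt); rewrite (lo_le_odd l1 lt).
  by have := lo_le_even l1 lt; rewrite (ex _ ac' lt) on s.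
have [r [h1 h2 h3 h4]] := germ_left2 g ae ac' he; have er := coddE h1.
rewrite on s in er; have oc := ex _ aq cq; rewrite on s in oc.
exists r; split=> //; [by exists n|exact: clt_trans cq|exact: clt_neq|by apply: Or32; rewrite oc|].
case=> l1 [ne l2]; case: (cut_tri c c') => [e1|lt|lt]; first by rewrite e1 in ne.
  by have := lo_le_even l2 (clt_trans h2 lt); rewrite (lo_le_odd l1 lt).
by have := lo_le_odd l2 (h4 lt); rewrite er.
Qed.

Lemma hi_no_succ c p c' : cadm A c -> cadm A p -> cadm A c' -> clt p c -> csig A c ->
  exists r, [/\ cadm A r, clt p r, r <> c, hi_le A c r &
    ~ (hi_le A c c' /\ c' <> c /\ hi_le A c' r)].
Proof.
move=> ac ap ac' pc s; case: (germ ac) => -[n g]; have [on ex [e ae he] _] := g.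
  have [r [h1 h2 h3 h4]] := germ_right2 g ae ac' he; have er := coddE h1.
  rewrite on s /= in er; have oc := ex _ ap pc; rewrite on s in oc.
  exists r; split=> //; [by exists n|exact: clt_trans h2|exact/nesym/clt_neq|by apply: Or32; rewrite oc|].
  case=> l1 [ne l2]; case: (cut_tri c c') => [e1|lt|lt]; first by rewrite e1 in ne.
    by have := hi_le_odd l2 (h4 lt); rewrite er.
  by have := hi_le_even l2 (clt_trans lt h2); rewrite (hi_le_odd l1 lt).
have [r [h1 h2 h3 h4]] := germ_left2 g ap ac' pc; have er := coddE h1.
rewrite on s in er.
exists r; split=> //; [by exists n|exact: clt_neq|exact: Or33|].
case=> l1 [ne l2]; case: (cut_tri c c') => [e1|lt|lt]; first by rewrite e1 in ne.
  by have := hi_le_even l1 lt; rewrite (ex _ ac' lt) on s.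
by have := hi_le_even l2 (h4 lt); rewrite (hi_le_odd l1 lt).
Qed.

Lemma hi_no_pred c p c' : cadm A c -> cadm A p -> cadm A c' -> clt p c -> ~~ csig A c ->
  exists r, [/\ cadm A r, clt p r, r <> c, hi_le A r c &
    ~ (hi_le A c' c /\ c' <> c /\ hi_le A r c')].
Proof.
move=> ac ap ac' pc /negbTE s; case: (germ ac) => -[n g]; have [on ex [e ae he] _] := g.
  have [r [h1 h2 h3 h4]] := germ_right2 g ae ac' he; have er := coddE h1.
  rewrite on s /= in er; have oc := ex _ ap pc; rewrite on s in oc.
  exists r; split=> //; [by exists n|exact: clt_trans h2|exact/nesym/clt_neq|exact: Or33|].
  case=> l1 [ne l2]; case: (cut_tri c c') => [e1|lt|lt]; first by rewrite e1 in ne.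
    by have := hi_le_even l2 (h4 lt); rewrite er.
  by have := hi_le_even l1 lt; rewrite (hi_le_odd l2 (clt_trans lt h2)).
have [r [h1 h2 h3 h4]] := germ_left2 g ap ac' pc; have er := coddE h1.
rewrite on s in er.
exists r; split=> //; [by exists n|exact: clt_neq|by apply: Or32; rewrite er|].
case=> l1 [ne l2]; case: (cut_tri c c') => [e1|lt|lt]; first by rewrite e1 in ne.
  by have := hi_le_odd l1 lt; rewrite (ex _ ac' lt) on s.
by have := hi_le_even l1 lt; rewrite (hi_le_odd l2 (h4 lt)).
Qed.

End Pairs.

(** * Auslander-Reiten sequences of intervals *)

Section ARSequences.
Context {R : realType} (k : fieldType) (A : quiver R).
Implicit Types (x y z : R) (E : rep k A) (I J : @itvl R) (V W X N L : indec k A).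

Lemma itvl_eq I J : iset I = iset J -> I = J.
Proof.
case: I J => [S h1 h2] [T h3 h4] /= e; subst T.
by congr Itvl; exact: Prop_irrelevance.
Qed.

Lemma indec_eq V W : iset (indec_itv V) = iset (indec_itv W) -> V = W.
Proof.
case: V W => [I hI] [J hJ] /= /itvl_eq e; subst J.
by congr Indec; exact: Prop_irrelevance.
Qed.

Lemma indec_cuts_eq V W : clo V = clo W -> chi V = chi W -> V = W.
Proof. by move=> e1 e2; apply: indec_eq; rewrite itvlE e1 e2 -itvlE. Qed.

Lemma indec_adm V : itv_adm A V.
Proof. exact: in_repk_adm (indec_in_repk V). Qed.

Lemma exists_indec c d : cadm A c -> cadm A d -> clt c d ->
  exists V : indec k A, clo V = c /\ chi V = d.
Proof.
move=> ac ad cd; pose I := mkitv (cadm_proper ac) (cadm_proper ad) cd.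
have e := @itv_cuts R I c d (cadm_proper ac) (cadm_proper ad) erefl.
have h : itv_adm A I by rewrite /itv_adm e.1 e.2.
by exists (Indec (adm_in_repk k h)).
Qed.

Lemma hom_le V W (f : rhom (M k A V) (M k A W)) : rhom_nonzero f ->
  le_itv A V W /\ meets V W.
Proof.
move=> /nonzero_hom[h m _]; split=> //.
by apply: arrow_ok_le_itv => //; exact: indec_adm.
Qed.

Lemma onem_inj I J x : iset I x -> iset J x ->
  injective (onem k (Mdim I x) (Mdim J x)).
Proof.
move=> Ix Jx; apply: (can_inj (g := onem k (Mdim J x) (Mdim I x))) => u.
by rewrite -comp_lfunE onem_comp3 // onem_id ?Mdim_le1 // id_lfunE.
Qed.

Section Construct.
Variables V1 V2 V3 V4 : indec k A.
Variables (p0 p1 q0 q1 : @cut R).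
Hypotheses (c1 : clo V1 = p0 /\ chi V1 = q0) (c2 : clo V2 = p0 /\ chi V2 = q1)
  (c3 : clo V3 = p1 /\ chi V3 = q0) (c4 : clo V4 = p1 /\ chi V4 = q1).
Hypotheses (p01 : lo_le A p0 p1) (q01 : hi_le A q0 q1) (p_ne : p0 <> p1) (q_ne : q0 <> q1).
Hypotheses (succ_lo : forall r, cadm A r -> lo_le A p0 r -> r <> p0 -> lo_le A p1 r)
  (pred_lo : forall r, cadm A r -> lo_le A r p1 -> r <> p1 -> lo_le A r p0)
  (succ_hi : forall r, cadm A r -> hi_le A q0 r -> r <> q0 -> hi_le A q1 r)
  (pred_hi : forall r, cadm A r -> hi_le A r q1 -> r <> q1 -> hi_le A r q0).

Let lt10 : clt p1 q0. Proof. by case: c3 => <- <-; exact: clo_clt_chi. Qed.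
Let lt01 : clt p0 q1. Proof. by case: c2 => <- <-; exact: clo_clt_chi. Qed.
Let lt00 : clt p0 q0. Proof. by case: c1 => <- <-; exact: clo_clt_chi. Qed.
Let lt11 : clt p1 q1. Proof. by case: c4 => <- <-; exact: clo_clt_chi. Qed.

Let le12 : le_itv A V1 V2.
Proof. by case: c1 c2 => [l1 h1] [l2 h2]; rewrite /le_itv l1 h1 l2 h2; split=> //; exact: Or31. Qed.
Let le13 : le_itv A V1 V3.
Proof. by case: c1 c3 => [l1 h1] [l2 h2]; rewrite /le_itv l1 h1 l2 h2; split=> //; exact: Or31. Qed.
Let le24 : le_itv A V2 V4.
Proof. by case: c2 c4 => [l1 h1] [l2 h2]; rewrite /le_itv l1 h1 l2 h2; split=> //; exact: Or31. Qed.
Let le34 : le_itv A V3 V4.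
Proof. by case: c3 c4 => [l1 h1] [l2 h2]; rewrite /le_itv l1 h1 l2 h2; split=> //; exact: Or31. Qed.

Definition ar_f : rhom (M k A V1) (dsum (M k A V2) (M k A V3)) :=
  rpair (chom 1 (le_itv_arrow_ok le12)) (chom 1 (le_itv_arrow_ok le13)).
(** The sign makes the composite with [ar_f] zero. *)
Definition ar_g : rhom (dsum (M k A V2) (M k A V3)) (M k A V4) :=
  rcopair (chom 1 (le_itv_arrow_ok le24)) (chom (-1) (le_itv_arrow_ok le34)).

Let mem x : [/\ iset V1 x <-> below p0 x && ~~ below q0 x,
  iset V2 x <-> below p0 x && ~~ below q1 x,
  iset V3 x <-> below p1 x && ~~ below q0 x &
  iset V4 x <-> below p1 x && ~~ below q1 x].
Proof.
by split; [case: c1|case: c2|case: c3|case: c4] => <- <-; exact: itvlP.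
Qed.

Let lt_mem x : [/\ below q0 x -> below p1 x, below q1 x -> below p0 x,
  below q0 x -> below p0 x & below q1 x -> below p1 x].
Proof. by split; exact: clt_below. Qed.

Let V1_sub x : iset V1 x -> iset V2 x \/ iset V3 x.
Proof.
have [-> -> -> _] := mem x; have [h1 h2 h3 h4] := lt_mem x.
case: (below p0 x) => // /negbTE q0x; rewrite q0x /= andbT.
by case: (boolP (below p1 x)) => [_|n]; [right|left; apply: contra n; exact: h4].
Qed.

Let V4_sub x : iset V4 x -> iset V2 x \/ iset V3 x.
Proof.
have [_ -> -> ->] := mem x; have [h1 h2 h3 h4] := lt_mem x.
case/andP => p1x q1x; rewrite p1x q1x andbT /=.
by case: (boolP (below p0 x)) => [_|n]; [left|right; apply: contra n; exact: h3].
Qed.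

Let dims x : (Mdim V1 x + Mdim V4 x = Mdim V2 x + Mdim V3 x)%N.
Proof.
have [e1 e2 e3 e4] := mem x; have [h1 h2 h3 h4] := lt_mem x.
rewrite /Mdim (asbool_equiv_eq e1) (asbool_equiv_eq e2) (asbool_equiv_eq e3).
rewrite (asbool_equiv_eq e4) !asboolb.
by case: (below p0 x) (below p1 x) (below q0 x) (below q1 x) h1 h2 h3 h4
  => -[] [] [] h1 h2 h3 h4 //; do ?[by have := h1 isT|by have := h2 isT|
    by have := h3 isT|by have := h4 isT].
Qed.

Lemma dim_dsum_M x : \dim {: dsum (M k A V2) (M k A V3) x} = (Mdim V2 x + Mdim V3 x)%N.
Proof.
rewrite dimvf.
transitivity (dim (M k A V2 x : vectType k) + dim (M k A V3 x : vectType k))%N; first by [].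
by rewrite -!dimvf !dim_M.
Qed.

Lemma lker0_inj (aT rT : vectType k) (f : 'Hom(aT, rT)) :
  (forall u, f u = 0 -> u = 0) -> lker f = 0%VS.
Proof.
move=> H; apply/eqP; rewrite -subv0; apply/subvP => u; rewrite memv_ker => /eqP/H->.
exact: mem0v.
Qed.

Lemma ar_exact : short_exact ar_f ar_g.
Proof.
move=> x.
have k0 : lker (ar_f x) = 0%VS.
  apply: lker0_inj => u; rewrite rpairE => -[]; rewrite /= !scale1r => e2 e3.
  case: (pselect (iset V1 x)) => [h1|no]; last exact: M_zero.
  by case: (V1_sub h1) => h; [apply: (onem_inj h1 h)|apply: (onem_inj h1 h)];
    rewrite linear0.
have img : limg (ar_g x) = fullv.
  apply: limg_full => v.
  case: (pselect (iset V4 x)) => [h4|no]; last first.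
    by exists 0; rewrite linear0 (M_zero v no).
  case: (V4_sub h4) => h.
    have [u hu] := chom_onto (le_itv_arrow_ok le24) v h.
    by exists (u, 0); rewrite rcopairE hu linear0 addr0.
  have [u hu] := chom_onto (le_itv_arrow_ok le34) v h.
  exists (0, - u); rewrite rcopairE linear0 add0r linearN /=.
  by move: hu; rewrite /= scale1r scaleN1r opp_lfunE opprK.
(* Exactness in the middle: the composite is zero, and by [dims] the image of [ar_f] and the kernel
   of [ar_g] have the same dimension. *)
split=> //; apply/esym/eqP; rewrite eqEdim; apply/andP; split.
  apply/subvP => _ /memv_imgP[u _ ->]; rewrite memv_ker rcopairE rpairE /=.
  rewrite !scale1r scaleN1r opp_lfunE -!comp_lfunE !onem_comp3 ?subrr //.
    by move=> a b; exact: le_itv_mid le13 le34 a b.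
  by move=> a b; exact: le_itv_mid le12 le24 a b.
have d1 := limg_ker_dim (ar_f x) fullv; rewrite capfv k0 dimv0 dim_M in d1.
have d2 := limg_ker_dim (ar_g x) fullv; rewrite capfv img dim_M dim_dsum_M in d2.
by have := dims x; lia.
Qed.

Let zero_hom V W (h : rhom (M k A V) (M k A W)) : ~ le_itv A V W -> forall x, h x = 0.
Proof.
move=> no x; apply: contrapT => hx; apply: no; apply: (hom_le (f := h) _).1.
by exists x.
Qed.

Let le21 : ~ le_itv A V2 V1.
Proof.
case: c1 c2 => [l1 h1] [l2 h2]; rewrite /le_itv l1 h1 l2 h2 => -[_ h].
by apply: q_ne; exact: hi_le_anti q01 h.
Qed.
Let le31 : ~ le_itv A V3 V1.
Proof.
case: c1 c3 => [l1 h1] [l2 h2]; rewrite /le_itv l1 h1 l2 h2 => -[h _].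
by apply: p_ne; exact: lo_le_anti p01 h.
Qed.
Let le42 : ~ le_itv A V4 V2.
Proof.
case: c2 c4 => [l1 h1] [l2 h2]; rewrite /le_itv l1 h1 l2 h2 => -[h _].
by apply: p_ne; exact: lo_le_anti p01 h.
Qed.
Let le43 : ~ le_itv A V4 V3.
Proof.
case: c3 c4 => [l1 h1] [l2 h2]; rewrite /le_itv l1 h1 l2 h2 => -[_ h].
by apply: q_ne; exact: hi_le_anti q01 h.
Qed.

Lemma M_id_neq0 I x : iset I x -> (\1%VF : 'Hom(M k A I x, M k A I x)) <> 0.
Proof.
move=> Ix /lfunP/(_ (const_mx 1)); rewrite id_lfunE zero_lfunE.
exact: const_mx1_neq0 (Mdim1 Ix).
Qed.

(** [V2] and [V3] have no nonzero map to [V1], nor [V4] to them, so the sequence does not split. A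
    nonzero map from [V1] to another [X] moves one of the ends, hence moves it at least to the next
    cut; dually for maps to [V4]. *)
Lemma ar_sequence : AR_sequence ar_f ar_g.
Proof.
split; first exact: ar_exact.
- case=> r H; have [x Vx] := iset_neq0 V1; apply: (M_id_neq0 Vx); rewrite -(H x).
  have z2 := zero_hom (rcomp r (rinl _ _)) le21 x.
  have z3 := zero_hom (rcomp r (rinr _ _)) le31 x.
  apply/lfunP => u; rewrite comp_lfunE zero_lfunE [ar_f x u]dsum_splitE linearD.
  have z2' w : r x (rinl _ _ x w) = 0 by rewrite -comp_lfunE; move: z2 => /= ->; rewrite zero_lfunE.
  have z3' w : r x (rinr _ _ x w) = 0 by rewrite -comp_lfunE; move: z3 => /= ->; rewrite zero_lfunE.
  by rewrite -[RHS]addr0; congr (_ + _); [exact: z2'|exact: z3'].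
- case=> s H; have [x Vx] := iset_neq0 V4; apply: (M_id_neq0 Vx); rewrite -(H x).
  have z2 := zero_hom (rcomp (rfst _ _) s) le42 x.
  have z3 := zero_hom (rcomp (rsnd _ _) s) le43 x.
  apply/lfunP => u; rewrite comp_lfunE zero_lfunE [s x u]dsum_splitE linearD.
  have z2' : rfst _ _ x (s x u) = 0 by rewrite -comp_lfunE; move: z2 => /= ->; rewrite zero_lfunE.
  have z3' : rsnd _ _ x (s x u) = 0 by rewrite -comp_lfunE; move: z3 => /= ->; rewrite zero_lfunE.
  by rewrite z2' z3' !linear0 addr0.
- move=> X h ne hn; have [le_X _] := hom_le hn; have [_ _ [c c0 hE]] := nonzero_hom hn.
  have [aX bX] := indec_adm X; have [l1 l2] := le_X; rewrite c1.1 in l1; rewrite c1.2 in l2.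
  (* If the lower cut stays, the upper one moves and the map factors through [V2]; otherwise it
     factors through [V3]. *)
  case: (pselect (clo X = p0)) => [e|nl].
    have nh : chi X <> q0.
      by move=> e2; apply: ne; apply: indec_cuts_eq; rewrite ?c1.1 ?c1.2.
    have le2X : le_itv A V2 X.
      by split; [rewrite c2.1 e; exact: Or31|rewrite c2.2; exact: succ_hi].
    exists (rcomp (chom c (le_itv_arrow_ok le2X)) (rfst _ _)) => x.
    apply/lfunP => u; rewrite comp_lfunE [LHS]comp_lfunE rfstE rpairE hE /=.
    rewrite scale1r !scale_lfunE -comp_lfunE onem_comp3 // => a b.
    exact: le_itv_mid le12 le2X a b.
  have le3X : le_itv A V3 X.
    by split; [rewrite c3.1; exact: succ_lo|rewrite c3.2].
  exists (rcomp (chom c (le_itv_arrow_ok le3X)) (rsnd _ _)) => x.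
  apply/lfunP => u; rewrite comp_lfunE [LHS]comp_lfunE rsndE rpairE hE /=.
  rewrite scale1r !scale_lfunE -comp_lfunE onem_comp3 // => a b.
  exact: le_itv_mid le13 le3X a b.
- move=> X h ne hn; have [le_X _] := hom_le hn; have [_ _ [c c0 hE]] := nonzero_hom hn.
  have [aX bX] := indec_adm X; have [l1 l2] := le_X; rewrite c4.1 in l1; rewrite c4.2 in l2.
  case: (pselect (clo X = p1)) => [e|nl].
    have nh : chi X <> q1.
      by move=> e2; apply: ne; apply: indec_cuts_eq; rewrite ?c4.1 ?c4.2.
    have leX3 : le_itv A X V3.
      by split; [rewrite c3.1 e; exact: Or31|rewrite c3.2; exact: pred_hi].
    exists (rpair (rzero _ _) (chom (- c) (le_itv_arrow_ok leX3))) => x.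
    apply/lfunP => u; rewrite comp_lfunE rcopairE rpairE hE /= zero_lfunE linear0 add0r.
    rewrite scaleN1r opp_lfunE !scale_lfunE linearZ /= scaleNr opprK -comp_lfunE.
    by rewrite onem_comp3 // => a b; exact: le_itv_mid leX3 le34 a b.
  have leX2 : le_itv A X V2.
    by split; [rewrite c2.1; exact: pred_lo|rewrite c2.2].
  exists (rpair (chom c (le_itv_arrow_ok leX2)) (rzero _ _)) => x.
  apply/lfunP => u; rewrite comp_lfunE rcopairE rpairE hE /= zero_lfunE linear0 addr0.
  rewrite scale1r !scale_lfunE linearZ /= -comp_lfunE.
  by rewrite onem_comp3 // => a b; exact: le_itv_mid leX2 le24 a b.
Qed.

End Construct.

Lemma same_loP V W : same_lo V W <-> clo V = clo W.
Proof.
rewrite /same_lo /clo; split=> [[e h]|e].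
  rewrite e; congr (_, _); apply: asbool_equiv_eq.
  by rewrite h.
have el : lo V = lo W by case: e.
split=> //; case: e => _; rewrite el.
case: (pselect (lo W = -oo%E)) => [e _|ne].
  by split=> -[x _ ex]; rewrite ?el e in ex.
by case: asboolP => [[_ h1]|h1]; case: asboolP => [[_ h2]|h2] // _;
  split=> // _; apply: contrapT => h; [apply: h2|apply: h1].
Qed.

Lemma same_hiP V W : same_hi V W <-> chi V = chi W.
Proof.
rewrite /same_hi /chi; split=> [[e h]|e].
  rewrite e; congr (_, _); apply: asbool_equiv_eq.
  by rewrite h.
have el : hi V = hi W by case: e.
split=> //; case: e => _; rewrite el.
case: (pselect (hi W = +oo%E)) => [e _|ne].
  by split=> -[x _ ex]; rewrite ?el e in ex.
move=> eb; have [h1 h2] := asbool_eq_equiv eb.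
by split=> h; [case: (h1 (or_intror h))|case: (h2 (or_intror h))].
Qed.

Section Uniqueness.
Variables V1 V2 V3 V4 : indec k A.
Hypothesis AR : labelled_AR V1 V2 V3 V4.

Let clo2 : clo V2 = clo V1. Proof. by apply/same_loP; case: AR => _ []. Qed.
Let chi3 : chi V3 = chi V1. Proof. by apply/same_hiP; case: AR => _ []. Qed.

(** By exactness the dimensions at every point satisfy V1 + V4 = V2 + V3, which leaves for [V4] only
    the interval with the two other cuts. *)
Lemma AR_V4 : clo V4 = clo V3 /\ chi V4 = chi V2.
Proof.
case: AR => -[f [g [ex _ _ _ _]]] _.
apply: itv_cuts; rewrite ?proper_clo ?proper_chi //; apply/seteqP.
have D x : (Mdim V1 x + Mdim V4 x = Mdim V2 x + Mdim V3 x)%N.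
  have [k0 kg ig] := ex x.
  have := limg_ker_dim (f x) fullv; rewrite capfv k0 dimv0 dim_M => d1.
  have := limg_ker_dim (g x) fullv; rewrite capfv ig dim_M kg dim_dsum_M => d2.
  lia.
have E x : Mdim V4 x = (below (clo V3) x && ~~ below (chi V2) x).
  have := D x; rewrite /Mdim (asbool_equiv_eq (itvlP V1 x)) (asbool_equiv_eq (itvlP V2 x)).
  rewrite (asbool_equiv_eq (itvlP V3 x)) !asboolb clo2 chi3.
  have := @clt_below _ _ _ x (clo_clt_chi V1); have := @clt_below _ _ _ x (clo_clt_chi V2).
  have := @clt_below _ _ _ x (clo_clt_chi V3); rewrite clo2 chi3.
  have b1 : (`[< iset V4 x >] <= 1)%N by case: `[< _ >].
  move: b1; case: (below (clo V1) x) (below (clo V3) x) (below (chi V1) x) (below (chi V2) x)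
    => -[] [] [] b1 h1 h2 h3 //=; try (by have := h1 isT); try (by have := h2 isT);
    try (by have := h3 isT); lia.
split=> x; rewrite /itv /=; have := E x.
  by move=> h Vx; move: h; rewrite (Mdim1 Vx); case: (_ && _).
by move=> h hx; apply: contrapT => /Mdim0; rewrite h hx.
Qed.

Lemma comp_neq0 V W X (f : rhom (M k A V) (M k A W)) (h : rhom (M k A W) (M k A X)) x :
  (h x \o f x)%VF <> 0 ->
  [/\ le_itv A V W, le_itv A W X & W = V -> is_iso f] /\ (W = X -> is_iso h).
Proof.
move=> nz; have fn : rhom_nonzero f.
  by exists x => e; apply: nz; rewrite e comp_lfun0r.
have hn : rhom_nonzero h by exists x => e; apply: nz; rewrite e comp_lfun0l.
split; first split; [exact: (hom_le fn).1|exact: (hom_le hn).1| |].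
  by move=> e; apply: iso_eq fn; rewrite e.
by move=> e; apply: iso_eq hn; rewrite e.
Qed.

(** The map to [X] factors through [f], so its part through [V2] or its part through [V3] is
    nonzero. If that summand were [V1] itself, the component of [f] would be an isomorphism and [f]
    a section. *)
Lemma AR_succ X : le_itv A V1 X -> meets V1 X -> X <> V1 ->
  [/\ le_itv A V1 V2, le_itv A V2 X & V2 <> V1] \/
  [/\ le_itv A V1 V3, le_itv A V3 X & V3 <> V1].
Proof.
move=> le m ne; case: AR => -[f [g [_ nsec _ fac _]]] _.
pose h := chom (1 : k) (le_itv_arrow_ok le).
have hn : rhom_nonzero h by apply: chom_nonzero => //; exact: oner_neq0.
have [h' H] := fac X h ne hn; have [x hx] := hn.
have sum : h x = (((h' x \o rinl _ _ x) \o (rfst _ _ x \o f x)) +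
                  ((h' x \o rinr _ _ x) \o (rsnd _ _ x \o f x)))%VF.
  rewrite -H; apply/lfunP => u; rewrite add_lfunE !comp_lfunE.
  by rewrite {1}[f x u]dsum_splitE linearD.
have nsec2 : ~ is_iso (rcomp (rfst (M k A V2) (M k A V3)) f).
  case=> r Hr; apply: nsec; exists (rcomp r (rfst _ _)) => y.
  by rewrite -(Hr y).1 /= comp_lfunA.
have nsec3 : ~ is_iso (rcomp (rsnd (M k A V2) (M k A V3)) f).
  case=> r Hr; apply: nsec; exists (rcomp r (rsnd _ _)) => y.
  by rewrite -(Hr y).1 /= comp_lfunA.
case: (pselect (((h' x \o rinl _ _ x) \o (rfst _ _ x \o f x))%VF = 0)) => [z|nz].
  right; rewrite z add0r in sum; rewrite sum in hx.
  have [[l1 l2 i1] _] := @comp_neq0 V1 V3 X (rcomp (rsnd _ _) f) (rcomp h' (rinr _ _)) x hx.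
  by split=> // /i1.
left; have [[l1 l2 i1] _] := @comp_neq0 V1 V2 X (rcomp (rfst _ _) f) (rcomp h' (rinl _ _)) x nz.
by split=> // /i1.
Qed.

Lemma AR_pred X : le_itv A X V4 -> meets X V4 -> X <> V4 ->
  [/\ le_itv A X V2, le_itv A V2 V4 & V2 <> V4] \/
  [/\ le_itv A X V3, le_itv A V3 V4 & V3 <> V4].
Proof.
move=> le m ne; case: AR => -[f [g [_ _ nret _ fac]]] _.
pose h := chom (1 : k) (le_itv_arrow_ok le).
have hn : rhom_nonzero h by apply: chom_nonzero => //; exact: oner_neq0.
have [h' H] := fac X h ne hn; have [x hx] := hn.
have sum : h x = (((g x \o rinl _ _ x) \o (rfst _ _ x \o h' x)) +
                  ((g x \o rinr _ _ x) \o (rsnd _ _ x \o h' x)))%VF.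
  rewrite -H; apply/lfunP => u; rewrite add_lfunE !comp_lfunE.
  by rewrite {1}[h' x u]dsum_splitE linearD.
have nret2 : ~ is_iso (rcomp g (rinl (M k A V2) (M k A V3))).
  case=> r Hr; apply: nret; exists (rcomp (rinl _ _) r) => y.
  by rewrite -(Hr y).2 /= comp_lfunA.
have nret3 : ~ is_iso (rcomp g (rinr (M k A V2) (M k A V3))).
  case=> r Hr; apply: nret; exists (rcomp (rinr _ _) r) => y.
  by rewrite -(Hr y).2 /= comp_lfunA.
case: (pselect (((g x \o rinl _ _ x) \o (rfst _ _ x \o h' x))%VF = 0)) => [z|nz].
  right; rewrite z add0r in sum; rewrite sum in hx.
  have [[l1 l2 _] i1] := @comp_neq0 X V3 V4 (rcomp (rsnd _ _) h') (rcomp g (rinr _ _)) x hx.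
  by split=> // /i1.
left; have [[l1 l2 _] i1] := @comp_neq0 X V2 V4 (rcomp (rfst _ _) h') (rcomp g (rinl _ _)) x nz.
by split=> // /i1.
Qed.

Lemma meets_lo c (q : @cut R) V W : clo V = c -> chi V = q -> chi W = q -> meets V W.
Proof.
move=> _ e1 e2; have l1 := clo_clt_chi V; have l2 := clo_clt_chi W.
rewrite e1 in l1; rewrite e2 in l2.
have pq : proper q by rewrite -e1; exact: proper_chi.
have [x vx qx] := clt_between (proper_clo V) pq l1.
have [y wy qy] := clt_between (proper_clo W) pq l2.
case: (leP x y) => [xy|/ltW yx].
  by exists y; split; apply/itvlP; rewrite ?e1 ?e2 ?wy ?qy // (below_le xy vx).
by exists x; split; apply/itvlP; rewrite ?e1 ?e2 ?vx ?qx // (below_le yx wy).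
Qed.

Lemma meets_hi (p : @cut R) V W : clo V = p -> clo W = p -> meets V W.
Proof.
move=> e1 e2; have l1 := clo_clt_chi V; have l2 := clo_clt_chi W.
rewrite e1 in l1; rewrite e2 in l2.
have pp : proper p by rewrite -e1; exact: proper_clo.
have [x px vx] := clt_between pp (proper_chi V) l1.
have [y py wy] := clt_between pp (proper_chi W) l2.
case: (leP x y) => [xy|/ltW yx].
  exists x; split; apply/itvlP; rewrite ?e1 ?e2 px //=.
  by apply: contra wy; exact: below_le.
exists y; split; apply/itvlP; rewrite ?e1 ?e2 py //=.
by apply: contra vx; exact: below_le.
Qed.

(** If, say, the lower cut of [V1] had no immediate successor, there would be an [X] with the same
    upper cut and the lower cut moved so little that [V3] does not come in between. The
    factorisation of the map to [X] would then have to go through [V2] and force [V2 = V1]. *)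
Lemma AR_csig :
  [/\ csig A (clo V1) = false, csig A (chi V1) = false,
      csig A (clo V3) = true & csig A (chi V2) = true].
Proof.
have [a1 b1] := indec_adm V1; have [a2 b2] := indec_adm V2.
have [a3 b3] := indec_adm V3; have [a4 b4] := indec_adm V4.
have [e4 e4'] := AR_V4; have lt4 := clo_clt_chi V4; rewrite e4 e4' in lt4.
split; [apply/negbTE/negP|apply/negbTE/negP|apply/negPn/negP|apply/negPn/negP].
- move=> s; have [r [ar rq ne l no]] := lo_no_succ a1 b1 a3 (clo_clt_chi V1) s.
  have [X [X1 X2]] := exists_indec ar b1 rq.
  have le : le_itv A V1 X by split; rewrite ?X1 // X2; exact: Or31.
  have nX : X <> V1 by move=> e; apply: ne; rewrite -X1 e.
  case: (AR_succ le (meets_lo erefl erefl X2) nX) => -[[l1 l2] [l3 l4] n].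
    rewrite X2 in l4; apply: n; apply: indec_cuts_eq; first exact: clo2.
    exact: hi_le_anti l4 l2.
  apply: no; split=> //; split; last by rewrite -X1.
  by move=> e; apply: n; exact: indec_cuts_eq e chi3.
- move=> s; have [r [ar rq ne l no]] := hi_no_succ b1 a1 b2 (clo_clt_chi V1) s.
  have [X [X1 X2]] := exists_indec a1 ar rq.
  have le : le_itv A V1 X by split; rewrite ?X2 // X1; exact: Or31.
  have nX : X <> V1 by move=> e; apply: ne; rewrite -X2 e.
  case: (AR_succ le (meets_hi erefl X1) nX) => -[[l1 l2] [l3 l4] n].
    apply: no; split=> //; split; last by rewrite -X2.
    by move=> e; apply: n; exact: indec_cuts_eq clo2 e.
  rewrite X1 in l3; apply: n; apply: indec_cuts_eq; last exact: chi3.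
  exact: lo_le_anti l3 l1.
- move=> s; have [r [ar rq ne l no]] := lo_no_pred a3 b2 a1 lt4 s.
  have [X [X1 X2]] := exists_indec ar b2 rq.
  have le : le_itv A X V4 by rewrite /le_itv X1 X2 e4 e4'; split=> //; exact: Or31.
  have nX : X <> V4 by move=> e; apply: ne; rewrite -X1 e.
  case: (AR_pred le (meets_lo erefl X2 e4') nX) => -[[l1 l2] [l3 l4] n].
    apply: no; split; [by rewrite -clo2 -e4|split; last by rewrite -X1 -clo2].
    by move=> e; apply: n; apply: indec_cuts_eq; rewrite ?e4 ?e4' ?clo2.
  rewrite X2 in l2; apply: n; apply: indec_cuts_eq; first by rewrite e4.
  by apply: hi_le_anti l4 _; rewrite e4'.
- move=> s; have [r [ar rq ne l no]] := hi_no_pred b2 a3 b1 lt4 s.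
  have [X [X1 X2]] := exists_indec a3 ar rq.
  have le : le_itv A X V4 by rewrite /le_itv X1 X2 e4 e4'; split=> //; exact: Or31.
  have nX : X <> V4 by move=> e; apply: ne; rewrite -X2 e.
  case: (AR_pred le (meets_hi X1 e4) nX) => -[[l1 l2] [l3 l4] n].
    rewrite X1 in l1; apply: n; apply: indec_cuts_eq; last by rewrite e4'.
    by apply: lo_le_anti l3 _; rewrite e4.
  apply: no; split; [by rewrite -chi3 -e4'|split; last by rewrite -X2 -chi3].
  by move=> e; apply: n; apply: indec_cuts_eq; rewrite ?e4 ?e4' ?chi3.
Qed.

End Uniqueness.

End ARSequences.

(** * Positions as pairs of bits *)

Section Positions.
Context {R : realType} (k : fieldType) (A : quiver R).
Implicit Types (V W : indec k A) (m n : int) (a b : R).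

(** The bits of the lower and the upper cut are coordinates on the diamond: [corner (pos_of i j)] is
    (i + j, j - i). *)
Definition pos_of (i j : bool) : nat :=
  if i then (if j then 4 else 3)%N else (if j then 2 else 1)%N.

Definition vpos V : nat := pos_of (csig A (clo V)) (csig A (chi V)).

Lemma indec_Gamma V : Gamma A V = gpt (lab_lo A (clo V)) (lab_hi A (chi V)).
Proof. by have [h1 h2] := indec_adm V; exact: GammaE. Qed.

Lemma indec_iset V : iset (indec_itv V) = itv (clo V) (chi V).
Proof. exact: itvlE. Qed.

Lemma proj_inj_vpos V p : proj_inj_position V p -> p = vpos V.
Proof.
case=> a; rewrite /vpos; case=> [[e ->]|].
  by have [-> ->] := @full_labels _ A V a false e.
case=> [[e ->]|]; first by have [-> ->] := @right_labels _ A V a false e.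
case=> [[e ->]|]; first by have [-> ->] := @left_labels _ A V a false e.
case=> [[e ->]|]; first by have [-> ->] := @full_labels _ A V a true e.
case=> [[e ->]|[e ->]]; first by have [-> ->] := @right_labels _ A V a true e.
by have [-> ->] := @left_labels _ A V a true e.
Qed.

Lemma is_position_vpos V p : is_position V p -> p = vpos V.
Proof.
have [h1 h2] := indec_adm V; have lt := clo_clt_chi V.
case=> [e|e|q _|V1 V2 V3 V4 q _ _ H h].
- rewrite /vpos; have [-> ->//] : csig A (clo V) = true /\ csig A (chi V) = false.
  by apply: lab_top => //; move: e; rewrite indec_Gamma /=; lra.
- rewrite /vpos; have [-> ->//] : csig A (clo V) = false /\ csig A (chi V) = true.
  by apply: lab_bottom => //; move: e; rewrite indec_Gamma /=; lra.
- exact: proj_inj_vpos.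
- have [s1 s2 s3 s4] := AR_csig H; have [e1 e2] := AR_V4 H.
  case: H => _ [/same_loP e3 /same_hiP e4].
  case: h => -[-> ->]; rewrite /vpos ?e1 ?e2 ?e3 ?e4 ?s1 ?s2 ?s3 ?s4 //.
Qed.

Lemma full_PI V a up : iset V = [set x | cmp A up x a] ->
  exists q, proj_inj_position V q.
Proof.
by case: up => e; [exists 1%N|exists 4%N]; exists a; [do 3 right; left|left].
Qed.

Lemma left_PI V a up : iset V = [set x | cmp A up x a /\ x < a] ->
  exists q, proj_inj_position V q.
Proof.
by case: up => e; [exists 2%N|exists 3%N]; exists a; [do 5 right|do 2 right; left].
Qed.

Lemma right_PI V a up : iset V = [set x | cmp A up x a /\ a < x] ->
  exists q, proj_inj_position V q.
Proof.
by case: up => e; [exists 3%N|exists 2%N]; exists a; [do 4 right; left|right; left].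
Qed.

Lemma clt_real a b s t : clt (a%:E, s) (b%:E, t) -> a <= b.
Proof. by move=> /clt_le; rewrite lee_fin. Qed.

Definition in_pair (c l r : @cut R) : Prop := partners A l r /\ (c = l \/ c = r).

Lemma in_pair_ex c : cadm A c -> exists l r, in_pair c l r.
Proof.
move=> ac; case: (boolP c.2) => h.
  by have [l hl] := pair_second ac h; exists l, c; split=> //; right.
by have [r hr] := pair_first ac h; exists c, r; split=> //; left.
Qed.

Lemma at_cut_mid n a : segment A n -> (qs A n < a%:E < qs A (n + 1))%E -> at_cut A n n a.
Proof. by move=> Sn /andP[h1 h2]; split; rewrite // ?h1 ?h2 ?ltW. Qed.

Lemma at_cut_end n : segment A n -> segment A (n + 1) ->
  exists2 a, qs A (n + 1) = a%:E & at_cut A n (n + 1) a.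
Proof.
move=> Sn Sn1; have h1 : (qs A n < qs A (n + 1))%E by rewrite (qs_lt Sn.1 Sn.2); lia.
have h2 : (qs A (n + 1) < qs A (n + 1 + 1))%E by rewrite (qs_lt Sn1.1 Sn1.2); lia.
case e : (qs A (n + 1)) h1 h2 => [a| |] h1 h2; last 2 first.
- by rewrite ltNge leey in h2.
- by rewrite ltNge leNye in h1.
by exists a => //; split; rewrite // e lexx ?h1 ?h2.
Qed.

(* If V is neither on the boundary nor projective or injective, then the four
   intervals obtained from V by replacing its ends by their partners exist. *)
Lemma pairs_disjoint V pl pr ql qr : ~ on_boundary (Gamma A V) ->
  ~ (exists q, proj_inj_position V q) ->
  in_pair (clo V) pl pr -> in_pair (chi V) ql qr -> clt pr ql.
Proof.
move=> nb nPI [hp ep] [hq eq]; have lt := clo_clt_chi V.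
(* The boundary lines are given by v - u = 0 and v - u = [2 * pi]. *)
have nlab : ~ (lab_lo A (clo V) = lab_hi A (chi V) \/
    lab_hi A (chi V) = lab_lo A (clo V) + 2 * pi).
  rewrite indec_Gamma /on_boundary /gpt /= in nb.
  by case=> e; apply: nb; rewrite e; [right|left]; lra.
have iV := indec_iset V.
(* A pair consists of the two sides of a point or of the outer cuts of a segment. If the pairs at
   the two ends overlap, they belong to a common point, a common segment or adjacent segments, and
   [V] is a projective, an injective or on the boundary. *)
case: hp ep => [n a Sn hn|m Sm] ep; case: hq eq => [n' b Sn' hn'|l Sl] eq.
- case: (boolP (clt (a%:E, true) (b%:E, false))) => // nlt; exfalso.
  have ba : b <= a by rewrite leNgt -lte_fin; apply: contra nlt; rewrite /clt /= => ->.
  have ab : a <= b by case: ep eq lt => -> [] ->; exact: clt_real.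
  have e : a = b by apply/le_anti; rewrite ab.
  subst b; have [e1 e2] : clo V = (a%:E, false) /\ chi V = (a%:E, true).
    by case: ep eq lt => -> [] ->; rewrite /clt /= ltxx ?andbF.
  have [c1 _ c2 _] := pair_adm (Pair_mid Sn hn).
  have h := at_cut_mid Sn hn.
  apply: nlab; rewrite e1 e2 /lab_lo /lab_hi (coddE (cidx_lt h)) (coddE (cidx_gt h)).
  by case: ifP => _; [right|left].
- case: (boolP (clt (a%:E, true) (qs A l, false))) => // nlt; exfalso.
  have la : (qs A l <= a%:E)%E by rewrite leNgt; apply: contra nlt; rewrite /clt /= => ->.
  have eq2 : chi V = (qs A (l + 1), true).
    case: eq => // e; move: lt; rewrite e; case: ep => ->; rewrite /clt /= !andbF orbF ltNge la //.
  have al : (a%:E <= qs A (l + 1))%E.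
    by move: lt; rewrite eq2; case: ep => ->; exact: clt_le.
  have e : n = l.
    have /andP[n1 n2] := hn; have := lt_le_trans n1 al; have := le_lt_trans la n2.
    by rewrite (qs_lt Sl.1 Sn.2) (qs_lt Sn.1 Sl.2); move: nb nlab => _ _; clear; lia.
  subst l; have h := at_cut_mid Sn hn; apply: nPI; rewrite eq2 in iV.
  case: ep => ep; rewrite ep in iV.
    apply: (@full_PI V a (~~ odd_idx n)); rewrite iV (cmp_set _ h).
    by case: odd_idx.
  apply: (@right_PI V a (~~ odd_idx n)); rewrite iV (cmp_set_gt _ h).
  by case: odd_idx.
- case: (boolP (clt (qs A (m + 1), true) (b%:E, false))) => // nlt; exfalso.
  have la : (b%:E <= qs A (m + 1))%E by rewrite leNgt; apply: contra nlt; rewrite /clt /= => ->.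
  have ep2 : clo V = (qs A m, false).
    case: ep => // e; move: lt; rewrite e; case: eq => ->; rewrite /clt /= ?andbF ?orbF ltNge la //.
  have al : (qs A m <= b%:E)%E.
    by move: lt; rewrite ep2; case: eq => ->; exact: clt_le.
  have e : n' = m.
    have /andP[n1 n2] := hn'; have := lt_le_trans n1 la; have := le_lt_trans al n2.
    by rewrite (qs_lt Sm.1 Sn'.2) (qs_lt Sn'.1 Sm.2); clear; lia.
  subst m; have h := at_cut_mid Sn' hn'; apply: nPI; rewrite ep2 in iV.
  case: eq => eq; rewrite eq in iV.
    apply: (@left_PI V b (odd_idx n')); rewrite iV (cmp_set_lt _ h).
    by case: odd_idx.
  apply: (@full_PI V b (odd_idx n')); rewrite iV (cmp_set _ h).
  by case: odd_idx.
- case: (boolP (clt (qs A (m + 1), true) (qs A l, false))) => // nlt; exfalso.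
  have lm : l <= m + 1.
    rewrite leNgt -(qs_lt Sm.2 Sl.1); apply: contra nlt.
    by rewrite /clt /= => ->.
  have full_end : l = m + 1 -> False.
    move=> el; subst l; have [a ea h] := at_cut_end Sm Sl.
    rewrite ea in ep eq; apply: nPI; case: ep => ep; case: eq => eq; rewrite ep eq in iV.
    + apply: (@left_PI V a (odd_idx m)); rewrite iV (cmp_set_lt _ h).
      by rewrite eqxx.
    + apply: (@full_PI V a (odd_idx m)); rewrite iV (cmp_set _ h) odd_idxS.
      by rewrite eqxx; case: odd_idx.
    + by move: lt; rewrite ep eq /clt /= ltxx ?andbF.
    + apply: (@right_PI V a (odd_idx m)); rewrite iV (cmp_set_gt _ h) odd_idxS.
      by case: odd_idx.
  have {lm full_end} lm : l <= m by move: lm full_end; clear; lia.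
  have ep2 : clo V = (qs A m, false).
    case: ep => // e; move: lt; rewrite e; case: eq => ->.
      by rewrite /clt /= ?andbF ?orbF (qs_lt Sm.2 Sl.1); clear -lm; lia.
    by rewrite /clt /= ?andbF ?orbF (qs_lt Sm.2 Sl.2); clear -lm; lia.
  have eq2 : chi V = (qs A (l + 1), true).
    case: eq => // e; move: lt; rewrite e ep2 /clt /= !andbF orbF (qs_lt Sm.1 Sl.1).
    by clear -lm; lia.
  rewrite ep2 eq2 in iV lt nlab.
  have ml : m <= l + 1.
    move: (clt_le lt) => /=; rewrite leNgt (qs_lt Sl.2 Sm.1) -leNgt //.
  have [e|e] : l = m \/ m = l + 1 by clear -lm ml; lia.
    subst l; apply: nlab; have [s1 s2] := segment_bounds Sm.
    rewrite /lab_lo /lab_hi (coddE (cidx_qs_lt Sm)) (coddE (cidx_qs_gt Sm)).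
    rewrite odd_idxB odd_idxS /=; case: (boolP (odd_idx m)) => o /=; [left|right].
      exact: (kappa_odd s1 s2 o).1.
    by rewrite (kappa_even s1 s2 o).1.
  subst m; have [a ea h] := at_cut_end Sl Sm; rewrite ea in iV.
  apply: nPI; apply: (@full_PI V a (~~ odd_idx l)); rewrite iV (cmp_set _ h) odd_idxS.
  by case: odd_idx.
Qed.

(** Away from the special cases, the partners at both ends give the four intervals of an
    Auslander-Reiten sequence containing [V]. *)
Lemma is_position_ex V : exists p, is_position V p.
Proof.
have [h1 h2] := indec_adm V; have lt := clo_clt_chi V.
case: (pselect (on_boundary (Gamma A V))) => [[e|e]|nb].
- by exists 3%N; exact: Position_top.
- by exists 2%N; exact: Position_bottom.
case: (pselect (exists q, proj_inj_position V q)) => [[q hq]|nPI].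
  by exists q; exact: Position_proj_inj.
have [pl [pr hp]] := in_pair_ex h1; have [ql [qr hq]] := in_pair_ex h2.
have dis := pairs_disjoint nb nPI hp hq.
have [hp' ep] := hp; have [hq' eq] := hq.
have [apl apr ltp _] := pair_adm hp'; have [aql aqr ltq _] := pair_adm hq'.
have lt1 := clt_trans ltp dis; have lt2 := clt_trans dis ltq; have lt3 := clt_trans lt1 ltq.
have fs (c d : @cut R) (P : @cut R -> Prop) : P c -> P d -> P (pfst A c d) /\ P (psnd A c d).
  by rewrite /pfst /psnd; case: ifP.
have [ap0 ap1] := fs _ _ _ apl apr; have [aq0 aq1] := fs _ _ _ aql aqr.
set p0 := pfst A pl pr; set p1 := psnd A pl pr; set q0 := pfst A ql qr; set q1 := psnd A ql qr.
have [[l00 l01] [l10 l11]] : (clt p0 q0 /\ clt p0 q1) /\ (clt p1 q0 /\ clt p1 q1).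
  by apply: (fs pl pr (fun c => clt c q0 /\ clt c q1));
    [exact: (fs ql qr (fun d => clt pl d))|exact: (fs ql qr (fun d => clt pr d))].
have [V1 c1] := exists_indec k ap0 aq0 l00; have [V2 c2] := exists_indec k ap0 aq1 l01.
have [V3 c3] := exists_indec k ap1 aq0 l10; have [V4 c4] := exists_indec k ap1 aq1 l11.
have [sp0 sp1] := csig_pair hp'; have [sq0 sq1] := csig_pair hq'.
have pne : p0 <> p1 by move=> e; move: sp0; rewrite -/p0 e /p1 sp1.
have qne : q0 <> q1 by move=> e; move: sq0; rewrite -/q0 e /q1 sq1.
have AR := @ar_sequence R k A V1 V2 V3 V4 p0 p1 q0 q1 c1 c2 c3 c4
  (lo_le_pair hp') (hi_le_pair hq') pne qne
  (fun r => @lo_succ _ _ _ _ r hp') (fun r => @lo_pred _ _ _ _ r hp')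
  (fun r => @hi_succ _ _ _ _ r hq') (fun r => @hi_pred _ _ _ _ r hq').
have lab : labelled_AR V1 V2 V3 V4.
  split; first by do 2 eexists; exact: AR.
  by split; [apply/same_loP; rewrite c1.1 c2.1|apply/same_hiP; rewrite c1.2 c3.2].
have ep' : clo V = p0 \/ clo V = p1.
  by rewrite /p0 /p1 /pfst /psnd; case: ifP => _; case: ep => ->; by [left|right].
have eq' : chi V = q0 \/ chi V = q1.
  by rewrite /q0 /q1 /pfst /psnd; case: ifP => _; case: eq => ->; by [left|right].
case: ep' => ep'; case: eq' => eq'; [exists 1%N|exists 2%N|exists 3%N|exists 4%N];
  apply: (Position_AR nb nPI lab).
- by apply: Or41; split=> //; apply: indec_cuts_eq; rewrite ?c1.1 ?c1.2.
- by apply: Or42; split=> //; apply: indec_cuts_eq; rewrite ?c2.1 ?c2.2.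
- by apply: Or43; split=> //; apply: indec_cuts_eq; rewrite ?c3.1 ?c3.2.
- by apply: Or44; split=> //; apply: indec_cuts_eq; rewrite ?c4.1 ?c4.2.
Qed.

Lemma positionE V : position V = vpos V.
Proof.
apply: is_position_vpos; have [p hp] := is_position_ex V.
exact: (xgetI _ hp).
Qed.

End Positions.

(** * The rectangle *)

Section Slopes.
Context {R : realType} (k : fieldType) (A : quiver R).
Implicit Types (V W : indec k A) (c e : R * R).

Lemma slope_diag c e : e.1 - c.1 = e.2 - c.2 -> c != e -> slope c e = Some 1.
Proof.
case: c e => [x y] [x' y'] /= h; rewrite xpair_eqE /slope /= => ne.
have nx : x == x' = false.
  apply/negbTE; apply: contra ne => /eqP ex.
  by rewrite ex eqxx /=; apply/eqP; lra.
rewrite nx; congr Some; rewrite -h divff // subr_eq0 eq_sym.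
exact: negbT.
Qed.

Lemma slope_antidiag c e : e.1 - c.1 = c.2 - e.2 -> c != e -> slope c e = Some (- 1).
Proof.
case: c e => [x y] [x' y'] /= h; rewrite xpair_eqE /slope /= => ne.
have nx : x == x' = false.
  apply/negbTE; apply: contra ne => /eqP ex.
  by rewrite ex eqxx /=; apply/eqP; lra.
rewrite nx; congr Some; have -> : y' - y = - (x' - x) by lra.
rewrite mulNr divff // subr_eq0 eq_sym.
exact: negbT.
Qed.

(** Corners with a common first bit differ by a multiple of [(1, 1)], and the offset for slope 1 is
    [(1, 1)] itself. *)
Lemma slope2_diag i j j' : slope2_dir (Some 1) (pos_of i j) (pos_of i j') = Some 1 :> option R.
Proof.
rewrite /slope2_dir /=; case: ifP => [_|/negbT ne]; first by rewrite eqxx.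
apply: slope_diag => //; rewrite eqxx.
by case: i j j' {ne} => -[] [] /=; lra.
Qed.

Lemma slope2_antidiag i i' j :
  slope2_dir (Some (- 1)) (pos_of i j) (pos_of i' j) = Some (- 1) :> option R.
Proof.
have n1 : (- 1 == 1 :> R) = false by apply/eqP; lra.
rewrite /slope2_dir /=; case: ifP => [_|/negbT ne]; first by rewrite eqxx orbT.
apply: slope_antidiag => //; rewrite n1 eqxx.
by case: i i' j {ne} => -[] [] /=; lra.
Qed.

Lemma dist0_Gamma V W : (dist V W).1 = 0 -> Gamma A V = Gamma A W.
Proof.
rewrite /dist /=; case: (Gamma A V) (Gamma A W) => [x y] [x' y'] /= /eqP.
rewrite sqrtr_eq0 => h.
have h1 := sqr_ge0 (x - x'); have h2 := sqr_ge0 (y - y').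
have /eqP : (x - x') ^+ 2 = 0 by lra.
have /eqP : (y - y') ^+ 2 = 0 by lra.
by rewrite !sqrf_eq0 !subr_eq0 => /eqP -> /eqP ->.
Qed.

(** A common lower cut means equal u-coordinates and equal first bits. If the images under [Gamma]
    coincide too, the upper cuts are distinct with one label, so their bits differ and the positions
    are adjacent corners of the diamond. *)
Lemma share_lo V W : clo V = clo W -> V <> W ->
  ~ degenerate V W /\ slope_pm11 (seg_slope V W).
Proof.
move=> e ne; have [aV bV] := indec_adm V; have [aW bW] := indec_adm W.
have neh : chi V <> chi W by move=> e'; apply: ne; exact: indec_cuts_eq.
rewrite /degenerate /seg_slope !positionE /vpos e.
case: eqP => [eG|/eqP nG].
  have js : csig A (chi V) <> csig A (chi W).
    apply: lab_hi_inj => //; move: eG; rewrite !indec_Gamma e /gpt => -[]; lra.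
  split.
    rewrite /dist /zdist eG eqxx !positionE /vpos e => -[_].
    by move: js; case: (csig A (chi V)) (csig A (chi W)) (csig A (clo W)) => -[] [].
  left; suff -> : forall i, slope (corner (pos_of i (csig A (chi V))))
      (corner (pos_of i (csig A (chi W)))) = Some (1 : R) by [].
  move=> i; apply: slope_diag.
    by case: i (csig _ _) (csig _ _) => -[] [] /=; lra.
  move: js; case: i (csig _ _) (csig _ _) => -[] [] //= _;
    rewrite xpair_eqE negb_and; apply/orP; left; apply/eqP; lra.
have s1 : slope (Gamma A V) (Gamma A W) = Some 1.
  by apply: slope_diag => //; rewrite !indec_Gamma e /gpt /=; lra.
split.
  by move=> d; move/eqP: nG; apply; apply: dist0_Gamma; rewrite d.
left; rewrite s1; congr (_, _).
by case: ifP => _; exact: slope2_diag.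
Qed.

Lemma share_hi V W : chi V = chi W -> V <> W ->
  ~ degenerate V W /\ slope_pm11 (seg_slope V W).
Proof.
move=> e ne; have [aV bV] := indec_adm V; have [aW bW] := indec_adm W.
have neh : clo V <> clo W by move=> e'; apply: ne; exact: indec_cuts_eq.
rewrite /degenerate /seg_slope !positionE /vpos e.
case: eqP => [eG|/eqP nG].
  have js : csig A (clo V) <> csig A (clo W).
    apply: lab_lo_inj => //; move: eG; rewrite !indec_Gamma e /gpt => -[]; lra.
  split.
    rewrite /dist /zdist eG eqxx !positionE /vpos e => -[_].
    by move: js; case: (csig A (clo V)) (csig A (clo W)) (csig A (chi W)) => -[] [].
  right; suff -> : forall j, slope (corner (pos_of (csig A (clo V)) j))
      (corner (pos_of (csig A (clo W)) j)) = Some (- 1 : R) by [].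
  move=> j; apply: slope_antidiag.
    by case: j (csig _ _) (csig _ _) => -[] [] /=; lra.
  move: js; case: j (csig _ _) (csig _ _) => -[] [] //= _;
    rewrite xpair_eqE negb_and; apply/orP; left; apply/eqP; lra.
have s1 : slope (Gamma A V) (Gamma A W) = Some (- 1).
  by apply: slope_antidiag => //; rewrite !indec_Gamma e /gpt /=; lra.
split.
  by move=> d; move/eqP: nG; apply; apply: dist0_Gamma; rewrite d.
right; rewrite s1; congr (_, _).
by case: ifP => _; exact: slope2_antidiag.
Qed.

End Slopes.

Section Rectangle.
Context {R : realType} (k : fieldType) (A : quiver R).
Implicit Types (c d : @cut R) (I J : @itvl R).

Lemma gpt_shift (I : set R) u v : Gamma A I = gpt u v ->
  Gamma_shift A 1 I = gpt v (u + 2 * pi).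
Proof. by rewrite /Gamma_shift => ->; rewrite /gpt /= expr1z; congr (_, _); lra. Qed.

Lemma Gamma_piece c d : cadm A c -> cadm A d -> clt c d ->
  Gamma A (itv c d) = gpt (lab_lo A c) (lab_hi A d).
Proof.
move=> ac ad cd; pose I := mkitv (cadm_proper ac) (cadm_proper ad) cd.
have [e1 e2] := @itv_cuts R I c d (cadm_proper ac) (cadm_proper ad) erefl.
by have := @GammaE R A I; rewrite e1 e2 => /(_ ac ad).
Qed.

Lemma diff_pieces I J z : iset I z -> iset J z -> forall x,
  (iset J `\` iset I) x <-> itv (clo J) (clo I) x \/ itv (chi I) (chi J) x.
Proof.
move=> /itvlP/andP[pz qz] /itvlP/andP[p'z q'z] x; split.
  case=> /itvlP/andP[p'x q'x] nI.
  case: (boolP (below (clo I) x)) => px; last by left; rewrite /itv /= p'x.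
  right; rewrite /itv /= q'x andbT; apply: contraT => qx; exfalso.
  by apply: nI; apply/itvlP; rewrite px.
case=> /andP[h1 h2]; split.
- apply/itvlP; rewrite h1; apply: contra q'z; apply: below_le.
  exact: ltW (below_gt pz h2).
- by move=> /itvlP; rewrite (negbTE h2).
- apply/itvlP; rewrite h2 andbT; apply: below_le p'z.
  exact: ltW (below_gt h1 qz).
- by move=> /itvlP; rewrite h1 andbF.
Qed.

Variables (I J : @itvl R).
Hypotheses (aI : itv_adm A I) (aJ : itv_adm A J) (IJ : le_itv A I J).

(** With M_J at (u, v) and the shift of M_I at (u', v'), these are the corners (u, v') and (u', v).
    Since [1] exchanges the roles of the labels of [I], each of them depends on one end of the two
    intervals only. *)
Definition left_corner : R * R := gpt (lab_lo A (clo J)) (lab_lo A (clo I) + 2 * pi).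
Definition right_corner : R * R := gpt (lab_hi A (chi I)) (lab_hi A (chi J)).

Definition left_extra := if `[< clo I = clo J >] then [:: left_corner] else [::].
Definition right_extra := if `[< chi I = chi J >] then [:: right_corner] else [::].

(** Exactly one of the three lists is nonempty. The parity in [lo_le] turns the upper label of a cut
    into its lower label: an odd cut adds the [2 * pi] needed for a piece of the cokernel, an even
    one adds nothing, as needed for a shifted piece of the kernel. *)
Lemma left_list : map (Gamma A) (pieces (clo J) (clo I)) ++
  map (Gamma_shift A 1) (pieces (clo I) (clo J)) ++ left_extra = [:: left_corner].
Proof.
case: IJ => lo _; rewrite /pieces /left_extra.
case: (cut_tri (clo I) (clo J)) => [e|lt|lt].
- by rewrite e clt_irr asboolT.
- rewrite (clt_asym lt) lt asboolF => [|/(clt_neq lt)//] /=.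
  rewrite (gpt_shift (Gamma_piece aI.1 aJ.1 lt)) /left_corner; congr [:: gpt _ _].
  by rewrite /lab_hi /lab_lo (negbTE (lo_le_even lo lt)).
- rewrite (clt_asym lt) lt asboolF /= => [|e]; last exact: (clt_neq lt).
  rewrite (Gamma_piece aJ.1 aI.1 lt) /left_corner; congr [:: gpt _ _].
  by rewrite /lab_hi /lab_lo (lo_le_odd lo lt).
Qed.

Lemma right_list : map (Gamma A) (pieces (chi I) (chi J)) ++
  map (Gamma_shift A 1) (pieces (chi J) (chi I)) ++ right_extra = [:: right_corner].
Proof.
case: IJ => _ hi; rewrite /pieces /right_extra.
case: (cut_tri (chi I) (chi J)) => [e|lt|lt].
- by rewrite e clt_irr asboolT.
- rewrite (clt_asym lt) lt asboolF => [|/(clt_neq lt)//] /=.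
  rewrite (Gamma_piece aI.2 aJ.2 lt) /right_corner; congr [:: gpt _ _].
  by rewrite /lab_hi /lab_lo (negbTE (hi_le_even hi lt)).
- rewrite (clt_asym lt) lt asboolF /= => [|e]; last exact: (clt_neq lt).
  rewrite (gpt_shift (Gamma_piece aJ.2 aI.2 lt)) /right_corner; congr [:: gpt _ _].
  by rewrite /lab_hi /lab_lo (hi_le_odd hi lt).
Qed.

(** A common lower end gives v = u + [2 * pi], the line y = [pi / 2]; a common upper end gives u =
    v, the line y = [- (pi / 2)]. *)
Lemma extra_boundary x : List.In x (left_extra ++ right_extra) -> on_boundary x.
Proof.
move=> /(@List.in_app_or _ left_extra right_extra x)[].
  rewrite /left_extra; case: asboolP => [e|] // [<-|//]; left.
  by rewrite /left_corner /gpt e /=; lra.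
rewrite /right_extra; case: asboolP => [e|] // [<-|//]; right.
by rewrite /right_corner /gpt e /=; lra.
Qed.

(** Adding [(s, s)] raises v by [2 * s] and adding [(t, - t)] raises u by [2 * t], so [s] and [t]
    are half the differences of the coordinates of the opposite corners. *)
Lemma rectangle_corners :
  pm1_rectangle (gpt (lab_lo A (clo J)) (lab_hi A (chi J)))
    ((lab_lo A (clo I) + 2 * pi - lab_hi A (chi J)) / 2)
    ((lab_hi A (chi I) - lab_lo A (clo J)) / 2) =
  [:: gpt (lab_lo A (clo J)) (lab_hi A (chi J)); left_corner; right_corner;
      gpt (lab_hi A (chi I)) (lab_lo A (clo I) + 2 * pi)].
Proof.
rewrite /pm1_rectangle /left_corner /right_corner /gpt.
set u := lab_lo A (clo J); set v := lab_hi A (chi J).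
set u' := lab_hi A (chi I); set v' := lab_lo A (clo I) + 2 * pi.
have E (x y : R * R) : x.1 = y.1 -> x.2 = y.2 -> x = y.
  by case: x y => [? ?] [? ?] /= -> ->.
by congr [:: _; _; _; _]; apply: E => /=; lra.
Qed.

End Rectangle.

Lemma addn_shuffle (w v x1 x2 y1 y2 e1 e2 : nat) :
  (w + v + (x1 + x2 + (y1 + y2 + (e1 + e2))) =
   w + (x1 + (y1 + e1) + (x2 + (y2 + e2) + v)))%N.
Proof. lia. Qed.

Section Summands.
Context {R : realType} (k : fieldType) (A : quiver R).

Lemma perm_map_iset (T : eqType) (F : set R -> T) (cs : seq (indec k A)) s :
  perm_eq [seq iset (indec_itv C) | C <- cs] s ->
  perm_eq [seq F (iset (indec_itv C)) | C <- cs] (map F s).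
Proof. by move=> /(perm_map F); rewrite -map_comp. Qed.

Lemma summand_piece (cs : seq (indec k A)) s C :
  perm_eq [seq iset (indec_itv C) | C <- cs] s -> List.In C cs ->
  iset (indec_itv C) \in s.
Proof. by move=> /perm_mem <- hC; apply/mem_map_In; exists C. Qed.

Lemma piece_cuts (C : indec k A) c d : proper c -> proper d ->
  iset (indec_itv C) \in pieces c d -> clo C = c /\ chi C = d.
Proof. by move=> pc pd; rewrite mem_pieces => /andP[_ /eqP]; exact: itv_cuts. Qed.

(** A summand keeps the outer cut of [U] at its end, and [z] lies in [U] but not in the summand. It
    serves the cokernel with the target as [U] and the kernel with the source as [U]. *)
Lemma summand_slope (U C : indec k A) z l1 r2 : iset (indec_itv U) z ->
  proper l1 -> proper r2 -> below l1 z -> ~~ below r2 z ->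
  iset (indec_itv C) \in pieces (clo U) l1 ++ pieces r2 (chi U) ->
  (~ degenerate U C /\ slope_pm11 (seg_slope U C)) /\
  (~ degenerate C U /\ slope_pm11 (seg_slope C U)).
Proof.
move=> Uz p1 p2 l1z r2z; rewrite mem_cat => /orP[] /piece_cuts[||e1 e2];
  rewrite ?proper_clo ?proper_chi //.
- have ne : C <> U.
    by move=> e; have /itvlP/andP[_] := Uz; rewrite -e e2 l1z.
  by split; [apply: share_lo => //; exact: nesym|exact: share_lo].
- have ne : C <> U.
    by move=> e; have /itvlP/andP[] := Uz; rewrite -e e1 (negbTE r2z).
  by split; [apply: share_hi => //; exact: nesym|exact: share_hi].
Qed.

End Summands.

Theorem proposition4p4p2 (R : realType) (k : fieldType) (A : quiver R)
    (V W : indec k A)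
    (Hom_VW : hom_iso_k (M k A V) (M k A W))
    (f : rhom (M k A V) (M k A W)) (f_neq0 : rhom_nonzero f)
    (Q : rep k A) (g : rhom (M k A W) Q) (Qg : is_coker f g)
    (K : rep k A) (i : rhom K (M k A V)) (Ki : is_ker f i)
    (cs ks : seq (indec k A)) (Qcs : decomposes Q cs) (Kks : decomposes K ks) :
  (exists (extra : seq (R * R)) (P : R * R) (s t : R),
     [/\ (forall p, List.In p extra -> on_boundary p),
         (~ is_iso f -> (size extra <= 1)%N) &
         perm_eq
           ([:: Gamma A W; Gamma_shift A 1%R V]
              ++ [seq Gamma A C | C : indec k A <- cs]
              ++ [seq Gamma_shift A 1%R N | N : indec k A <- ks]
              ++ extra)
           (pm1_rectangle P s t)]) /\
  (forall (C : indec k A) (l : set (indec k A)), List.In C cs ->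
     line_segment W C l -> ~ degenerate W C /\ slope_pm11 (seg_slope W C)) /\
  (forall (N : indec k A) (l : set (indec k A)), List.In N ks ->
     line_segment N V l -> ~ degenerate N V /\ slope_pm11 (seg_slope N V)).
Proof.
have [le [z [Vz Wz]]] := hom_le f_neq0.
have aV := indec_adm V; have aW := indec_adm W.
have /itvlP/andP[pz qz] := Vz; have /itvlP/andP[p'z q'z] := Wz.
have pc : perm_eq [seq iset (indec_itv C) | C <- cs]
    (pieces (clo W) (clo V) ++ pieces (chi V) (chi W)).
  apply: (thin_pieces (coker_thin f_neq0 Qg) Qcs (z := z)) => //.
    by split; rewrite ?proper_clo ?proper_chi.
  exact: diff_pieces Vz Wz.
have pk : perm_eq [seq iset (indec_itv N) | N <- ks]
    (pieces (clo V) (clo W) ++ pieces (chi W) (chi V)).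
  apply: (thin_pieces (ker_thin f_neq0 Ki) Kks (z := z)) => //.
    by split; rewrite ?proper_clo ?proper_chi.
  exact: diff_pieces Wz Vz.
split; last split.
- exists (left_extra A V W ++ right_extra A V W).
  exists (gpt (lab_lo A (clo W)) (lab_hi A (chi W))),
    ((lab_lo A (clo V) + 2 * pi - lab_hi A (chi W)) / 2),
    ((lab_hi A (chi V) - lab_lo A (clo W)) / 2); split; last 1 first.
  + rewrite (@rectangle_corners R A V W) -indec_Gamma -(gpt_shift (indec_Gamma V)).
    have /permP hc := perm_map_iset (Gamma A) pc.
    have /permP hk := perm_map_iset (Gamma_shift A 1) pk.
    apply/permP => a; move: (hc a) (hk a) (congr1 (count a) (left_list aV aW le))
      (congr1 (count a) (right_list aV aW le)).
    rewrite !map_cat !count_cat /= ?addn0 => -> -> <- <-.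
    exact: addn_shuffle.
  + by move=> p; exact: extra_boundary.
  (* Two extra points mean that both cuts agree, so the supports are equal and [f] is invertible. *)
  + move=> niso; rewrite size_cat /left_extra /right_extra.
    case: asboolP => [e1|_]; case: asboolP => [e2|_] //=; exfalso; apply: niso.
    by apply: iso_eq f_neq0; rewrite (indec_iset V) (indec_iset W) e1 e2.
- move=> C _ hC _; have hp := summand_piece pc hC.
  by have [] := summand_slope Wz (proper_clo V) (proper_chi V) pz qz hp.
- move=> N _ hN _; have hp := summand_piece pk hN.
  by have [] := summand_slope Vz (proper_clo W) (proper_chi W) p'z q'z hp.
Qed.
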